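(* Let $W$ be a positive definite $n\times n$ matrix. The system $$\dot{x}(t)=\sum_{j=0}^{m}A_{j}x(t-h_{j})$$ is exponentially stable if and only if the Lyapunov condition holds and, for every natural number $r$, $$\mathcal{K}_r>0.$$ Moreover, if the Lyapunov condition holds and the system is unstable, then there exists a natural number $r$ such that $\mathcal{K}_r\not\geqslant 0$. Here $\mathcal{K}_1=U(0)$ and, for $r=2,3,\ldots$, $$\mathcal{K}_r=\left[U\left(\frac{j-i}{r-1}H\right)\right]_{i,j=1}^r,$$ where $U$ is the delay Lyapunov matrix of the system associated with $W$.
   Context: System: $A_0,\ldots,A_m$ are real constant $n\times n$ matrices, $h_0=0$, $h_1,\ldots,h_m>0$ are delays, $H=\max\{h_1,\ldots,h_m\}$, and at least one $A_k$ with $k\in\{1,\ldots,m\}$ is nonzero. For a piecewise continuous initial function $\varphi:[-H,0]\to\mathbb{R}^n$, the solution $x(t,\varphi)$, $t\geqslant -H$, is the function that is continuous on $[0,\infty)$, satisfies the system almost everywhere on $[0,\infty)$, and equals $\varphi$ on $[-H,0]$. Norms: $\|\cdot\|$ is the Euclidean norm (induced norm for matrices), $\|\varphi\|_H=\sup_{\theta\in[-H,0]}\|\varphi(\theta)\|$. Exponential stability: there exist $\gamma\geqslant 1$, $\sigma>0$ with $\|x(t,\varphi)\|\leqslant\gamma e^{-\sigma t}\|\varphi\|_H$ for all $t\geqslant 0$ and all piecewise continuous $\varphi$. ''Stable'' means exponentially stable; ''unstable'' means not exponentially stable. Lyapunov condition: the system has no eigenvalues symmetric with respect to zero, i.e.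 there are no two roots $s_1,s_2$ (possibly equal) of $\det\left(sI_n-\sum_{j=0}^m e^{-sh_j}A_j\right)=0$ with $s_1+s_2=0$. Delay Lyapunov matrix associated with a positive definite matrix $W$: the function $U:\mathbb{R}\to\mathbb{R}^{n\times n}$ such that (1) $U$ is continuous; (2) $U'(\tau)=\sum_{j=0}^mU(\tau-h_j)A_j$ for $\tau>0$; (3) $U(\tau)=U^T(-\tau)$ for $\tau\in\mathbb{R}$; (4) $\sum_{j=0}^m\left(U(-h_j)A_j+A_j^TU(h_j)\right)=-W$. Under the Lyapunov condition it exists and is unique. $[B_{ij}]_{i,j=1}^r$ denotes the square block matrix whose block in row $i$, column $j$ is $B_{ij}$; $B>0$ (resp. $B\not\geqslant 0$) means that the symmetric matrix $B$ is positive definite (resp. not positive semidefinite). *)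

(* Defs.v *)
(* MathComp / MathComp-Analysis *)
From HB Require Import structures.
From mathcomp Require Import all_boot all_order all_algebra.
From mathcomp Require Import all_classical all_reals all_analysis.
From mathcomp Require Import complex.

Set Implicit Arguments.
Unset Strict Implicit.
Unset Printing Implicit Defensive.

Import Order.TTheory GRing.Theory Num.Theory.
Import numFieldNormedType.Exports.

Local Open Scope classical_set_scope.
Local Open Scope ring_scope.
Local Open Scope complex_scope.

Section LinearAlgebra.
Variable R : realType.

(* The library norm on matrices is the max norm, hence this one. *)
Definition enorm n (v : 'cV[R]_n) : R := Num.sqrt (\sum_i v i 0 ^+ 2).

Definition posdefmx n (M : 'M[R]_n) : Prop :=
  M^T = M /\ forall v : 'cV[R]_n, v != 0 -> 0 < (v^T *m M *m v) 0 0.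

Definition possemidefmx n (M : 'M[R]_n) : Prop :=
  M^T = M /\ forall v : 'cV[R]_n, 0 <= (v^T *m M *m v) 0 0.

Definition cexp (z : R[i]) : R[i] :=
  (expR (complex.Re z))%:C * (cos (complex.Im z) +i* sin (complex.Im z)).

End LinearAlgebra.

Section Functions.
Variables (R : realType) (V : normedModType R).

(* Finitely many discontinuities, all of the first kind; only the values of f
   on [a, b] matter, and f may jump at a and at b. *)
Definition piecewise_continuous (a b : R) (f : R -> V) : Prop :=
  [/\ exists D : seq R, forall t, a < t < b -> t \notin D ->
        {for t, continuous f},
      forall t, a <= t < b -> cvg (f s @[s --> t^'+]) &
      forall t, a < t <= b -> cvg (f s @[s --> t^'-])].

Definition absolutely_continuous (a b : R) (f : R -> V) : Prop :=
  forall e : R, 0 < e -> exists2 d : R, 0 < d &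
    forall (N : nat) (u v : 'I_N -> R),
      (forall i, a <= u i /\ u i <= v i /\ v i <= b) ->
      (forall i j, i != j -> v i <= u j \/ v j <= u i) ->
      \sum_i (v i - u i) < d -> \sum_i `|f (v i) - f (u i)| < e.

End Functions.

(* The system is x'(t) = \sum_(j < m.+1) A j *m x (t - h j), with h ord0 = 0. *)
Section DelaySystem.
Variables (R : realType) (n m : nat).
Variables (A : 'I_m.+1 -> 'M[R]_n) (h : 'I_m.+1 -> R).

Definition max_delay : R := \big[Num.max/0]_(k | k != ord0) h k.

Definition init_norm (phi : R -> 'cV[R]_n) : R :=
  sup [set enorm (phi t) | t in `[- max_delay, 0]].

(* Absolute continuity (Caratheodory solutions) is required: mere continuity
   together with the equation almost everywhere does not determine x, as singular
   (Cantor-type) perturbations would be allowed. Only the values of phi on [-H, 0]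
   and of x on [-H, +oo) matter. *)
Definition is_solution (phi x : R -> 'cV[R]_n) : Prop :=
  [/\ {within `[0, +oo[, continuous x},
      forall T : R, 0 < T -> absolutely_continuous 0 T x,
      {ae @lebesgue_measure R, forall t : R, 0 <= t ->
        is_derive t 1 x (\sum_j A j *m x (t - h j))} &
      forall t : R, - max_delay <= t <= 0 -> x t = phi t].

Definition exponentially_stable : Prop :=
  exists gamma sigma : R, [/\ 1 <= gamma, 0 < sigma &
    forall phi x : R -> 'cV[R]_n,
      piecewise_continuous (- max_delay) 0 phi -> is_solution phi x ->
      forall t, 0 <= t ->
        enorm (x t) <= gamma * expR (- (sigma * t)) * init_norm phi].

Definition is_eigenvalue (s : R[i]) : Prop :=
  \det (s%:M - \sum_j cexp (- (s * (h j)%:C)) *: map_mx (real_complex R) (A j))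
    = 0.

Definition lyapunov_condition : Prop :=
  ~ exists s1 s2 : R[i], [/\ is_eigenvalue s1, is_eigenvalue s2 & s1 + s2 = 0].

Definition is_delay_lyapunov_matrix (W : 'M[R]_n) (U : R -> 'M[R]_n) : Prop :=
  [/\ continuous U,
      forall t : R, 0 < t -> is_derive t 1 U (\sum_j U (t - h j) *m A j),
      forall t, U t = (U (- t))^T &
      \sum_j (U (- h j) *m A j + (A j)^T *m U (h j)) = - W].

(* For r = 1 the only block is U 0, since (0 - 0) / 0 = 0. *)
Definition Kmx (U : R -> 'M[R]_n) (r : nat) : 'M[R]_(\sum_(i < r) n) :=
  \mxblock_(i < r, j < r) U ((j%:R - i%:R) / (r%:R - 1) * max_delay).

End DelaySystem.

(* Main.v *)
(** The fundamental matrix K (K = 0 on the negative axis, K(0) = I) solves the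
    delay equation from both sides.  Everything rests on one identity: if
    z' = sum_j z(. - h_j) A_j + r and y' = sum_j A_j y(. - h_j), then the
    functional
      z(u - t) y(t) + sum_j int_(t - h_j)^t z(u - s - h_j) A_j y(s) ds
    of t has derivative - r(u - t) y(t).

    The defining properties of the delay Lyapunov matrix U give
    U'(t) = sum_j U(t - h_j) A_j + K(-t)^T W for all t <> 0, so the identity
    with z = U, y = K yields
      U(s) = U(s - T) K(T) + (memory term) + int_0^T K(t - s)^T W K(t) dt.

    If the system is stable, K tends to 0, the first two terms vanish in the
    limit and the quadratic form of K_r is the integral of y^T W y for a nonzero
    combination y of translates of K: hence K_r > 0.  A stable system has no
    eigenvalue with nonnegative real part, which gives the Lyapunov condition.

    Conversely, the state of K at time T is a measure on [T, T + H]; lumping it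
    on the grid of K_r and using that every K_r is positive semidefinite shows
    that int_0^T K^T W K <= U(0) for all T.  So K is square integrable, hence
    tends to 0, and variation of constants then contracts every solution. *)
Require Import Defs.
From HB Require Import structures.
From mathcomp Require Import all_boot all_order all_algebra.
From mathcomp Require Import all_classical all_reals all_analysis.
From mathcomp Require Import complex.
From mathcomp Require Import measurable_realfun ring lra.

Set Implicit Arguments.
Unset Strict Implicit.
Unset Printing Implicit Defensive.

Import Order.TTheory GRing.Theory Num.Theory.
Import numFieldNormedType.Exports.

Local Open Scope classical_set_scope.
Local Open Scope ring_scope.

(** * Derivatives and matrices *)

Section Derivatives.
Variables (R : realType) (V : normedModType R).
Implicit Types (f g : R -> V) (t : R) (l : V).

(** Two gaps in regularity shape the proof. [Kfun] jumps at 0, and what is built from it is only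
    piecewise continuous. So integrals are increments of primitives, and an integral identity says
    that a continuous function has zero derivative off a finite set; the continuous companion
    [1%:M + Klim] replaces [Kfun] on the nonnegative axis. A solution, in turn, satisfies its
    equation only almost everywhere. Absolute continuity still gives a mean value inequality, hence
    a priori bounds; after time H the right-hand side is continuous, the equation holds everywhere,
    and variation of constants is started there. W enters through the jump of U' at 0: the algebraic
    property of U reads U'(0+) - U'(0-) = -W. The defect of U in the equation valid on the other
    half-line starts from W and solves the equation of K, so it equals W K. The converse uses only
    semidefiniteness of the blocks, so the claim on unstable systems is its contrapositive. No decay
    rate of K is needed: once K is small on a window of length H, every solution contracts by a
    fixed factor per period. *)

Lemma is_deriveP f t l : is_derive t 1 f l <->
  forall e, 0 < e -> exists2 d, 0 < d &
    forall s, `|s - t| < d -> `|f s - f t - (s - t) *: l| <= e * `|s - t|.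
Proof.
split=> [[df <-] e e0|H].
  have /derivable1P := df; rewrite /derivable => /cvg_ex [l' Hl'].
  have Hl : h^-1 *: (f (h *: 1 + t) - f t) @[h --> 0^'] --> 'D_1 f t by exact: df.
  move/cvgrPdist_le: Hl => /(_ e e0)[d /= d0 Hd]; exists d => // s st.
  have [->|sneq] := eqVneq s t.
    by rewrite !subrr scale0r subr0 !normr0 mulr0.
  have st0 : s - t != 0 by rewrite subr_eq0.
  have st' : ball_ Num.norm 0 d (s - t) by rewrite /ball_/= sub0r normrN.
  have := Hd (s - t) st' st0; rewrite [_ *: 1]mulr1 subrK distrC => He.
  have -> : f s - f t - (s - t) *: 'D_1 f t =
      (s - t) *: ((s - t)^-1 *: (f s - f t) - 'D_1 f t).
    by rewrite scalerBr scalerA divff// scale1r.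
  by rewrite normrZ mulrC ler_wpM2r.
have Hl : h^-1 *: (f (h *: 1 + t) - f t) @[h --> 0^'] --> l.
  apply/cvgrPdist_le => e e0; have [d d0 Hd] := H e e0.
  exists d => // h /=; rewrite sub0r normrN => hd h0.
  have := Hd (h + t); rewrite addrK => /(_ hd) He.
  rewrite [_ *: 1]mulr1 distrC.
  have -> : h^-1 *: (f (h + t) - f t) - l = h^-1 *: (f (h + t) - f t - h *: l).
    by rewrite [RHS]scalerBr scalerA mulVf// scale1r.
  by rewrite normrZ normfV mulrC ler_pdivrMr ?normr_gt0.
apply: DeriveDef; first by apply/cvg_ex; exists l.
exact/cvg_lim.
Qed.

Lemma is_derive_continuous f t l : is_derive t 1 f l -> {for t, continuous f}.
Proof. by move=> [df _]; apply/differentiable_continuous/derivable1_diffP. Qed.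

Lemma is_derive_near f g t l e : 0 < e ->
  (forall s, `|s - t| < e -> f s = g s) -> is_derive t 1 f l -> is_derive t 1 g l.
Proof.
move=> e0 fg; apply: near_eq_is_derive; exists e => // s /=.
by rewrite distrC => /fg.
Qed.

Lemma is_derive_affine f t l (c : R) :
  is_derive (t - c) 1 f l -> is_derive t 1 (fun s => f (s - c)) l.
Proof.
move=> /is_deriveP H; apply/is_deriveP => e /H[d d0 Hd]; exists d => // s sd.
have E : s - c - (t - c) = s - t by ring.
by have := Hd (s - c); rewrite E; apply.
Qed.

Lemma is_derive_reflect f t l (c : R) :
  is_derive (c - t) 1 f l -> is_derive t 1 (fun s => f (c - s)) (- l).
Proof.
move=> /is_deriveP H; apply/is_deriveP => e /H[d d0 Hd]; exists d => // s sd.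
have E : c - s - (c - t) = - (s - t) by ring.
by have := Hd (c - s); rewrite E normrN scaleNr scalerN; apply.
Qed.

Lemma continuous_distP f t : {for t, continuous f} <->
  forall e, 0 < e -> exists2 d, 0 < d & forall s, `|s - t| < d -> `|f s - f t| <= e.
Proof.
split=> [/cvgrPdist_le H e /H[d /= d0 Hd]|H].
  by exists d => // s st; rewrite distrC; apply: Hd; rewrite /= distrC.
apply/cvgrPdist_le => e /H[d d0 Hd]; exists d => // s /=.
by rewrite distrC => /Hd; rewrite distrC.
Qed.

Lemma continuous_addf f g t : {for t, continuous f} -> {for t, continuous g} ->
  {for t, continuous (fun s => f s + g s)}.
Proof. exact: continuousD. Qed.

Lemma continuous_subf f g t : {for t, continuous f} -> {for t, continuous g} ->
  {for t, continuous (fun s => f s - g s)}.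
Proof. exact: continuousB. Qed.

Lemma is_derive_addf f g t l (l' : V) : is_derive t 1 f l -> is_derive t 1 g l' ->
  is_derive t 1 (fun s => f s + g s) (l + l').
Proof. exact: is_deriveD. Qed.

Lemma is_derive_subf f g t l (l' : V) : is_derive t 1 f l -> is_derive t 1 g l' ->
  is_derive t 1 (fun s => f s - g s) (l - l').
Proof. exact: is_deriveB. Qed.

Lemma is_derive_scalef (c : R) f t l : is_derive t 1 f l ->
  is_derive t 1 (fun s => c *: f s) (c *: l).
Proof. exact: is_deriveZ. Qed.

Lemma continuous_reflect f t (c : R) :
  {for c - t, continuous f} -> {for t, continuous (fun s => f (c - s))}.
Proof.
move=> /continuous_distP ct; apply/continuous_distP => e /ct[d d0 Hd].
exists d => // s; rewrite distrC => sd; apply: Hd.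
by rewrite (_ : _ - _ = t - s)//; ring.
Qed.

Lemma continuous_affine f t (c : R) :
  {for t - c, continuous f} -> {for t, continuous (fun s => f (s - c))}.
Proof.
move=> /continuous_distP ct; apply/continuous_distP => e /ct[d d0 Hd].
exists d => // s sd; apply: Hd.
by rewrite (_ : _ - _ = s - t)//; ring.
Qed.

End Derivatives.

Section Matrices.
Variable R : realType.

Lemma mx_norm_leP p q (M : 'M[R]_(p, q)) (c : R) : 0 <= c ->
  (forall i j, `|M i j| <= c) <-> `|M| <= c.
Proof.
move=> c0; rewrite {2}/Num.Def.normr/= mx_normrE; split=> H.
  by apply: bigmax_le => // -[i j] _ /=.
by move=> i j; apply: le_trans H; exact: (le_bigmax _ _ (i, j)).
Qed.

Lemma ler_mx_entry p q (M : 'M[R]_(p, q)) i j : `|M i j| <= `|M|.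
Proof. by move: i j; apply/mx_norm_leP. Qed.

Lemma ler_norm_mulmx p n q (M : 'M[R]_(p, n)) (N : 'M[R]_(n, q)) :
  `|M *m N| <= n%:R * `|M| * `|N|.
Proof.
apply/mx_norm_leP; first by rewrite !mulr_ge0.
move=> i j; rewrite mxE (le_trans (ler_norm_sum _ _ _))//.
have -> : n%:R * `|M| * `|N| = \sum_(k < n) `|M| * `|N|.
  by rewrite sumr_const card_ord mulr_natl mulrnAl.
apply: ler_sum => k _.
by rewrite normrM ler_pM// ler_mx_entry.
Qed.

Lemma norm_trmx p q (M : 'M[R]_(p, q)) : `|M^T| = `|M|.
Proof.
apply/eqP; rewrite eq_le; apply/andP; split; apply/mx_norm_leP => // i j.
  by rewrite mxE ler_mx_entry.
by have := ler_mx_entry M^T j i; rewrite mxE.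
Qed.

Lemma is_derive_mxP p q (F : R -> 'M[R]_(p, q)) (t : R) F' :
  is_derive t 1 F F' <-> forall i j, is_derive t 1 (fun s => F s i j) (F' i j).
Proof.
split=> [[dF <-] i j|H].
  by rewrite (derive_mx dF) mxE; apply/derivableP; move/derivable_mxP: dF; exact.
have dF : derivable F t 1 by apply/derivable_mxP => i j; have [] := H i j.
apply: DeriveDef => //; rewrite (derive_mx dF); apply/matrixP => i j.
by rewrite mxE; have [_ ->] := H i j.
Qed.

Lemma continuous_mxP p q (F : R -> 'M[R]_(p, q)) t :
  {for t, continuous F} <-> forall i j, {for t, continuous (fun s => F s i j)}.
Proof.
split=> [/continuous_distP H i j|H].
  apply/continuous_distP => e /H[d d0 Hd]; exists d => // s /Hd; apply: le_trans.
  by have := ler_mx_entry (F s - F t) i j; rewrite !mxE.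
apply/cvgrPdist_le => e e0; near=> s.
apply/mx_norm_leP; first exact: ltW.
move=> i j; rewrite !mxE; move: i j; near: s.
apply: filter_forall => i; apply: filter_forall => j /=.
by have /cvgrPdist_le := H i j; apply.
Unshelve. all: by end_near. Qed.

Lemma is_derive_sumr (V : normedModType R) (I : Type) (r : seq I) (P : pred I)
    (F : I -> R -> V) (dF : I -> V) (t : R) :
  (forall i, P i -> is_derive t 1 (F i) (dF i)) ->
  is_derive t 1 (fun s => \sum_(i <- r | P i) F i s) (\sum_(i <- r | P i) dF i).
Proof.
move=> H; elim: r => [|i r IH].
  rewrite big_nil (_ : (fun s => _) = cst 0); first exact: is_derive_cst.
  by apply/funext => s; rewrite big_nil.
rewrite big_cons (_ : (fun s => _) =
    fun s => (if P i then F i s else 0) + \sum_(j <- r | P j) F j s); last first.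
  by apply/funext => s; rewrite big_cons; case: ifP => // _; rewrite add0r.
case: ifPn => Pi; first by apply: is_deriveD; exact: H.
by rewrite (_ : (fun s => _) = fun s => \sum_(j <- r | P j) F j s)//;
  apply/funext => s; rewrite add0r.
Qed.

Lemma continuous_sumr (T : topologicalType) (V : normedModType R) (I : Type)
    (r : seq I) (P : pred I) (F : I -> T -> V) t :
  (forall i, P i -> {for t, continuous (F i)}) ->
  {for t, continuous (fun s => \sum_(i <- r | P i) F i s)}.
Proof. by move=> H; apply: cvg_big => //; exact: add_continuous. Qed.

Lemma is_derive_mulmx p n q (F : R -> 'M[R]_(p, n)) (G : R -> 'M[R]_(n, q)) (t : R) F' G' :
  is_derive t 1 F F' -> is_derive t 1 G G' ->
  is_derive t 1 (fun s => F s *m G s) (F' *m G t + F t *m G').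
Proof.
move=> /is_derive_mxP dF /is_derive_mxP dG; apply/is_derive_mxP => i j.
rewrite !mxE -big_split/= (_ : (fun s => _) = fun s => \sum_k F s i k * G s k j);
  last by apply/funext => s; rewrite mxE.
apply: is_derive_sumr => k _.
apply: (is_derive_eq
  (@is_deriveM _ _ (fun s => F s i k) (fun s => G s k j) t 1 _ _ (dF i k) (dG k j))).
by rewrite addrC; congr (_ + _); rewrite [_ *: _]mulrC.
Qed.

Lemma continuous_mulmx p n q (F : R -> 'M[R]_(p, n)) (G : R -> 'M[R]_(n, q)) t :
  {for t, continuous F} -> {for t, continuous G} ->
  {for t, continuous (fun s => F s *m G s)}.
Proof.
move=> /continuous_mxP cF /continuous_mxP cG; apply/continuous_mxP => i j.
rewrite (_ : (fun s => _) = fun s => \sum_k F s i k * G s k j);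
  last by apply/funext => s; rewrite mxE.
by apply: continuous_sumr => k _; apply: cvgM; [exact: cF|exact: cG].
Qed.

Lemma is_derive_trmx p q (F : R -> 'M[R]_(p, q)) (t : R) F' :
  is_derive t 1 F F' -> is_derive t 1 (fun s => (F s)^T) F'^T.
Proof.
move=> /is_derive_mxP dF; apply/is_derive_mxP => i j; rewrite mxE.
by rewrite (_ : (fun s => _) = fun s => F s j i)//; apply/funext => s; rewrite mxE.
Qed.

Lemma continuous_trmx p q (F : R -> 'M[R]_(p, q)) t :
  {for t, continuous F} -> {for t, continuous (fun s => (F s)^T)}.
Proof.
move=> /continuous_mxP cF; apply/continuous_mxP => i j.
by rewrite (_ : (fun s => _) = fun s => F s j i)//; apply/funext => s; rewrite mxE.
Qed.

End Matrices.

(** * Mean value inequalities and primitives *)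

Section MeanValue.
Variable R : realType.

(** Each exceptional point splits the interval in two; on a piece without such points the classical
    mean value theorem asks only for continuity at the ends. *)
Lemma mvt_le (f : R -> R) (D : seq R) a b M : a <= b -> continuous f ->
  (forall t, a < t < b -> t \notin D -> exists2 l, is_derive t 1 f l & l <= M) ->
  f b - f a <= M * (b - a).
Proof.
move=> ab cf; elim: D a b ab => [|d D IH] a b ab H.
  move: ab; rewrite le_eqVlt => /predU1P[->|ab]; first by rewrite !subrr mulr0.
  have dE t : a < t < b -> exists2 l, is_derive t 1 f l & l <= M.
    by move=> tab; exact: H.
  have [||c cab ->] := @MVT _ f ('D_1 f) a b ab.
  - move=> x; rewrite in_itv/= => /dE[l dl _].
    by apply: is_derive_eq; rewrite derive_val.
  - by apply: continuous_subspaceT.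
  - apply: ler_wpM2r; first by rewrite subr_ge0 ltW.
    by move: cab; rewrite in_itv/= => /dE[l dl lM]; rewrite derive_val.
have Hd u v : a <= u -> u <= v -> v <= b -> ~~ (u < d < v) ->
    f v - f u <= M * (v - u).
  move=> au uv vb ud; apply: IH => // t /andP[ut tv] tD; apply: H.
    by rewrite (le_lt_trans au)//= (lt_le_trans tv).
  rewrite inE negb_or tD andbT; apply: contra ud => /eqP <-.
  by rewrite ut tv.
have [/andP[ad db]|nd] := boolP (a < d < b); last exact: Hd.
have h1 : f d - f a <= M * (d - a) by apply: Hd; rewrite ?ltxx ?andbF// ltW.
have h2 : f b - f d <= M * (b - d) by apply: Hd; rewrite ?ltxx// ltW.
lra.
Qed.

Lemma mvt_norm p q (F : R -> 'M[R]_(p, q)) (D : seq R) a b M :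
  a <= b -> 0 <= M -> continuous F ->
  (forall t, a < t < b -> t \notin D -> exists2 l, is_derive t 1 F l & `|l| <= M) ->
  `|F b - F a| <= M * (b - a).
Proof.
move=> ab M0 cF H; apply/mx_norm_leP; first by rewrite mulr_ge0// subr_ge0.
move=> i j; rewrite !mxE ler_norml; apply/andP; split.
  suff : (- F b i j) - (- F a i j) <= M * (b - a) by lra.
  apply: (@mvt_le (fun t => - F t i j) D) => // [t|t tab tD].
    by apply: cvgN; have /continuous_mxP := cF t; exact.
  have [l /is_derive_mxP dl lM] := H t tab tD.
  exists (- l i j); first by apply: is_deriveN; exact: dl.
  by rewrite (le_trans _ lM)// (le_trans _ (ler_mx_entry _ i j))// -normrN ler_norm.
apply: (@mvt_le (fun t => F t i j) D) => // [t|t tab tD].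
  by have /continuous_mxP := cF t; exact.
have [l /is_derive_mxP dl lM] := H t tab tD.
exists (l i j); first exact: dl.
by rewrite (le_trans _ lM)// (le_trans _ (ler_mx_entry _ i j))// ler_norm.
Qed.

Lemma mvt_const p q (F : R -> 'M[R]_(p, q)) (D : seq R) a b :
  a <= b -> continuous F ->
  (forall t, a < t < b -> t \notin D -> is_derive t 1 F 0) -> F b = F a.
Proof.
move=> ab cF H; apply/eqP; rewrite -subr_eq0 -normr_le0 -[leRHS](mul0r (b - a)).
by apply: (mvt_norm (D := D)) => // t tab tD; exists 0; rewrite ?normr0//; exact: H.
Qed.

End MeanValue.

(** * Primitives of piecewise continuous functions on the whole line *)

Section Primitive.
Variable R : realType.
Local Notation mu := (@lebesgue_measure R).

(** Unlike [piecewise_continuous], this concerns the whole line and asks for local bounds instead of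
    one-sided limits: enough for integrability, and stable under products, reflections and
    translations. *)
Definition pwc (V : normedModType R) (f : R -> V) : Prop :=
  (exists D : seq R, forall t, t \notin D -> {for t, continuous f}) /\
  (forall b, exists M, forall t, `|t| <= b -> `|f t| <= M).

Lemma pwc_continuous (V : normedModType R) (f : R -> V) : continuous f -> pwc f.
Proof.
move=> cf; split; first by exists [::] => t _; exact: cf.
move=> b; have [b0|b0] := ltP b 0.
  by exists 0 => t tb; have := le_lt_trans tb b0; rewrite normr_lt0.
have [||c _ Hc] := @EVT_max R (fun t => `|f t|) (- b) b.
- lra.
- by apply: continuous_subspaceT => t; apply: cvg_norm; exact: cf.
- by exists `|f c| => t; rewrite ler_norml => tb; apply: Hc; rewrite in_itv.
Qed.

Lemma pwc_measurable (f : R -> R) : pwc f -> measurable_fun setT f.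
Proof.
move=> [[D HD] _]; pose C : set R := [set` D].
have fC : finite_set C by exact: finite_seq.
have mC : measurable C.
  by apply: countable_measurable; [exact: measurable_set1|exact: finite_set_countable].
rewrite -(setUv C); apply/measurable_funU => //; first exact: measurableC.
split.
  move=> _ Y mY; apply: countable_measurable; first exact: measurable_set1.
  by apply: finite_set_countable; apply: sub_finite_set fC => t [].
apply: subspace_continuous_measurable_fun; first exact: measurableC.
apply/subspace_continuousP => t tC; apply: cvg_within_filter.
by apply: HD; apply/negP => tD; apply: tC.
Qed.

Lemma pwc_integrable (f : R -> R) a b : pwc f -> mu.-integrable `[a, b] (EFin \o f).
Proof.
move=> Hf; apply: measurable_bounded_integrable => //.
- by rewrite /= lebesgue_measure_itv/=; case: ifP => // _; rewrite -EFinB ltry.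
- by apply: measurable_funS (pwc_measurable Hf).
- have [_ /(_ (`|a| + `|b|))[M HM]] := Hf.
  exists M; split; first exact: num_real.
  move=> x Mx t /=; rewrite in_itv/= => /andP[at_ tb].
  apply: le_trans (ltW Mx); apply: HM.
  have := ler_norm b; have := ler_norm (- a); rewrite normrN.
  have := normr_ge0 a; have := normr_ge0 b.
  by rewrite ler_norml => *; lra.
Qed.

Lemma pwc_opp (V : normedModType R) (f : R -> V) (c : R) :
  pwc f -> pwc (fun s => f (c - s)).
Proof.
move=> [[D HD] Hb]; split.
  exists [seq c - d | d <- D] => t tD.
  have : {for c - t, continuous f}.
    by apply: HD; apply: contra tD => /(map_f (fun d => c - d)); rewrite subKr.
  exact: continuous_reflect.
move=> b; have [M HM] := Hb (`|c| + b); exists M => t tb; apply: HM.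
by rewrite (le_trans (ler_normB _ _))// lerD2l.
Qed.

Lemma pwc_shift (V : normedModType R) (f : R -> V) (c : R) :
  pwc f -> pwc (fun s => f (s - c)).
Proof.
move=> /(pwc_opp 0) /(pwc_opp c); rewrite (_ : (fun s => _) = fun s => f (s - c))//.
by apply/funext => s; congr f; ring.
Qed.

Let prim0 (f : R -> R) x := \int[mu]_(s in `[0, x]) f s.

Let prim0_le0 (f : R -> R) x : x <= 0 -> prim0 f x = 0.
Proof.
rewrite /prim0 le_eqVlt => /predU1P[->|x0]; first by rewrite set_itv1 Rintegral_set1.
by rewrite set_itv_ge ?Rintegral_set0// bnd_simp -ltNge.
Qed.

Let prim0_continuous (f : R -> R) : pwc f -> continuous (prim0 f).
Proof.
move=> Hf t; have [t0|t0|->] := ltgtP t 0.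
- apply/continuous_distP => e e0; exists (- t); first lra.
  move=> s st; have : s < 0 by move: st; rewrite ltr_norml => /andP[_ st]; lra.
  by move=> s0; rewrite !prim0_le0 ?subrr ?normr0 ?ltW.
- have : {within `]0, t + 1[, continuous (prim0 f)}.
    have t1 : 0 <= t + 1 by lra.
    apply: continuous_subspaceW
      (parameterized_integral_continuous t1 (pwc_integrable 0 (t + 1) Hf)).
    exact: subset_itv_oo_cc.
  rewrite continuous_open_subspace; last exact: interval_open.
  by apply; rewrite inE/= in_itv/=; lra.
- have [_ /(_ 1)[M HM]] := Hf.
  have M0 : 0 <= M by apply: le_trans (HM 0 _); rewrite ?normr0.
  apply/continuous_distP => e e0; exists (Num.min 1 (e / (M + 1))).
    by rewrite lt_min ltr01 divr_gt0//; lra.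
  move=> s; rewrite subr0 lt_min => /andP[s1 se].
  rewrite (prim0_le0 _ (lexx 0)) subr0.
  have [s0|s0] := leP s 0; first by rewrite prim0_le0// normr0 ltW.
  rewrite (le_trans (le_normr_Rintegral _ _))//; first exact: pwc_integrable.
  have Hle : \int[mu]_(x in `[0, s]) `|f x| <= \int[mu]_(x in `[0, s]) M.
    apply: le_Rintegral => //.
    - have := pwc_integrable 0 s Hf => /integrable_norm.
      by apply: eq_integrable.
    - apply: (pwc_integrable 0 s (f := cst M)); apply: pwc_continuous.
      exact: cst_continuous.
    - move=> x; rewrite /= in_itv/= => /andP[x0 xs]; apply: HM.
      by rewrite ger0_norm// (le_trans xs)// (le_trans _ (ltW s1))// ler_norm.
  rewrite (le_trans Hle)// Rintegral_cst//= lebesgue_measure_itv/= lte_fin s0 /=.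
  rewrite oppr0 addr0; move: se; rewrite gtr0_norm// ltr_pdivlMr; last lra.
  by move=> se; rewrite mulrC; nra.
Qed.

Let prim0_derive (f : R -> R) t : pwc f -> 0 < t -> {for t, continuous f} ->
  is_derive t 1 (prim0 f) (f t).
Proof.
move=> Hf t0 ct.
have [|] := @continuous_FTC1_closed _ f 0 t (t + 1) _ (pwc_integrable 0 (t+1) Hf) t0 ct.
  by rewrite ltrDl ltr01.
by rewrite derive1E => df <-; apply: DeriveDef.
Qed.

(** The oriented integral from 0 to [t]: [prim0] vanishes on the negative axis, so exactly one of
    the two terms is active on each side. *)
Definition prim (f : R -> R) t := prim0 f t - prim0 (fun s => f (0 - s)) (0 - t).

Lemma prim_continuous f : pwc f -> continuous (prim f).
Proof.
move=> Hf t; apply: cvgB; first exact: prim0_continuous.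
by apply: continuous_reflect; apply: prim0_continuous; exact: pwc_opp.
Qed.

Lemma prim_derive f : pwc f ->
  exists D : seq R, forall t, t \notin D -> is_derive t 1 (prim f) (f t).
Proof.
move=> Hf; have [[D HD] _] := Hf; exists (0 :: D) => t.
rewrite inE negb_or => /andP[t0 /HD ct].
have [tlt|tgt] : t < 0 \/ 0 < t by move: t0; case: ltgtP; auto.
  apply: (@is_derive_near _ _ (fun s => - prim0 (fun s => f (0 - s)) (0 - s)) _ _ _ (- t)).
  - lra.
  - move=> s; rewrite ltr_norml => /andP[_ st]; rewrite /prim (prim0_le0 f) ?sub0r//; lra.
  - rewrite -[f t]opprK; apply: is_deriveN; apply: is_derive_reflect.
    have {2}-> : t = 0 - (0 - t) by ring.
    apply: (prim0_derive (f := fun s => f (0 - s))); [exact: pwc_opp|lra|].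
    by apply: continuous_reflect; rewrite subKr.
apply: (@is_derive_near _ _ (prim0 f) _ _ _ t) => //; last exact: prim0_derive.
move=> s; rewrite ltr_norml => /andP[st _].
rewrite /prim (@prim0_le0 (fun s => f (0 - s)) (0 - s)) ?subr0//; lra.
Qed.

End Primitive.

(** * Absolutely continuous functions *)

Section AbsolutelyContinuous.
Variable R : realType.
Local Notation mu := (@lebesgue_measure R).

(* Cousin's lemma, stated as an induction principle on intervals. *)
Lemma interval_ind (Q : R -> R -> Prop) a b : a <= b ->
  (forall u w v, a <= u -> u <= w -> w <= v -> v <= b -> Q u w -> Q w v -> Q u v) ->
  (forall t, a <= t <= b -> exists2 d, 0 < d &
     forall u v, a <= u -> v <= b -> t - d < u -> u <= t -> t <= v -> v < t + d ->
     Q u v) ->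
  Q a b.
Proof.
move=> ab Qtrans Qloc; pose S := [set c | a <= c <= b /\ Q a c].
have Sa : S a.
  split; first by rewrite lexx.
  have [|d d0 Hd] := Qloc a; first by rewrite lexx.
  by apply: Hd => //; lra.
have Sub : ubound S b by move=> c [/andP[]].
have hub : has_ubound S by exists b.
have hS : has_sup S by split=> //; exists a.
have ac : a <= sup S by exact: ub_le_sup hub _ Sa.
have cb : sup S <= b by apply: ge_sup => //; exists a.
have [|d d0 Hd] := Qloc (sup S); first by rewrite ac.
have [c' Sc' dc'] := sup_adherent d0 hS.
have c'c : c' <= sup S by exact: ub_le_sup hub _ Sc'.
have [/andP[ac' c'b] Qc'] := Sc'.
have Qv v : sup S <= v -> v <= b -> v < sup S + d -> Q a v.
  by move=> cv vb vd; apply: (Qtrans _ c') => //; [lra|exact: Hd].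
move: cb; rewrite le_eqVlt => /predU1P[cb|cb].
  by apply: Qv; lra.
(* If [sup S < b], this point belongs to [S] and yet exceeds its supremum. *)
pose v := Num.min b (sup S + d / 2).
have vS : S v.
  split; first by rewrite le_min ge_min ab lexx/= andbT; lra.
  apply: Qv; first by rewrite le_min ltW//=; lra.
    by rewrite ge_min lexx.
  by rewrite gt_min; apply/orP; right; lra.
have : v <= sup S by exact: ub_le_sup hub _ vS.
by rewrite ge_min => /orP[]; lra.
Qed.

(** The intervals are sorted from left to right, so cutting [O] at the right end of the first one
    separates it from all the others; being half-open, they fall exactly on the two sides of the
    cut. *)
Lemma sum_length_le (s : seq (R * R)) (O : set R) : measurable O ->
  pairwise (fun p q : R * R => p.2 <= q.1) s ->
  (forall p, p \in s -> p.1 <= p.2 /\ `]p.1, p.2] `<=` O) ->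
  ((\sum_(p <- s) (p.2 - p.1))%:E <= mu O)%E.
Proof.
elim: s O => [|p s IH] O mO; first by rewrite big_nil.
rewrite big_cons /= => /andP[/allP ps pw] H.
have [p12 pO] := H p (mem_head _ _).
have mI : measurable (`]p.2, +oo[ : set R) by [].
have {}IH : ((\sum_(q <- s) (q.2 - q.1))%:E <= mu (O `&` `]p.2, +oo[))%E.
  apply: IH => //; first exact: measurableI.
  move=> q qs; have [q12 qO] : q.1 <= q.2 /\ `]q.1, q.2] `<=` O.
    by apply: H; rewrite inE qs orbT.
  split=> // x xq; split; first exact: qO.
  move: xq; rewrite /= !in_itv/= andbT => /andP[xq _].
  by apply: le_lt_trans xq; exact: ps.
rewrite -[in leRHS](setUIDK O `]p.2, +oo[).
rewrite measureU//; [|exact: measurableI|exact: measurableD|]; last first.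
  by apply/seteqP; split=> x //= [[_ x1] [_ x2]].
rewrite addrC EFinD; apply: leeD => //.
apply: (@le_trans _ _ (mu `]p.1, p.2])).
  rewrite /= lebesgue_measure_itv/= lte_fin; case: ltP => [|p21].
    by rewrite -EFinD.
  by rewrite lee_fin subr_le0.
apply: le_measure; rewrite ?inE//; first exact: measurableD.
move=> x xp; split; first exact: pO.
by move: xp; rewrite /= !in_itv/= andbT => /andP[_ xp]; apply/negP; rewrite -leNgt.
Qed.

(* Gauge argument: on the exceptional null set the gauge keeps the intervals inside
   an open set of small measure, elsewhere it is given by the derivative. *)
Lemma ac_mvt (V : normedModType R) (f : R -> V) a b M : a <= b ->
  absolutely_continuous a b f ->
  {ae mu, forall t : R, a <= t <= b -> exists2 l, is_derive t 1 f l & `|l| <= M} ->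
  0 <= M -> `|f b - f a| <= M * (b - a).
Proof.
move=> ab acf aef M0; apply/ler_addgt0Pr => e e0.
(* The error is [e' * (b - a)] from the points of differentiability plus [e'] from the intervals
   tagged in the null set. *)
pose e' := e / (b - a + 1).
have e'0 : 0 < e' by apply: divr_gt0 => //; lra.
have [d d0 Hd] := acf e' e'0.
have [N [mN N0 HN]] := aef.
have [||O [oO NO Od]] := @lebesgue_regularity_outer R N d mN.
- by apply: (@le_lt_trans _ _ 0%E); [move: N0 => /= <-|exact: ltry].
- by [].
have mO : measurable O by exact: open_measurable.
have muO : (mu O < d%:E)%E.
  have -> : O = (O `\` N) `|` N.
    by apply/seteqP; split=> x; [have [|] := pselect (N x); [right|left]|
      move=> [[]|/NO]].
  apply: le_lt_trans (measureU2 _ _ _) _ => //; first exact: measurableD.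
  by rewrite [X in (_ + X)%E]N0 adde0.
(* [s] lists the intervals tagged in [N]. Their increments stay unestimated here, because absolute
   continuity bounds them only all together, at the end. *)
pose Q u v := exists s : seq (R * R), [/\
  pairwise (fun p q : R * R => p.2 <= q.1) s,
  forall p, p \in s -> [/\ u <= p.1, p.1 <= p.2, p.2 <= v & `]p.1, p.2] `<=` O] &
  `|f v - f u| <= (M + e') * (v - u) + \sum_(p <- s) `|f p.2 - f p.1| ].
have [s [pws Hs Hf]] : Q a b.
  apply: interval_ind => //.
    move=> u w v au uw wv vb [s1 [pw1 H1 F1]] [s2 [pw2 H2 F2]].
    exists (s1 ++ s2); split.
    - rewrite pairwise_cat pw1 pw2 !andbT; apply/allrelP => p q /H1[_ _ pw _].
      by move=> /H2[wq _ _ _]; exact: le_trans wq.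
    - move=> p; rewrite mem_cat => /orP[/H1|/H2] [h1 h2 h3 h4]; split=> //.
        exact: le_trans wv.
      exact: le_trans h1.
    - rewrite big_cat/= -(subrKA (f w)); apply: le_trans (ler_normD _ _) _.
      lra.
  move=> t tab; have [Nt|Nt] := pselect (N t).
    have /nbhs_ballP[r /= r0 Hr] : nbhs t O by apply: open_nbhs_nbhs; split=> //; exact: NO.
    exists r => // u v au vb tu ut tv vt.
    exists [:: (u, v)]; split=> //.
      move=> p; rewrite inE => /eqP ->; split=> //=; first exact: le_trans tv.
      move=> x; rewrite /= in_itv/= => /andP[ux xv]; apply: Hr.
      rewrite /ball/= ltr_norml; apply/andP; split; lra.
    by rewrite big_seq1 lerDr mulr_ge0//; lra.
  have [l dl lM] : exists2 l, is_derive t 1 f l & `|l| <= M.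
    by apply: contrapT => nl; apply: Nt; apply: HN => /= /(_ tab).
  have /is_deriveP/(_ _ e'0)[r r0 Hr] := dl.
  exists r => // u v au vb tu ut tv vt; exists [::]; split=> //.
  rewrite big_nil addr0.
  have hv : `|f v - f t| <= (M + e') * (v - t).
    have := Hr v; rewrite ger0_norm ?subr_ge0// => /(_ ltac:(lra)) h.
    rewrite -[f v - f t](subrK ((v - t) *: l)); apply: le_trans (ler_normD _ _) _.
    by rewrite normrZ ger0_norm ?subr_ge0//; nra.
  have hu : `|f u - f t| <= (M + e') * (t - u).
    have := Hr u; rewrite ler0_norm ?subr_le0// opprB => /(_ ltac:(lra)) h.
    rewrite -[f u - f t](subrK ((u - t) *: l)); apply: le_trans (ler_normD _ _) _.
    by rewrite normrZ ler0_norm ?subr_le0// opprB; nra.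
  rewrite -(subrKA (f t)); apply: le_trans (ler_normD _ _) _.
  by rewrite [`|f t - _|]distrC; lra.
have sd : \sum_(p <- s) (p.2 - p.1) < d.
  rewrite -lte_fin; apply: le_lt_trans muO; apply: sum_length_le => // p /Hs[_ ? _ ?].
  by split.
have : \sum_(p <- s) `|f p.2 - f p.1| < e'.
  have := Hd (size s) (fun i => (nth (0, 0) s i).1) (fun i => (nth (0, 0) s i).2).
  move: sd; rewrite !(big_nth (0, 0)) !big_mkord => sd H; apply: H => //.
    by move=> i; have [? ? ? _] := Hs _ (mem_nth (0, 0) (ltn_ord i)).
  move=> i j ij; move/(pairwiseP (0, 0)): pws => pws.
  have : (i < j)%N \/ (j < i)%N by move: ij; rewrite -val_eqE /=; case: ltngtP; auto.
  by case=> ?; [left|right]; apply: pws => //; rewrite inE ltn_ord.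
have : e' * (b - a + 1) = e by rewrite divfK//; lra.
lra.
Qed.

End AbsolutelyContinuous.

(** * The fundamental matrix *)

Section Fundamental.
Variables (R : realType) (n m : nat) (A : 'I_m.+1 -> 'M[R]_n) (h : 'I_m.+1 -> R).
Hypothesis h_ge0 : forall j, 0 <= h j.
Implicit Types (t s c T e : R) (k N M : nat).

(** The iterated integrals of the unit step; [tpow 0] is the step itself, with value 1 at 0. *)
Definition tpow k (t : R) : R := if 0 <= t then t ^+ k / k`!%:R else 0.

Lemma tpow_lt0 k t : t < 0 -> tpow k t = 0.
Proof. by move=> t0; rewrite /tpow leNgt t0. Qed.

Lemma tpow_le k t T : t <= T -> `|tpow k t| <= `|T| ^+ k / k`!%:R.
Proof.
move=> tT; have [t0|t0] := leP 0 t; last first.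
  by rewrite tpow_lt0// normr0 divr_ge0// exprn_ge0.
rewrite /tpow t0.
rewrite ger0_norm; last by rewrite divr_ge0// exprn_ge0.
by rewrite ler_pM2r ?invr_gt0 ?ltr0n ?fact_gt0// lerXn2r ?nnegrE// (le_trans tT)// ler_norm.
Qed.

Lemma is_derive_tpow k t : t != 0 -> is_derive t 1 (tpow k.+1) (tpow k t).
Proof.
move=> tn0; have [tlt|tgt] : t < 0 \/ 0 < t by move: tn0; case: ltgtP; auto.
  rewrite tpow_lt0//; apply: (@is_derive_near _ _ (cst 0) _ _ _ (- t)); first lra.
  by move=> s; rewrite ltr_norml => /andP[_ st]; rewrite tpow_lt0//; lra.
apply: (@is_derive_near _ _ (fun s => k.+1`!%:R^-1 * s ^+ k.+1) _ _ _ t) => //.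
  by move=> s; rewrite ltr_norml => /andP[st _]; rewrite /tpow ifT 1?mulrC//; lra.
have dX : is_derive t 1 (fun s : R => s ^+ k.+1) (k.+1%:R * t ^+ k).
  apply: DeriveDef; first exact: exprn_derivable.
  by rewrite exp_derive /= [_ *: (1 : R)]mulr1.
have dZ := @is_deriveZ _ _ _ (fun s : R => s ^+ k.+1) (k.+1`!%:R^-1) t 1 _ dX.
apply: (is_derive_eq dZ).
have k0 : k.+1%:R != 0 :> R by rewrite pnatr_eq0.
rewrite /tpow ltW// factS natrM -[LHS]/(_^-1 * (k.+1%:R * t ^+ k)) invfM.
by rewrite [_^-1 * _^-1]mulrC -mulrA mulKf// mulrC.
Qed.

Lemma tpow_continuous k : continuous (tpow k.+1).
Proof.
move=> t; have [->|tn0] := eqVneq t 0; last exact: is_derive_continuous (is_derive_tpow k tn0).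
apply/continuous_distP => e e0; exists (Num.min 1 e) => [|s].
  by rewrite lt_min ltr01.
rewrite lt_min subr0 => /andP[s1 se].
rewrite [tpow _ 0]/tpow lexx expr0n mul0r subr0.
apply: le_trans (tpow_le _ (lexx s)) _; apply: (le_trans _ (ltW se)).
rewrite exprS -mulrA ler_piMr// ler_pdivrMr ?ltr0n ?fact_gt0// mul1r.
by rewrite (le_trans (exprn_ile1 k (normr_ge0 s) (ltW s1)))// ler1n fact_gt0.
Qed.

(* The sum of [A_(j_1) ... A_(j_k) g(t - h_(j_1) - ... - h_(j_k))] over words. *)
Fixpoint wsum k (g : R -> R) (t : R) : 'M[R]_n :=
  if k is k'.+1 then \sum_j A j *m wsum k' g (t - h j) else (g t)%:M.

(** A word can be shortened at its last letter as well as at its first. This symmetry is the reason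
    why K solves the equation from both sides. *)
Lemma wsumSr k g t : wsum k.+1 g t = \sum_j wsum k g (t - h j) *m A j.
Proof.
elim: k t => [|k IH] t.
  by apply: eq_bigr => j _ /=; rewrite mul_mx_scalar mul_scalar_mx.
rewrite [LHS]/=; under eq_bigr => j _ do rewrite -/(wsum k.+1 g _) IH mulmx_sumr.
rewrite exchange_big/=; apply: eq_bigr => j _; rewrite mulmx_suml.
by apply: eq_bigr => i _; rewrite mulmxA addrAC.
Qed.

Lemma wsum_le0 k g t : (forall s, s <= 0 -> g s = 0) -> t <= 0 -> wsum k g t = 0.
Proof.
move=> g0; elim: k t => [|k IH] t t0 /=; first by rewrite g0// raddf0.
by rewrite big1// => j _; rewrite IH ?mulmx0//; have := h_ge0 j; lra.
Qed.

Definition anorm : R := \sum_j n%:R * `|A j|.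

Lemma anorm_ge0 : 0 <= anorm.
Proof. by apply: sumr_ge0 => j _; rewrite mulr_ge0. Qed.

Lemma norm_Asum p (X : 'I_m.+1 -> 'M[R]_(n, p)) c : (forall j, `|X j| <= c) ->
  `|\sum_j A j *m X j| <= anorm * c.
Proof.
move=> H; apply: le_trans (ler_norm_sum _ _ _) _; rewrite mulr_suml.
apply: ler_sum => j _; apply: le_trans (ler_norm_mulmx _ _) _.
by rewrite ler_wpM2l// mulr_ge0.
Qed.

Lemma norm_sumA p (X : 'I_m.+1 -> 'M[R]_(p, n)) c : (forall j, `|X j| <= c) ->
  `|\sum_j X j *m A j| <= anorm * c.
Proof.
move=> H; apply: le_trans (ler_norm_sum _ _ _) _; rewrite mulr_suml.
apply: ler_sum => j _; apply: le_trans (ler_norm_mulmx _ _) _.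
by rewrite mulrAC ler_wpM2l// mulr_ge0.
Qed.

Lemma norm_wsum k g c T : (forall s, s <= T -> `|g s| <= c) ->
  forall t, t <= T -> `|wsum k g t| <= anorm ^+ k * c.
Proof.
move=> H; elim: k => [|k IH] t tT /=.
  rewrite mul1r; have c0 : 0 <= c by apply: le_trans (H _ tT).
  apply/mx_norm_leP => // i j; rewrite mxE; case: eqP => _; last by rewrite normr0.
  exact: H.
rewrite exprS -mulrA; apply: norm_Asum => j; apply: IH.
by have := h_ge0 j; lra.
Qed.

Lemma wsum_continuous k g : continuous g -> continuous (wsum k g).
Proof.
move=> cg; elim: k => [|k IH] t /=.
  apply/continuous_mxP => i j.
  rewrite (_ : (fun s => _) = fun s => g s *+ (i == j)).
    by case: (i == j); [exact: cg|exact: cst_continuous].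
  by apply/funext => s; rewrite mxE.
apply: continuous_sumr => j _; apply: (continuous_mulmx (F := fun=> A j)).
  exact: cst_continuous.
by apply: continuous_affine; exact: IH.
Qed.

Lemma is_derive_wsum k g g' (D : seq R) :
  (forall t, t \notin D -> is_derive t 1 g (g' t)) ->
  exists D' : seq R, forall t, t \notin D' -> is_derive t 1 (wsum k g) (wsum k g' t).
Proof.
move=> H; elim: k => [|k [D' IH]] /=.
  exists D => t tD; apply/is_derive_mxP => i j.
  rewrite mxE (_ : (fun s => _) = fun s => g s *+ (i == j)).
    by case: (i == j); [exact: H|exact: is_derive_cst].
  by apply/funext => s; rewrite mxE.
exists [seq d + h j | d <- D', j <- enum 'I_m.+1] => t tD.
apply: is_derive_sumr => j _.
apply: is_derive_eq.
  apply: (is_derive_mulmx (is_derive_cst (A j) t 1)).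
  apply: is_derive_affine; apply: IH; apply: contra tD => tD.
  by apply/allpairsP; exists (t - h j, j); split=> //=; rewrite ?mem_enum// subrK.
by rewrite mul0mx add0r.
Qed.

(* Partial sums without the discontinuous term [k = 0], which contributes [1]
   for [t >= 0]. *)
Definition Kpart N (t : R) : 'M[R]_n := \sum_(1 <= k < N.+1) wsum k (tpow k) t.

Lemma Kpart_continuous N : continuous (Kpart N).
Proof.
move=> t; rewrite /Kpart.
under [X in continuous_at _ X]eq_fun => s do rewrite big_add1.
apply: continuous_sumr => k _; apply: (@wsum_continuous k.+1); exact: tpow_continuous.
Qed.

Lemma Kpart_le0 N t : t <= 0 -> Kpart N t = 0.
Proof.
move=> t0; rewrite /Kpart big_nat big1// => -[//|k] _; apply: wsum_le0 => // s.
rewrite le_eqVlt => /predU1P[->|/tpow_lt0->//].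
by rewrite /tpow lexx expr0n mul0r.
Qed.

Definition step (t : R) : 'M[R]_n := (tpow 0 t)%:M.

(** Differentiation lowers the power by one and keeps the length of the word; removing the first
    letter then shows the preceding term at a delayed time. The exceptional points are sums of
    delays, more of them as [N] grows. *)
Lemma is_derive_Kpart N : exists D : seq R, forall t, t \notin D ->
  is_derive t 1 (Kpart N.+1) (\sum_j A j *m (step (t - h j) + Kpart N (t - h j))).
Proof.
have dt k s : s \notin [:: 0] -> is_derive s 1 (tpow k.+1) (tpow k s).
  by rewrite inE; exact: is_derive_tpow.
elim: N => [|N [D IH]].
  have [D HD] := @is_derive_wsum 1 (tpow 1) (tpow 0) [:: 0] (dt _).
  have -> : Kpart 1 = wsum 1 (tpow 1) by apply/funext => s; rewrite /Kpart big_nat1.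
  exists D => t /HD H; apply: (is_derive_eq H).
  by apply: eq_bigr => j _; rewrite /Kpart big_geq// addr0.
have [D' HD'] := @is_derive_wsum N.+2 (tpow N.+2) (tpow N.+1) [:: 0] (dt _).
exists (D ++ D') => t; rewrite mem_cat negb_or => /andP[tD tD'].
rewrite (_ : Kpart N.+2 = fun t => Kpart N.+1 t + wsum N.+2 (tpow N.+2) t); last first.
  by apply/funext => s; rewrite /Kpart big_nat_recr.
apply: (is_derive_eq (is_deriveD (IH _ tD) (HD' _ tD'))).
rewrite -big_split/=; apply: eq_bigr => j _; rewrite -mulmxDr -addrA.
by rewrite [in RHS]/Kpart big_nat_recr.
Qed.

Lemma Kpart_comm N t : \sum_j A j *m (step (t - h j) + Kpart N (t - h j)) =
  \sum_j (step (t - h j) + Kpart N (t - h j)) *m A j.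
Proof.
have E s : step s + Kpart N s = \sum_(0 <= k < N.+1) wsum k (tpow k) s.
  by rewrite [RHS]big_nat_recl// /Kpart big_add1.
under eq_bigr => j _ do rewrite E mulmx_sumr.
under [RHS]eq_bigr => j _ do rewrite E mulmx_suml.
rewrite exchange_big [RHS]exchange_big/=; apply: eq_bigr => k _.
by rewrite -wsumSr.
Qed.

(** Words of length k contribute at most [anorm ^+ k] times a power over a factorial, so the tails
    are dominated by those of an exponential series, uniformly up to time [T]. *)
Lemma Kpart_cauchy T e : 0 < e -> exists N0, forall N M t,
  (N0 <= N)%N -> (N <= M)%N -> t <= T -> `|Kpart M t - Kpart N t| <= e.
Proof.
move=> e0; have := is_cvg_series_exp_coeff (anorm * `|T|).
move=> /cauchy_cvgP/cauchy_seriesP /(_ e e0)[[P1 P2] [/= [N1 _ H1] [N2 _ H2]] HP].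
exists (maxn N1 N2) => N M t; rewrite geq_max => /andP[N1N N2N] NM tT.
have -> : Kpart M t - Kpart N t = \sum_(N.+1 <= k < M.+1) wsum k (tpow k) t.
  by rewrite /Kpart (@big_cat_nat _ _ _ N.+1)//= addrAC subrr add0r.
have /HP/= : (P1 `*` P2) (N.+1, M.+1).
  by split; [apply: H1 => /=; exact: leqW|apply: H2 => /=; rewrite leqW// (leq_trans N2N)].
move=> /ltW; apply: le_trans; rewrite [leRHS]ger0_norm; last first.
  by apply: sumr_ge0 => k _; rewrite /exp_coeff /= divr_ge0// exprn_ge0// mulr_ge0// anorm_ge0.
apply: le_trans (ler_norm_sum _ _ _) _; apply: ler_sum => k _.
rewrite /exp_coeff/= exprMn -mulrA; apply: (@norm_wsum k (tpow k) _ T) => // s sT.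
exact: tpow_le.
Qed.

Definition Klim t : 'M[R]_n := \matrix_(i, j) limn (fun N => Kpart N t i j).

Lemma Klim_unif T e : 0 < e -> exists N0, forall N t, (N0 <= N)%N -> t <= T ->
  `|Klim t - Kpart N t| <= e.
Proof.
move=> e0; have [N0 HN0] := Kpart_cauchy T e0; exists N0 => N t N0N tT.
apply/mx_norm_leP => [|i j]; first exact: ltW.
rewrite !mxE; pose u M := Kpart M t i j; rewrite -/(u N) -/u.
have cu : cvgn u.
  apply/cauchy_cvgP/cauchy_exP => r r0; have r20 : 0 < r / 2 by lra.
  have [N1 HN1] := Kpart_cauchy T r20; exists (u N1); exists N1 => // M /= N1M.
  have := ler_mx_entry (Kpart M t - Kpart N1 t) i j.
  have := HN1 N1 M t (leqnn _) N1M tT; rewrite !mxE -/(u M) -/(u N1).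
  by move=> h1 h2; rewrite /ball/= distrC; lra.
apply/ler_addgt0Pr => r r0; have /cvgrPdist_le/(_ r r0)[N1 _ HN1] := cu.
pose M := maxn N N1; have NM : (N <= M)%N by exact: leq_maxl.
have h1 : `|limn u - u M| <= r by apply: HN1; exact: leq_maxr.
have h2 := HN0 N M t N0N NM tT.
have := ler_mx_entry (Kpart M t - Kpart N t) i j; rewrite !mxE -/(u M) -/(u N) => h3.
rewrite -(subrKA (u M)); apply: le_trans (ler_normD _ _) _; lra.
Qed.

Lemma Klim_le0 t : t <= 0 -> Klim t = 0.
Proof.
move=> t0; apply/matrixP => i j; rewrite !mxE.
rewrite (_ : (fun N => _) = cst 0) ?lim_cst//.
by apply/funext => N; rewrite Kpart_le0// mxE.
Qed.

Lemma Klim_continuous : continuous Klim.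
Proof.
move=> t; apply/continuous_distP => e e0; have e3 : 0 < e / 3 by lra.
have [N HN] := Klim_unif (t + 1) e3.
have /continuous_distP/(_ _ e3)[d d0 Hd] : {for t, continuous (Kpart N)}.
  exact: Kpart_continuous.
exists (Num.min d 1) => [|s]; first by rewrite lt_min d0/=.
rewrite lt_min => /andP[sd s1].
have st1 : s <= t + 1 by move: s1; rewrite ltr_norml => /andP[_]; lra.
have h1 := HN N s (leqnn _) st1; have h2 := HN N t (leqnn _) ltac:(lra).
have h3 := Hd s sd.
rewrite -(subrKA (Kpart N s)) -[X in _ + X](subrKA (Kpart N t)).
apply: le_trans (ler_normD _ _) _; apply: le_trans (lerD (lexx _) (ler_normD _ _)) _.
by rewrite (distrC (Kpart N t)) in h2 *; lra.
Qed.

Definition Kfun t : 'M[R]_n := step t + Klim t.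

Lemma step_lt0 t : t < 0 -> step t = 0.
Proof. by move=> t0; rewrite /step tpow_lt0// raddf0. Qed.

Lemma step_ge0 t : 0 <= t -> step t = 1%:M.
Proof. by move=> t0; rewrite /step /tpow t0 expr0 divr1. Qed.

Lemma Kfun_lt0 t : t < 0 -> Kfun t = 0.
Proof. by move=> t0; rewrite /Kfun step_lt0// Klim_le0 ?addr0// ltW. Qed.

Lemma Kfun_ge0 t : 0 <= t -> Kfun t = 1%:M + Klim t.
Proof. by move=> t0; rewrite /Kfun step_ge0. Qed.

Lemma Kfun0 : Kfun 0 = 1%:M.
Proof. by rewrite Kfun_ge0// Klim_le0// addr0. Qed.

Lemma Kfun_continuous t : t != 0 -> {for t, continuous Kfun}.
Proof.
move=> tn0; apply: continuousD; last exact: Klim_continuous.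
apply/continuous_distP => e e0; exists `|t| => [|s st]; first by rewrite normr_gt0.
have [tlt|tgt] : t < 0 \/ 0 < t by move: tn0; case: ltgtP; auto.
  rewrite !step_lt0 ?subrr ?normr0 ?ltW//.
  by move: st; rewrite (ltr0_norm tlt) ltr_norml => /andP[_]; lra.
rewrite !step_ge0 ?subrr ?normr0 ?ltW//.
by move: st; rewrite (gtr0_norm tgt) ltr_norml => /andP[]; lra.
Qed.

(** The exceptional sets of the partial sums grow with [N], so derivatives are not passed to the
    limit. The mean value inequality is applied to a partial sum minus its expected linear part, and
    the resulting bound survives the limit. Only continuity of the right-hand side at [t] matters,
    which excludes just the delays themselves. *)
Lemma is_derive_Klim t : (forall j, t != h j) ->
  is_derive t 1 Klim (\sum_j A j *m Kfun (t - h j)).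
Proof.
move=> th; pose L s := \sum_j A j *m Kfun (s - h j).
have cL : {for t, continuous L}.
  apply: continuous_sumr => j _; apply: (continuous_mulmx (F := cst (A j))).
    exact: cst_continuous.
  by apply: continuous_affine; apply: Kfun_continuous; rewrite subr_eq0.
apply/is_deriveP => e e0; have /continuous_distP/(_ e e0)[d d0 Hd] := cL.
exists d => // s sd; apply/ler_addgt0Pr => r r0.
pose T := `|t| + d; have tT : t <= T by have := ler_norm t; rewrite /T; lra.
have sT : s <= T.
  by move: sd; rewrite ltr_norml /T => /andP[_]; have := ler_norm t; lra.
(* The slack [r] pays for two uniform approximations, at [s] and at [t], and for the error of the
   derivative integrated from [t] to [s]. *)
pose c := 2 + anorm * `|s - t|.
have c0 : 0 < c by have := mulr_ge0 anorm_ge0 (normr_ge0 (s - t)); rewrite /c; lra.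
have rc : 0 < r / c by exact: divr_gt0.
have [N HN] := Klim_unif T rc.
pose F x := Kpart N.+1 x - (x - t) *: L t.
have cF : continuous F.
  move=> x; apply: cvgB; first exact: Kpart_continuous.
  apply: cvgZl; apply: cvgB; [exact: cvg_id|exact: cvg_cst].
have [D HD] := is_derive_Kpart N.
have HF x : Num.min t s < x < Num.max t s -> x \notin D ->
    exists2 l, is_derive x 1 F l & `|l| <= e + anorm * (r / c).
  move=> /andP[x1 x2] xD; have dK := HD x xD.
  have dl : is_derive x 1 (fun x => (x - t) *: L t) (L t).
    apply/is_deriveP => e' e'0; exists 1 => // y _.
    rewrite -scalerBl -scalerBl (_ : _ - _ - _ = 0); last by ring.
    by rewrite scale0r normr0 mulr_ge0// ltW.
  eexists; first exact: is_deriveB dK dl.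
  have xT : x <= T by apply: le_trans (ltW x2) _; rewrite ge_max tT sT.
  have xd : `|x - t| < d.
    move: sd x1 x2; rewrite !ltr_norml gt_min lt_max => /andP[s1 s2].
    by move=> /orP[?|?] /orP[?|?]; apply/andP; split; lra.
  rewrite -(subrKA (L x)) addrC; apply: le_trans (ler_normD _ _) _.
  apply: lerD; first exact: Hd.
  rewrite /L -sumrB; under eq_bigr => j _ do rewrite -mulmxBr.
  apply: norm_Asum => j; rewrite /Kfun opprD addrACA subrr add0r distrC.
  by apply: HN => //; have := h_ge0 j; lra.
have M0 : 0 <= e + anorm * (r / c).
  by apply: addr_ge0; [exact: ltW|apply: mulr_ge0; [exact: anorm_ge0|exact: ltW]].
have FF : `|F s - F t| <= (e + anorm * (r / c)) * `|s - t|.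
  have [ts|st] := leP t s.
    rewrite ger0_norm ?subr_ge0//; apply: (mvt_norm (D := D)) => // x xts; apply: HF.
    by rewrite min_l// max_r.
  rewrite distrC ltr0_norm ?subr_lt0// (opprB s t).
  apply: (mvt_norm (D := D)) => // [|x xts].
    exact: ltW.
  by apply: HF; rewrite min_r ?max_l// ltW.
have h1 := HN N.+1 s (leqnSn _) sT; have h2 := HN N.+1 t (leqnSn _) tT.
have -> : Klim s - Klim t - (s - t) *: L t =
    (Klim s - Kpart N.+1 s) - (Klim t - Kpart N.+1 t) + (F s - F t).
  by rewrite /F subrr scale0r subr0; apply/matrixP => i j; rewrite !mxE; ring.
apply: le_trans (ler_normD _ _) _; apply: le_trans (lerD (ler_normB _ _) FF) _.
have E : r / c * (2 + anorm * `|s - t|) = r by rewrite -/c divfK ?gt_eqF.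
by move: E h1 h2; set q := r / c => E h1 h2; lra.
Qed.

Lemma Kfun_comm t : \sum_j A j *m Kfun (t - h j) = \sum_j Kfun (t - h j) *m A j.
Proof.
apply/eqP; rewrite -subr_eq0 -normr_le0; apply/ler_addgt0Pr => e e0; rewrite add0r.
have a0 := anorm_ge0.
have e'0 : 0 < e / (2 * (anorm + 1)) by apply: divr_gt0 => //; lra.
have [N /(_ N)HN] := Klim_unif t e'0.
have Hj j : `|Kfun (t - h j) - (step (t - h j) + Kpart N (t - h j))| <=
    e / (2 * (anorm + 1)).
  rewrite /Kfun opprD addrACA subrr add0r; apply: HN => //.
  by have := h_ge0 j; lra.
have -> : \sum_j A j *m Kfun (t - h j) - \sum_j Kfun (t - h j) *m A j =
   \sum_j A j *m (Kfun (t - h j) - (step (t - h j) + Kpart N (t - h j))) -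
   \sum_j (Kfun (t - h j) - (step (t - h j) + Kpart N (t - h j))) *m A j.
  under [in RHS]eq_bigr => j _ do rewrite mulmxBr.
  rewrite sumrB Kpart_comm.
  under [X in _ = _ - X]eq_bigr => j _ do rewrite mulmxBl.
  by rewrite sumrB opprB addrA subrK.
apply: le_trans (ler_normB _ _) _.
apply: le_trans (lerD (norm_Asum Hj) (norm_sumA Hj)) _.
have E : e / (2 * (anorm + 1)) * (2 * (anorm + 1)) = e by rewrite divfK//; lra.
set x := e / _ in E e'0 *; nra.
Qed.

End Fundamental.

(** * The pairing of left and right solutions *)

Section MatrixPrimitive.
Variable R : realType.
Implicit Types (t s a b : R) (p q : nat).

Lemma pwc_entry p q (F : R -> 'M[R]_(p, q)) i j : pwc F -> pwc (fun s => F s i j).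
Proof.
move=> [[D HD] Hb]; split; first by exists D => t /HD/continuous_mxP; exact.
move=> b; have [M HM] := Hb b; exists M => t /HM; apply: le_trans.
exact: ler_mx_entry.
Qed.

Lemma pwc_mulmx p n q (F : R -> 'M[R]_(p, n)) (G : R -> 'M[R]_(n, q)) :
  pwc F -> pwc G -> pwc (fun s => F s *m G s).
Proof.
move=> [[D HD] Hb] [[D' HD'] Hb']; split.
  exists (D ++ D') => t; rewrite mem_cat negb_or => /andP[/HD ? /HD' ?].
  exact: continuous_mulmx.
move=> b; have [M HM] := Hb b; have [M' HM'] := Hb' b; exists (n%:R * M * M') => t tb.
apply: le_trans (ler_norm_mulmx _ _) _.
by rewrite ler_pM ?mulr_ge0 ?ler_wpM2l ?HM ?HM'.
Qed.

Lemma pwc_trmx p q (F : R -> 'M[R]_(p, q)) : pwc F -> pwc (fun s => (F s)^T).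
Proof.
move=> [[D HD] Hb]; split; first by exists D => t /HD; exact: continuous_trmx.
by move=> b; have [M HM] := Hb b; exists M => t tb; rewrite norm_trmx; exact: HM.
Qed.

Lemma pwc_cst (V : normedModType R) (c : V) : pwc (fun _ : R => c).
Proof. by apply: pwc_continuous; exact: cst_continuous. Qed.

Lemma pwcD (V : normedModType R) (F G : R -> V) :
  pwc F -> pwc G -> pwc (fun s => F s + G s).
Proof.
move=> [[D HD] Hb] [[D' HD'] Hb']; split.
  exists (D ++ D') => t; rewrite mem_cat negb_or => /andP[/HD ? /HD' ?].
  exact: continuousD.
move=> b; have [M HM] := Hb b; have [M' HM'] := Hb' b; exists (M + M') => t tb.
by apply: le_trans (ler_normD _ _) _; apply: lerD; [exact: HM|exact: HM'].
Qed.

Definition mprim p q (F : R -> 'M[R]_(p, q)) t : 'M[R]_(p, q) :=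
  \matrix_(i, j) prim (fun s => F s i j) t.

Lemma mprim_continuous p q (F : R -> 'M[R]_(p, q)) : pwc F -> continuous (mprim F).
Proof.
move=> HF t; apply/continuous_mxP => i j.
rewrite (_ : (fun s => _) = prim (fun s => F s i j)).
  by apply: prim_continuous; exact: pwc_entry.
by apply/funext => s; rewrite mxE.
Qed.

Lemma mprim_derive p q (F : R -> 'M[R]_(p, q)) : pwc F ->
  exists D : seq R, forall t, t \notin D -> is_derive t 1 (mprim F) (F t).
Proof.
move=> HF.
have /choice[D HD] : forall ij : 'I_p * 'I_q, exists D : seq R, forall t,
    t \notin D -> is_derive t 1 (prim (fun s => F s ij.1 ij.2)) (F t ij.1 ij.2).
  by move=> ij; apply: prim_derive; exact: pwc_entry.
exists (flatten [seq D ij | ij <- enum {: 'I_p * 'I_q}]) => t tD.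
apply/is_derive_mxP => i j.
rewrite (_ : (fun s => _) = prim (fun s => F s i j)); last first.
  by apply/funext => s; rewrite mxE.
apply: (HD (i, j)); apply: contra tD => tD; apply/flattenP.
by exists (D (i, j)) => //; apply/mapP; exists (i, j); rewrite ?mem_enum.
Qed.

Lemma mprim_bound p q (F : R -> 'M[R]_(p, q)) a b M : pwc F -> a <= b -> 0 <= M ->
  (forall t, a < t < b -> `|F t| <= M) -> `|mprim F b - mprim F a| <= M * (b - a).
Proof.
move=> HF ab M0 HM; have [D HD] := mprim_derive HF.
apply: (mvt_norm (D := D)) => //; first exact: mprim_continuous.
by move=> t tab /HD dF; exists (F t); [exact: dF|exact: HM].
Qed.

Lemma mprim_eq0 p q (F : R -> 'M[R]_(p, q)) a b : pwc F -> a <= b ->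
  (forall t, a < t < b -> F t = 0) -> mprim F b = mprim F a.
Proof.
move=> HF ab H0; apply/eqP; rewrite -subr_eq0 -normr_le0 -[leRHS](mul0r (b - a)).
by apply: mprim_bound => // t /H0 ->; rewrite normr0.
Qed.

End MatrixPrimitive.

Section Pairing.
Variables (R : realType) (n m : nat) (A : 'I_m.+1 -> 'M[R]_n) (h : 'I_m.+1 -> R).
Hypothesis h_ge0 : forall j, 0 <= h j.
Implicit Types (t s u a b T : R) (p q : nat).

(* The sum over [j] of the integrals of [z (u - s - h j) *m A j *m y s] for [s] in
   [T - h j, T], written as increments of primitives. *)
Definition memory p q (z : R -> 'M[R]_(p, n)) (y : R -> 'M[R]_(n, q)) u T : 'M[R]_(p, q) :=
  \sum_j (mprim (fun s => z (u - s - h j) *m A j *m y s) T -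
          mprim (fun s => z (u - s - h j) *m A j *m y s) (T - h j)).

Lemma pwc_memory p q (z : R -> 'M[R]_(p, n)) (y : R -> 'M[R]_(n, q)) u j :
  pwc z -> pwc y -> pwc (fun s => z (u - s - h j) *m A j *m y s).
Proof.
move=> Hz Hy; apply: pwc_mulmx => //; apply: pwc_mulmx; last exact: pwc_cst.
have := pwc_opp (u - h j) Hz; congr pwc; apply/funext => s; congr z; ring.
Qed.

Lemma memory_bound p q (z : R -> 'M[R]_(p, n)) (y : R -> 'M[R]_(n, q)) u T H Z Y :
  pwc z -> pwc y -> (forall j, h j <= H) -> 0 <= Z -> 0 <= Y ->
  (forall t, u - T - H <= t <= u - T -> `|z t| <= Z) ->
  (forall t, T - H <= t <= T -> `|y t| <= Y) ->
  `|memory z y u T| <= H * (n%:R * anorm A) * Z * Y.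
Proof.
move=> Hz Hy hH Z0 Y0 zZ yY; apply: le_trans (ler_norm_sum _ _ _) _.
rewrite /anorm 2!mulr_sumr mulr_suml mulr_suml; apply: ler_sum => j _.
have hj0 := h_ge0 j; have hjH := hH j.
have -> : H * (n%:R * (n%:R * `|A j|)) * Z * Y = n%:R * (n%:R * Z * `|A j|) * Y * H.
  by ring.
set c := n%:R * _ * Y; have c0 : 0 <= c by rewrite !mulr_ge0.
apply: (@le_trans _ _ (c * (T - (T - h j)))); last by rewrite subKr ler_wpM2l.
apply: mprim_bound => //; [exact: pwc_memory|lra|move=> t tT].
apply: le_trans (ler_norm_mulmx _ _) _.
apply: ler_pM; rewrite ?mulr_ge0//; last by apply: yY; lra.
rewrite -mulrA ler_wpM2l//; apply: le_trans (ler_norm_mulmx _ _) _.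
by rewrite mulrA ler_wpM2r// ler_wpM2l//; apply: zZ; lra.
Qed.

Lemma memory_eq0 p q (z : R -> 'M[R]_(p, n)) (y : R -> 'M[R]_(n, q)) u T :
  pwc z -> pwc y ->
  (forall j t, T - h j < t < T -> z (u - t - h j) *m A j *m y t = 0) ->
  memory z y u T = 0.
Proof.
move=> Hz Hy H; apply: big1 => j _; apply/eqP; rewrite subr_eq0; apply/eqP.
apply: mprim_eq0; [exact: pwc_memory| |exact: H].
by have := h_ge0 j; lra.
Qed.

(* [zb] and [yb] are continuous functions that agree with [z] and [y] on the
   interval of interest, where [z] and [y] may jump at the ends. *)
Lemma pairing p q (z zb r : R -> 'M[R]_(p, n)) (y yb : R -> 'M[R]_(n, q))
    (Dz Dy : seq R) u a b : a <= b -> pwc z -> pwc y -> pwc r ->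
  continuous zb -> continuous yb ->
  (forall t, a < t < b -> t \notin Dy ->
     is_derive t 1 yb (\sum_j A j *m y (t - h j)) /\ yb t = y t) ->
  (forall t, u - b < t < u - a -> t \notin Dz ->
     is_derive t 1 zb (\sum_j z (t - h j) *m A j + r t) /\ zb t = z t) ->
  zb (u - b) *m yb b + memory z y u b + mprim (fun s => r (u - s) *m y s) b =
  zb (u - a) *m yb a + memory z y u a + mprim (fun s => r (u - s) *m y s) a.
Proof.
move=> ab Hz Hy Hr czb cyb dy dz.
pose C j := mprim (fun s => z (u - s - h j) *m A j *m y s).
have HC j := pwc_memory u j Hz Hy.
have HP : pwc (fun s => r (u - s) *m y s) by apply: pwc_mulmx => //; exact: pwc_opp.
have [D HD] := mprim_derive HP.
have /choice[E HE] : forall j, exists D : seq R, forall t, t \notin D ->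
    is_derive t 1 (C j) (z (u - t - h j) *m A j *m y t).
  by move=> j; exact: mprim_derive.
pose F t := zb (u - t) *m yb t + memory z y u t + mprim (fun s => r (u - s) *m y s) t.
apply: (@mvt_const _ _ _ F (Dy ++ [seq u - d | d <- Dz] ++ D ++
  flatten [seq E j | j <- enum 'I_m.+1] ++
  flatten [seq [seq d + h j | d <- E j] | j <- enum 'I_m.+1])) => //.
  move=> t.
  have c1 : {for t, continuous (fun t => zb (u - t) *m yb t)}.
    apply: continuous_mulmx; last exact: cyb.
    by apply: continuous_reflect; exact: czb.
  have c2 : {for t, continuous (memory z y u)}.
    apply: continuous_sumr => j _; apply: continuousB; first exact: mprim_continuous.
    by apply: continuous_affine; exact: mprim_continuous.
  have c3 : {for t, continuous (mprim (fun s => r (u - s) *m y s))}.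
    exact: mprim_continuous.
  exact: (continuous_addf (continuous_addf c1 c2) c3).
move=> t tab; rewrite !mem_cat !negb_or => /and5P[tDy tDz tD tE tE'].
have [dyt yE] := dy t tab tDy.
have [|dzt zE] := dz (u - t) ltac:(lra).
  by apply: contra tDz => tDz; apply/mapP; exists (u - t); rewrite ?subKr.
have dC j : is_derive t 1 (C j) (z (u - t - h j) *m A j *m y t).
  apply: HE; apply: contra tE => tE; apply/flattenP; exists (E j) => //.
  by apply/mapP; exists j; rewrite ?mem_enum.
(* The delayed end of the memory integrals cancels z(u - t) y'(t); their other end cancels the
   delayed part of z'. What remains is the term with [r], cancelled by its primitive. *)
have dC' j : is_derive t 1 (fun t => C j (t - h j)) (z (u - t) *m A j *m y (t - h j)).
  have -> : z (u - t) = z (u - (t - h j) - h j) by congr z; ring.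
  apply: is_derive_affine; apply: HE; apply: contra tE' => tE'; apply/flattenP.
  exists [seq d + h j | d <- E j]; first by apply/mapP; exists j; rewrite ?mem_enum.
  by apply/mapP; exists (t - h j); rewrite ?subrK.
have dM : is_derive t 1 (memory z y u)
    (\sum_j (z (u - t - h j) *m A j *m y t - z (u - t) *m A j *m y (t - h j))).
  have dCC j := is_derive_subf (dC j) (dC' j).
  exact: (@is_derive_sumr _ _ _ _ _ (fun j t => C j t - C j (t - h j)) _ _ (fun j _ => dCC j)).
apply: (is_derive_eq (is_derive_addf (is_derive_addf
  (is_derive_mulmx (is_derive_reflect dzt) dyt) dM) (HD t tD))).
rewrite yE zE mulNmx mulmxDl sumrB mulmx_suml mulmx_sumr.
under [X in - _ + X]eq_bigr => j _ do rewrite mulmxA.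
move: (\sum_j _) (\sum_j _) (r (u - t) *m y t) => X Y Z.
by apply/matrixP => i j; rewrite !mxE; ring.
Qed.

End Pairing.

(** * The Lyapunov matrix and the fundamental matrix *)

Section LyapunovMatrix.
Variables (R : realType) (n m : nat) (A : 'I_m.+1 -> 'M[R]_n) (h : 'I_m.+1 -> R).
Hypothesis h_ge0 : forall j, 0 <= h j.
Implicit Types (t s u a b T : R) (p q : nat).
Local Notation K := (Kfun A h).
Local Notation Kb := (fun t => 1%:M + Klim A h t).

Lemma Kb_continuous : continuous Kb.
Proof.
move=> t; apply: (@continuous_addf _ _ (cst 1%:M) (Klim A h) t).
  exact: cst_continuous.
exact: Klim_continuous.
Qed.

Lemma pwc_Kfun : pwc K.
Proof.
split.
  by exists [:: 0] => t; rewrite inE => t0; exact: Kfun_continuous.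
move=> b; have [_ /(_ b)[M HM]] := pwc_continuous Kb_continuous.
exists M => t /HM; have [t0|t0] := ltP t 0; last by rewrite Kfun_ge0.
by rewrite Kfun_lt0// normr0 => /(le_trans (normr_ge0 _)).
Qed.

Lemma is_derive_Kb t : 0 < t -> t \notin [seq h j | j <- enum 'I_m.+1] ->
  is_derive t 1 Kb (\sum_j A j *m K (t - h j)) /\ Kb t = K t.
Proof.
move=> t0 th; split; last by rewrite Kfun_ge0// ltW.
rewrite -[X in is_derive _ _ _ X]add0r.
apply: is_derive_addf; apply: is_derive_Klim => // j.
by apply: contra th => /eqP ->; apply/mapP; exists j; rewrite ?mem_enum.
Qed.

Lemma memory_lt0 p (z : R -> 'M[R]_(p, n)) T : pwc z -> memory A h z K T 0 = 0.
Proof.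
move=> Hz; apply: memory_eq0 => //; first exact: pwc_Kfun.
by move=> j t /andP[_ t0]; rewrite Kfun_lt0// mulmx0.
Qed.

Lemma memory_end p q (z : R -> 'M[R]_(p, n)) (y : R -> 'M[R]_(n, q)) T :
  pwc z -> pwc y -> (forall t, t < 0 -> z t = 0) -> memory A h z y T T = 0.
Proof.
move=> Hz Hy z0; apply: memory_eq0 => // j t /andP[t0 _].
by rewrite z0 ?mul0mx//; lra.
Qed.

(** The pairing with [r = 0] and [u = T]: [z] runs backwards while [y] runs forwards, so the values
    at 0 and at [T] exchange their roles. Applied with a known [y] it works as a uniqueness
    statement for [z], and conversely. *)
Lemma pairing0 p q (z zb : R -> 'M[R]_(p, n)) (y yb : R -> 'M[R]_(n, q))
    (Dz Dy : seq R) T : 0 <= T -> pwc z -> pwc y -> continuous zb -> continuous yb ->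
  (forall t, 0 < t < T -> t \notin Dy ->
     is_derive t 1 yb (\sum_j A j *m y (t - h j)) /\ yb t = y t) ->
  (forall t, 0 < t < T -> t \notin Dz ->
     is_derive t 1 zb (\sum_j z (t - h j) *m A j) /\ zb t = z t) ->
  zb 0 *m yb T + memory A h z y T T = zb T *m yb 0 + memory A h z y T 0.
Proof.
move=> T0 Hz Hy czb cyb dy dz.
have dz' t : T - T < t < T - 0 -> t \notin Dz ->
    is_derive t 1 zb (\sum_j z (t - h j) *m A j + 0) /\ zb t = z t.
  by rewrite subrr subr0 addr0; exact: dz.
have := @pairing _ _ _ A h _ _ z zb (fun=> 0) y yb Dz Dy T 0 T T0
  Hz Hy (pwc_cst _) czb cyb dy dz'.
rewrite subrr subr0; set P := mprim _.
have -> : P T = P 0; last by move/addIr.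
apply: mprim_eq0 => // [|t _]; last by rewrite mul0mx.
by apply: pwc_mulmx => //; exact: pwc_cst.
Qed.

Lemma variation_of_constants q (y yb : R -> 'M[R]_(n, q)) (D : seq R) T : 0 <= T ->
  pwc y -> continuous yb ->
  (forall t, 0 < t < T -> t \notin D ->
     is_derive t 1 yb (\sum_j A j *m y (t - h j)) /\ yb t = y t) ->
  yb T = K T *m yb 0 + memory A h K y T 0.
Proof.
move=> T0 Hy cyb dy.
have := @pairing0 _ _ K Kb y yb [seq h j | j <- enum 'I_m.+1] D T T0 pwc_Kfun Hy
  Kb_continuous cyb dy.
have K0 : Klim A h 0 = 0 by rewrite Klim_le0.
rewrite K0 addr0 mul1mx (memory_end T pwc_Kfun Hy (@Kfun_lt0 _ _ _ A h h_ge0)).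
rewrite addr0 -Kfun_ge0//; apply=> t /andP[t0 _] tD.
by rewrite -Kfun_comm//; exact: is_derive_Kb.
Qed.

Variables (W : 'M[R]_n) (U : R -> 'M[R]_n).
Hypothesis W_sym : W^T = W.
Hypothesis HU : is_delay_lyapunov_matrix A h W U.

Let U_continuous : continuous U. Proof. by case: HU. Qed.

Let U_sym t : U t = (U (- t))^T. Proof. by case: HU. Qed.

Let Upos t : 0 < t -> is_derive t 1 U (\sum_j U (t - h j) *m A j).
Proof. by case: HU => _ H _ _; exact: H. Qed.

Let Uneg t : t < 0 -> is_derive t 1 U (- \sum_j (A j)^T *m U (t + h j)).
Proof.
move=> t0.
have := is_derive_trmx (is_derive_reflect (f := U) (c := 0) (@Upos (0 - t) _)).
rewrite (_ : (fun s => _) = U); last by apply/funext => s; rewrite sub0r -U_sym.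
move=> /(_ ltac:(lra)) H; apply: (is_derive_eq H); rewrite linearN/= linear_sum/=.
congr (- _); apply: eq_bigr => j _; rewrite trmx_mul [U (t + h j)]U_sym.
by congr (_ *m (U _)^T); ring.
Qed.

(** For t > 0, minus the defect of U in the equation U'(t) = - sum_j A_j^T U(t + h_j), which holds
    for t < 0. Hence the cut at 0 in [G]. *)
Definition Gb t : 'M[R]_n := - \sum_j (U (t - h j) *m A j + (A j)^T *m U (t + h j)).

Let G t : 'M[R]_n := if t < 0 then 0 else Gb t.

Lemma Gb0 : Gb 0 = W.
Proof.
case: HU => _ _ _ E; rewrite -[W]opprK -E /Gb; congr (- _); apply: eq_bigr => j _.
by rewrite sub0r add0r.
Qed.

Lemma Gb_continuous : continuous Gb.
Proof.
move=> t; apply: continuousN; apply: continuous_sumr => j _.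
apply: (@continuous_addf _ _ (fun t => U (t - h j) *m A j)
  (fun t => (A j)^T *m U (t + h j))); apply: continuous_mulmx; try exact: cst_continuous.
  by apply: continuous_affine; exact: U_continuous.
rewrite -[h j]opprK; apply: (continuous_affine (c := - h j)); exact: U_continuous.
Qed.

Let pwc_G : pwc G.
Proof.
have [_ Hb] := pwc_continuous Gb_continuous; split; last first.
  move=> b; have [M HM] := Hb b; exists M => t tb; rewrite /G; case: ifP => _.
    by rewrite normr0; apply: le_trans (HM _ tb).
  exact: HM.
exists [:: 0] => t; rewrite inE => tn0; apply/continuous_distP => e e0.
have [tlt|tgt] : t < 0 \/ 0 < t by move: tn0; case: ltgtP; auto.
  exists (- t) => [|s]; first lra.
  rewrite ltr_norml => /andP[_ st]; have s0 : s < 0 by lra.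
  by rewrite /G s0 tlt subrr normr0 ltW.
have /continuous_distP/(_ e e0)[d d0 Hd] : {for t, continuous Gb} by exact: Gb_continuous.
exists (Num.min d t) => [|s]; first by rewrite lt_min d0.
rewrite lt_min => /andP[sd]; rewrite ltr_norml => /andP[st _].
have s0 : 0 < s by lra.
have GE x : 0 < x -> G x = Gb x by move=> x0; rewrite /G ltNge ltW.
by rewrite !GE//; exact: Hd.
Qed.

(* [U] is differentiable off [0], and its derivative can be written with
   either of the two one-sided equations, up to the correction [G]. *)
Let dU_left t : t != 0 ->
  is_derive t 1 U (- G t - \sum_j (A j)^T *m U (t + h j)).
Proof.
move=> tn0; have [tlt|tgt] : t < 0 \/ 0 < t by move: tn0; case: ltgtP; auto.
  by rewrite /G tlt oppr0 add0r; exact: Uneg.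
apply: is_derive_eq; first exact: Upos.
by rewrite /G ltNge ltW//= /Gb opprK big_split/= addrK.
Qed.

Let dU_right t : t != 0 ->
  is_derive t 1 U (\sum_j U (t - h j) *m A j + (G (- t))^T).
Proof.
move=> tn0; have [tlt|tgt] : t < 0 \/ 0 < t by move: tn0; case: ltgtP; auto.
  apply: is_derive_eq; first exact: Uneg.
  rewrite /G oppr_lt0 ltNge ltW//= /Gb linearN/=.
  have UE j : (U (- t - h j))^T = U (t + h j) by rewrite -opprD -U_sym.
  have UE' j : (U (- t + h j))^T = U (t - h j) by rewrite [RHS]U_sym opprB addrC.
  have -> : (\sum_j (U (- t - h j) *m A j + (A j)^T *m U (- t + h j)))^T =
      \sum_j ((A j)^T *m U (t + h j) + U (t - h j) *m A j).
    rewrite linear_sum/=; apply: eq_bigr => j _.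
    by rewrite linearD/= !trmx_mul trmxK UE UE'.
  by rewrite big_split/= opprD addrC subrK.
apply: is_derive_eq; first exact: Upos.
by rewrite /G oppr_lt0 tgt trmx0 addr0.
Qed.

(** Differentiating the two sums of [Gb] with different forms of the equation of U makes their
    second-order terms opposite, which leaves only the correction [G] at the delayed times. *)
Let dG t : 0 < t -> t \notin [seq h j | j <- enum 'I_m.+1] ->
  is_derive t 1 Gb (\sum_j G (t - h j) *m A j) /\ Gb t = G t.
Proof.
move=> t0 th; split; last by rewrite /G ltNge ltW.
have thj j : t - h j != 0.
  rewrite subr_eq0; apply: contra th => /eqP ->.
  by apply/mapP; exists j; rewrite ?mem_enum.
have d1 j : is_derive t 1 (fun s => U (s - h j) *m A j)
    ((- G (t - h j) - \sum_i (A i)^T *m U (t - h j + h i)) *m A j).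
  apply: is_derive_eq.
    apply: is_derive_mulmx (is_derive_cst (A j) t 1).
    by apply: is_derive_affine; exact: dU_left.
  by rewrite mulmx0 addr0.
have d2 j : is_derive t 1 (fun s => (A j)^T *m U (s + h j))
    ((A j)^T *m \sum_i U (t + h j - h i) *m A i).
  apply: is_derive_eq.
    apply: is_derive_mulmx (is_derive_cst (A j)^T t 1) _.
    rewrite -[X in fun s => U (s + X)]opprK; apply: is_derive_affine.
    by rewrite opprK; apply: Upos; have := h_ge0 j; lra.
  by rewrite mul0mx add0r.
have dS := @is_derive_sumr _ _ _ (index_enum _) xpredT
  (fun j s => U (s - h j) *m A j + (A j)^T *m U (s + h j)) _ t
  (fun j _ => is_derive_addf (d1 j) (d2 j)).
apply: (is_derive_eq (is_deriveN dS)).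
rewrite big_split/= opprD.
under eq_bigr => j _ do rewrite mulmxBl mulNmx.
rewrite sumrB sumrN opprB opprK addrC addrA.
(* Both double sums consist of the terms A_j^T U(t + h_j - h_i) A_i. *)
have -> : \sum_j (A j)^T *m (\sum_i U (t + h j - h i) *m A i) =
    \sum_j (\sum_i (A i)^T *m U (t - h j + h i)) *m A j.
  under eq_bigr => j _ do rewrite mulmx_sumr.
  rewrite exchange_big/=; apply: eq_bigr => i _; rewrite mulmx_suml.
  by apply: eq_bigr => j _; rewrite mulmxA addrAC.
by rewrite addNr add0r.
Qed.

(** [G] is 0 before 0, equals [W] at 0 and solves the equation with coefficients on the right;
    pairing it with K forces it to be [W *m K]. *)
Lemma Gb_Kfun t : 0 <= t -> Gb t = W *m K t.
Proof.
move=> t0.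
have := @pairing0 _ _ G Gb K Kb _ _ t t0 pwc_G pwc_Kfun Gb_continuous Kb_continuous
  (fun s sT sD => is_derive_Kb (proj1 (elimT andP sT)) sD)
  (fun s sT sD => dG (proj1 (elimT andP sT)) sD).
rewrite memory_lt0// memory_end//; first last.
- by move=> s s0; rewrite /G s0.
- exact: pwc_Kfun.
by rewrite !addr0 Gb0 -Kfun_ge0// Klim_le0// addr0 mulmx1.
Qed.

(** The reflexive conjunct fits the form required by [pairing]: U is continuous, so it is its own
    continuous companion. *)
Lemma is_derive_U t : t \notin [:: 0] ->
  is_derive t 1 U (\sum_j U (t - h j) *m A j + (K (- t))^T *m W) /\ U t = U t.
Proof.
rewrite inE => tn0; split=> //; apply: is_derive_eq; first exact: dU_right.
congr (_ + _); rewrite /G; case: ltP => t0; first by rewrite Kfun_lt0// trmx0 mul0mx.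
by rewrite Gb_Kfun// trmx_mul W_sym.
Qed.

Definition Kgram tau : R -> 'M[R]_n := mprim (fun s => (K (s - tau))^T *m W *m K s).

Lemma pwc_gram tau : pwc (fun s => (K (s - tau))^T *m W *m K s).
Proof.
apply: pwc_mulmx; last exact: pwc_Kfun.
apply: pwc_mulmx; last exact: pwc_cst.
by apply: pwc_trmx; apply: pwc_shift; exact: pwc_Kfun.
Qed.

Lemma lyapunov_gram tau T : 0 <= T ->
  U tau = U (tau - T) *m K T + memory A h U K tau T + (Kgram tau T - Kgram tau 0).
Proof.
move=> T0.
have HrU : pwc (fun t => (K (- t))^T *m W).
  apply: pwc_mulmx; last exact: pwc_cst; apply: pwc_trmx.
  by have := pwc_opp 0 pwc_Kfun; congr pwc; apply/funext => s; rewrite sub0r.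
have HUp := pwc_continuous U_continuous.
have := @pairing _ _ _ A h _ _ U U (fun t => (K (- t))^T *m W) K Kb _ _ tau 0 T T0
  HUp pwc_Kfun HrU U_continuous Kb_continuous
  (fun s sT sD => is_derive_Kb (proj1 (elimT andP sT)) sD) (fun s _ => @is_derive_U s).
have K0 : Klim A h 0 = 0 by rewrite Klim_le0.
rewrite memory_lt0// K0 !addr0 subr0 mulmx1 -Kfun_ge0//.
rewrite (_ : mprim _ = Kgram tau); last first.
  by congr mprim; apply/funext => s; rewrite opprB.
by move=> E; rewrite addrA E addrK.
Qed.

(** For s < T <= tau the factor K(s - tau) is 0, so the integral term disappears and U(tau) is a
    linear function of the state of K at time [T]. *)
Lemma lyapunov_propagation tau T : 0 <= T -> T <= tau ->
  U tau = U (tau - T) *m K T + memory A h U K tau T.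
Proof.
move=> T0 Ttau; rewrite [LHS](lyapunov_gram _ T0).
rewrite (_ : Kgram tau T = Kgram tau 0) ?subrr ?addr0//.
apply: mprim_eq0 => //; first exact: pwc_gram.
by move=> t tT; rewrite Kfun_lt0 ?trmx0 ?mul0mx//; lra.
Qed.

End LyapunovMatrix.

(** * Stability and the fundamental matrix *)

Section EuclideanNorm.
Variables (R : realType) (n : nat).
Implicit Types v w : 'cV[R]_n.

Lemma enorm_ge0 v : 0 <= enorm v. Proof. exact: sqrtr_ge0. Qed.

Lemma ler_enorm_entry v i : `|v i 0| <= enorm v.
Proof.
rewrite -sqrtr_sqr ler_wsqrtr// (bigD1 i)//= lerDl; apply: sumr_ge0 => j _.
exact: sqr_ge0.
Qed.

Lemma ler_norm_enorm v : `|v| <= enorm v.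
Proof.
apply/mx_norm_leP; first exact: enorm_ge0.
by move=> i j; rewrite (ord1 j) ler_enorm_entry.
Qed.

Lemma enorm_le v : enorm v <= Num.sqrt n%:R * `|v|.
Proof.
have -> : `|v| = Num.sqrt (`|v| ^+ 2) by rewrite sqrtr_sqr normr_id.
rewrite -sqrtrM// ler_wsqrtr//.
have -> : n%:R * `|v| ^+ 2 = \sum_(i < n) `|v| ^+ 2.
  by rewrite sumr_const card_ord mulr_natl.
by apply: ler_sum => i _; rewrite -[leLHS]real_normK ?num_real// lerXn2r ?nnegrE// ler_mx_entry.
Qed.

End EuclideanNorm.

(** * The columns of K as solutions of the system *)

Section Solutions.
Variables (R : realType) (n m : nat) (A : 'I_m.+1 -> 'M[R]_n) (h : 'I_m.+1 -> R).
Hypothesis h_ge0 : forall j, 0 <= h j.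
Hypothesis h_ord0 : h ord0 = 0.
Implicit Types (t s u a b T : R).
Local Notation mu := (@lebesgue_measure R).
Local Notation K := (Kfun A h).
Local Notation H := (max_delay h).

Lemma max_delay_ge0 : 0 <= H. Proof. exact: bigmax_ge_id. Qed.

Lemma le_max_delay j : h j <= H.
Proof.
have [->|j0] := eqVneq j ord0; first by rewrite h_ord0 max_delay_ge0.
exact: le_bigmax_cond.
Qed.

Lemma finite_ae (D : seq R) (P : R -> Prop) : (forall t, t \notin D -> P t) ->
  {ae mu, forall t, P t}.
Proof.
move=> HP; exists [set` D]; split.
- apply: countable_measurable; first exact: measurable_set1.
  exact/finite_set_countable/finite_seq.
- exact/countable_lebesgue_measure0/finite_set_countable/finite_seq.
- by move=> t /= nP; apply: contrapT => /negP /HP.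
Qed.

(** The right-hand side is bounded on bounded intervals, so [x] is Lipschitz there and therefore
    absolutely continuous. [xb] forgets the jump that [x] may have at 0. *)
Lemma is_solutionI (x xb : R -> 'cV[R]_n) (D : seq R) : continuous xb ->
  (forall t, 0 <= t -> xb t = x t) -> pwc x ->
  (forall t, 0 < t -> t \notin D -> is_derive t 1 xb (\sum_j A j *m x (t - h j))) ->
  is_solution A h x x.
Proof.
move=> cxb xE [_ Hb] dx; split=> //.
- apply: (@subspace_eq_continuous _ _ _ xb); last exact: continuous_subspaceT.
  by move=> t; rewrite inE/= in_itv/= andbT => /xE.
- move=> T T0 e e0; have [M HM] := Hb (T + H).
  have TH0 : 0 <= T + H by rewrite addr_ge0 ?max_delay_ge0// ltW.
  have M0 : 0 <= M by apply: le_trans (HM 0 _); rewrite ?normr0.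
  have L0 : 0 <= anorm A * M by rewrite mulr_ge0// anorm_ge0.
  have lip u v : 0 <= u -> u <= v -> v <= T -> `|x v - x u| <= anorm A * M * (v - u).
    move=> u0 uv vT; rewrite -!xE//; last by rewrite (le_trans u0).
    apply: (mvt_norm (D := D)) => // t /andP[ut tv] tD.
    exists (\sum_j A j *m x (t - h j)); first by apply: dx => //; lra.
    apply: norm_Asum => j; apply: HM; have := le_max_delay j; have := h_ge0 j.
    by rewrite ler_norml => *; apply/andP; split; lra.
  exists (e / (anorm A * M + 1)); first by apply: divr_gt0 => //; lra.
  move=> N u v Huv _; rewrite ltr_pdivlMr; last lra.
  move=> Hd; apply: (@le_lt_trans _ _ (\sum_i anorm A * M * (v i - u i))).
    by apply: ler_sum => i _; have [? [? ?]] := Huv i; exact: lip.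
  have S0 : 0 <= \sum_i (v i - u i).
    by apply: sumr_ge0 => i _; have [_ [? _]] := Huv i; rewrite subr_ge0.
  by rewrite -mulr_sumr; lra.
- apply: (@finite_ae (0 :: D)) => t; rewrite inE negb_or => /andP[tn0 tD] t0.
  have {}t0 : 0 < t by rewrite lt_neqAle eq_sym tn0.
  apply: (@is_derive_near _ _ xb _ _ _ t) => //; last exact: dx.
  by move=> s; rewrite ltr_norml => /andP[st _]; apply: xE; lra.
Qed.

Lemma Kfun_solution (g : 'cV[R]_n) : is_solution A h (fun t => K t *m g) (fun t => K t *m g).
Proof.
apply: (@is_solutionI _ (fun t => (1%:M + Klim A h t) *m g) [seq h j | j <- enum 'I_m.+1]).
- move=> t; apply: continuous_mulmx; last exact: cst_continuous.
  exact: Kb_continuous.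
- by move=> t t0; rewrite Kfun_ge0.
- by apply: pwc_mulmx; [exact: pwc_Kfun|exact: pwc_cst].
- move=> t t0 tD; have [dK _] := is_derive_Kb A h_ge0 t0 tD.
  apply: (is_derive_eq (is_derive_mulmx dK (is_derive_cst g t 1))).
  by rewrite mulmx0 addr0 mulmx_suml; apply: eq_bigr => j _; rewrite mulmxA.
Qed.

(** As an initial function this is 0 before 0 and [g] at 0. It is admissible because a jump at the
    right end is allowed, and this lets stability speak about K. *)
Lemma Kfun_piecewise (g : 'cV[R]_n) a : piecewise_continuous a 0 (fun t => K t *m g).
Proof.
have near0 t : t < 0 -> \forall s \near t, K s *m g = 0.
  move=> t0; exists (- t) => [|s /=]; first by rewrite /= oppr_gt0.
  rewrite ltr_norml => /andP[st _]; rewrite Kfun_lt0 ?mul0mx//; lra.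
split.
- exists [::] => t /andP[_ t0] _.
  apply: (is_derive_continuous (l := 0)).
  apply: (@is_derive_near _ _ (cst 0) _ _ _ (- t)); first lra.
  by move=> s; rewrite ltr_norml => /andP[_ st]; rewrite Kfun_lt0 ?mul0mx//; lra.
- move=> t /andP[_ t0]; apply/cvg_ex; exists 0; apply: cvg_near_cst.
  by apply: cvg_within; exact: near0.
- move=> t /andP[_ t0]; apply/cvg_ex; exists 0; apply: cvg_near_cst.
  apply: filterS (nbhs_left_lt t) => s st; rewrite Kfun_lt0 ?mul0mx//.
  exact: lt_le_trans t0.
Qed.

Lemma Kfun_init_norm (g : 'cV[R]_n) : init_norm h (fun t => K t *m g) <= enorm g.
Proof.
apply: ge_sup.
  by exists (enorm (K 0 *m g)); exists 0 => //=; rewrite in_itv/= lexx oppr_le0 max_delay_ge0.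
move=> _ [t /= tI <-]; move: tI; rewrite in_itv/= => /andP[_].
rewrite le_eqVlt => /predU1P[->|t0].
  by rewrite Kfun0// mul1mx.
rewrite Kfun_lt0// mul0mx; apply: le_trans (enorm_ge0 _).
by apply: le_trans (enorm_le _) _; rewrite normr0 mulr0.
Qed.

Lemma stable_Kfun_decay : exponentially_stable A h ->
  exists C sigma, 0 < sigma /\ forall t, 0 <= t -> `|K t| <= C * expR (- (sigma * t)).
Proof.
move=> [c [sigma [c1 s0 Hs]]]; have c0 : 0 <= c by lra.
pose C := \sum_(j < n) c * enorm (delta_mx j 0 : 'cV[R]_n).
exists C, sigma; split=> // t t0.
have e0 := expR_ge0 (- (sigma * t)).
apply/mx_norm_leP => [|i j].
  by rewrite mulr_ge0//; apply: sumr_ge0 => j _; rewrite mulr_ge0// enorm_ge0.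
have -> : K t i j = (K t *m delta_mx j (0 : 'I_1)) i 0.
  rewrite [RHS]mxE (bigD1 j)//= [delta_mx _ _ _ _]mxE !eqxx mulr1 big1 ?addr0// => k kj.
  by rewrite [delta_mx _ _ _ _]mxE (negbTE kj) mulr0.
apply: le_trans (ler_enorm_entry _ _) _.
apply: le_trans (Hs _ _ (Kfun_piecewise _ _) (Kfun_solution _) t t0) _.
apply: (@le_trans _ _ (c * enorm (delta_mx j 0 : 'cV[R]_n) * expR (- (sigma * t)))).
  rewrite mulrAC; apply: ler_wpM2r => //; apply: ler_wpM2l => //.
  exact: Kfun_init_norm.
rewrite ler_wpM2r// /C (bigD1 j)//= lerDl; apply: sumr_ge0 => k _.
by rewrite mulr_ge0// enorm_ge0.
Qed.

Lemma Kfun_vanish : exponentially_stable A h ->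
  forall e : R, 0 < e -> exists T, forall t, T <= t -> `|K t| <= e.
Proof.
move=> /stable_Kfun_decay[C [sigma [s0 HK]]] e e0.
pose C' := `|C| + 1; have C'0 : 0 < C' by rewrite /C'; have := normr_ge0 C; lra.
(* From exp(u) >= 1 + u: beyond this time C' <= e sigma t <= e exp(sigma t). *)
exists (Num.max 0 (C' / (e * sigma))) => t; rewrite ge_max => /andP[t0 tT].
apply: le_trans (HK t t0) _.
have st : 0 <= sigma * t by rewrite mulr_ge0// ltW.
apply: (@le_trans _ _ (C' * expR (- (sigma * t)))).
  by rewrite ler_wpM2r ?expR_ge0// /C'; have := ler_norm C; lra.
rewrite expRN ler_pdivrMr ?expR_gt0//.
have h1 : C' <= e * (sigma * t).
  by move: tT; rewrite ler_pdivrMr ?mulr_gt0//; nra.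
apply: le_trans h1 _; rewrite ler_wpM2l ?(ltW e0)//.
by apply: le_trans (expR_ge1Dx _); lra.
Qed.

End Solutions.

(** * Positivity of the block matrices *)

Section RealArithmetic.
Variable R : realFieldType.
Implicit Types x y z w c d : R.

Lemma ler_sub_oppr x y c d : - x - - y <= - c * d -> c * d <= x - y.
Proof. lra. Qed.

Lemma gt0_of_increments a b c d w x y z : 0 < c * d -> c * (a + d - a) <= y - z ->
  0 * b <= x - y -> - (c * d / 2) <= w -> 0 < w + (x - z).
Proof. lra. Qed.

End RealArithmetic.

Section Positivity.
Variables (R : realType) (n m : nat) (A : 'I_m.+1 -> 'M[R]_n) (h : 'I_m.+1 -> R).
Hypothesis h_ge0 : forall j, 0 <= h j.
Hypothesis h_ord0 : h ord0 = 0.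
Variables (W : 'M[R]_n) (U : R -> 'M[R]_n).
Hypothesis W_pos : posdefmx W.
Hypothesis HU : is_delay_lyapunov_matrix A h W U.
Implicit Types (t u a b T tau e : R) (p q r : nat).
Local Notation K := (Kfun A h).
Local Notation H := (max_delay h).

Lemma mxblock_quad r (B : 'I_r -> 'I_r -> 'M[R]_n) (v : 'cV[R]_(\sum_(i < r) n)) :
  v^T *m (\mxblock_(i, j) B i j) *m v =
  \sum_i \sum_j (submxcol v i)^T *m B i j *m submxcol v j.
Proof.
rewrite -{1 2}(submxcolK v) -mulmxA mul_mxblock_mxrow tr_mxcol mul_mxrow_mxcol.
apply: eq_bigr => i _; rewrite mulmx_sumr; apply: eq_bigr => j _.
by rewrite mulmxA.
Qed.

Lemma Kmx_sym r : (Kmx h U r)^T = Kmx h U r.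
Proof.
rewrite /Kmx tr_mxblock; apply/eq_mxblockP => i j.
have [_ _ US _] := HU; rewrite [RHS]US; congr (U _)^T.
by rewrite -mulNr -mulNr opprB.
Qed.

Lemma Kfun_bounded T e : (forall t, T <= t -> `|K t| <= e) ->
  exists2 M, 0 <= M & forall t, `|K t| <= M.
Proof.
move=> HT; have [_ /(_ `|T|)[M HM]] := pwc_Kfun A h_ge0.
have M0 : 0 <= M by apply: le_trans (HM 0 _); rewrite ?normr0.
exists (M + `|e|) => [|t]; first by rewrite addr_ge0.
have [tT|tT] := leP T t.
  by apply: le_trans (HT t tT) _; have := ler_norm e; lra.
have [t0|t0] := ltP t 0; first by rewrite Kfun_lt0// normr0 addr_ge0.
have /HM : `|t| <= `|T| by rewrite ger0_norm// (le_trans (ltW tT))// ler_norm.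
by have := normr_ge0 e; lra.
Qed.

Hypothesis K_vanish : forall e, 0 < e -> exists T, forall t, T <= t -> `|K t| <= e.

Let U_pwc : pwc U. Proof. by apply: pwc_continuous; case: HU. Qed.

(** Propagation with [T = tau = t] expresses U(t) through U on [-H, 0] and K on [t - H, t], where
    both are bounded. *)
Lemma U_bounded : exists2 M, 0 <= M & forall t, `|U t| <= M.
Proof.
have [T /Kfun_bounded[MK MK0 HMK]] := K_vanish ltr01.
have [_ /(_ H)[Z HZ]] := U_pwc.
have Z0 : 0 <= Z by apply: le_trans (HZ 0 _); rewrite ?normr0// max_delay_ge0.
pose M := n%:R * Z * MK + H * (n%:R * anorm A) * Z * MK.
have HM t : 0 <= t -> `|U t| <= M.
  move=> t0; rewrite (lyapunov_propagation h_ge0 W_pos.1 HU t0 (lexx t)) subrr.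
  apply: le_trans (ler_normD _ _) _; apply: lerD.
    apply: le_trans (ler_norm_mulmx _ _) _.
    rewrite ler_pM ?mulr_ge0 ?ler_wpM2l//.
    by apply: HZ; rewrite normr0 max_delay_ge0.
  apply: memory_bound => //; first exact: pwc_Kfun.
    by move=> j; exact: le_max_delay.
  rewrite subrr => s /andP[s1 s2]; apply: HZ.
  by rewrite ler_norml (le_trans s2) ?max_delay_ge0// andbT; lra.
exists M => [|t]; first exact: le_trans (HM 0 _).
have [t0|t0] := leP 0 t; first exact: HM.
by have [_ _ -> _] := HU; rewrite norm_trmx; apply: HM; lra.
Qed.

(** The state of K at time [T] involves K on [T - H, T] only, and U is bounded; hence the shift by H
    in [T0]. *)
Lemma lyapunov_remainder tau e : 0 < e -> exists T0, forall T, T0 <= T ->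
  `|U (tau - T) *m K T + memory A h U K tau T| <= e.
Proof.
move=> e0; have [MU MU0 HMU] := U_bounded.
pose c := n%:R * MU + H * (n%:R * anorm A) * MU.
have c0 : 0 <= c.
  by rewrite addr_ge0 ?mulr_ge0 ?anorm_ge0 ?max_delay_ge0.
have e'0 : 0 < e / (c + 1) by apply: divr_gt0 => //; lra.
have [T1 HT1] := K_vanish e'0.
exists (T1 + H) => T T1T; have H0 := max_delay_ge0 h.
apply: (@le_trans _ _ (c * (e / (c + 1)))); last first.
  by rewrite mulrA ler_pdivrMr; nra.
apply: le_trans (ler_normD _ _) _; rewrite mulrDl; apply: lerD.
  apply: le_trans (ler_norm_mulmx _ _) _.
  by rewrite ler_pM ?mulr_ge0 ?ler_wpM2l//; apply: HT1; lra.
apply: memory_bound => //; [exact: pwc_Kfun| |exact: ltW|].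
  by move=> j; exact: le_max_delay.
by move=> t tT; apply: HT1; lra.
Qed.

Lemma lyapunov_posdef r (s : 'I_r -> R) (g : 'I_r -> 'cV[R]_n) k0 :
  injective s -> g k0 != 0 ->
  0 < (\sum_i \sum_k (g i)^T *m U (s i - s k) *m g k) 0 0.
Proof.
move=> s_inj gk0.
(* Among the translates with nonzero coefficient, take the one that starts first: right after its
   start it is alone, so nothing can cancel it. *)
have [{gk0}k0 gk0 smin] := @arg_minP _ _ _ k0 (fun k => g k != 0) s gk0.
set a := s k0 in smin.
(* Each term is stopped at its own time [t - s k], so that all integrals run in the common variable
   t and [Q] is a primitive of the single form y^T W y. *)
pose Q t := \sum_i \sum_k (g i)^T *m Kgram A h W (s i - s k) (t - s k) *m g k.
pose E T := \sum_i \sum_k (g i)^T *m (U (s i - s k - (T - s k)) *m K (T - s k) +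
  memory A h U K (s i - s k) (T - s k)) *m g k.
have sumE T : (forall k, s k <= T) ->
    \sum_i \sum_k (g i)^T *m U (s i - s k) *m g k = E T + (Q T - Q a).
  move=> HT; rewrite /E /Q -sumrB -big_split; apply: eq_bigr => i _ /=.
  rewrite -sumrB -big_split; apply: eq_bigr => k _ /=.
  rewrite -mulmxBl -mulmxBr -mulmxDl -mulmxDr.
  have [->|gk] := eqVneq (g k) 0; first by rewrite !mulmx0.
  have T0 : 0 <= T - s k by rewrite subr_ge0.
  have -> : Kgram A h W (s i - s k) (a - s k) = Kgram A h W (s i - s k) 0.
    apply: esym; apply: mprim_eq0; [exact: pwc_gram|by rewrite subr_le0; exact: smin|].
    by move=> t /andP[_ t0]; rewrite (Kfun_lt0 A h_ge0 t0) mulmx0.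
  by rewrite {1}(lyapunov_gram h_ge0 W_pos.1 HU (s i - s k) T0).
pose y t := \sum_k K (t - s k) *m g k.
have yE t : (y t)^T *m W *m y t = \sum_i \sum_k (g i)^T *m
    ((K (t - s k - (s i - s k)))^T *m W *m K (t - s k)) *m g k.
  have -> : (y t)^T = \sum_i (K (t - s i) *m g i)^T by rewrite /y linear_sum.
  rewrite /y !mulmx_suml; apply: eq_bigr => i _.
  rewrite mulmx_sumr; apply: eq_bigr => k _.
  have -> : t - s k - (s i - s k) = t - s i by ring.
  by rewrite trmx_mul !mulmxA.
have y_ge0 t : 0 <= ((y t)^T *m W *m y t) 0 0.
  have [->|y0] := eqVneq (y t) 0; first by rewrite mulmx0 mxE.
  exact/ltW/W_pos.2.
have cQ : continuous Q.
  move=> t; apply: continuous_sumr => i _; apply: continuous_sumr => k _.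
  apply: continuous_mulmx; last exact: cst_continuous.
  apply: continuous_mulmx; first exact: cst_continuous.
  by apply: continuous_affine; apply: mprim_continuous; exact: pwc_gram.
have [D dQ] : exists D : seq R, forall t, t \notin D ->
    is_derive t 1 Q ((y t)^T *m W *m y t).
  have /choice[D HD] : forall ik : 'I_r * 'I_r, exists D : seq R, forall t, t \notin D ->
      is_derive t 1 (Kgram A h W (s ik.1 - s ik.2))
        ((K (t - (s ik.1 - s ik.2)))^T *m W *m K t).
    by move=> ik; apply: mprim_derive; exact: pwc_gram.
  exists (flatten [seq [seq d + s ik.2 | d <- D ik] | ik <- enum {: 'I_r * 'I_r}]) => t tD.
  rewrite yE; apply: (@is_derive_sumr _ _ _ _ _ (fun i t => \sum_k (g i)^T *m
    Kgram A h W (s i - s k) (t - s k) *m g k)) => i _.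
  apply: (@is_derive_sumr _ _ _ _ _ (fun k t => (g i)^T *m
    Kgram A h W (s i - s k) (t - s k) *m g k)) => k _.
  have dK : is_derive (t - s k) 1 (Kgram A h W (s i - s k))
      ((K (t - s k - (s i - s k)))^T *m W *m K (t - s k)).
    apply: (HD (i, k)); apply: contra tD => tD; apply/flattenP.
    exists [seq d + s k | d <- D (i, k)].
      by apply/mapP; exists (i, k); rewrite ?mem_enum.
    by apply/mapP; exists (t - s k); rewrite ?subrK.
  have d1 := is_derive_mulmx (is_derive_cst (g i)^T t 1) (is_derive_affine dK).
  apply: (is_derive_eq (is_derive_mulmx d1 (is_derive_cst (g k) t 1))).
  by rewrite mul0mx add0r mulmx0 addr0.
have Q_ge t1 t2 c : t1 <= t2 -> (forall t, t1 < t < t2 -> c <= ((y t)^T *m W *m y t) 0 0) ->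
    c * (t2 - t1) <= Q t2 0 0 - Q t1 0 0.
  move=> t12 Hc; suff : - Q t2 0 0 - (- Q t1 0 0) <= - c * (t2 - t1).
    exact: ler_sub_oppr.
  apply: (@mvt_le _ (fun t => - Q t 0 0) D) => // [t|t t12' tD].
    by apply: continuousN; have /continuous_mxP := cQ t; exact.
  exists (- ((y t)^T *m W *m y t) 0 0); last by rewrite lerN2; exact: Hc.
  by apply: is_deriveN; move/is_derive_mxP: (dQ t tD); exact.
have [d [c [d0 c0 Hc]]] : exists d c, [/\ 0 < d, 0 < c &
    forall t, a < t < a + d -> c <= ((y t)^T *m W *m y t) 0 0].
  pose f t := (((1%:M + Klim A h t) *m g k0)^T *m W *m ((1%:M + Klim A h t) *m g k0)) 0 0.
  have cf : {for 0, continuous f}.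
    have cK : {for 0, continuous (fun t => (1%:M + Klim A h t) *m g k0)}.
      by apply: continuous_mulmx; [exact: Kb_continuous|exact: cst_continuous].
    have /continuous_mxP : {for 0, continuous (fun t =>
        ((1%:M + Klim A h t) *m g k0)^T *m W *m ((1%:M + Klim A h t) *m g k0))}.
      apply: continuous_mulmx (cK); apply: continuous_mulmx; last exact: cst_continuous.
      exact: continuous_trmx cK.
    by move=> /(_ 0 0).
  have f0 : 0 < f 0 by rewrite /f Klim_le0// addr0 mul1mx; exact: W_pos.2.
  have f20 : 0 < f 0 / 2 by lra.
  have /continuous_distP/(_ _ f20)[d1 d10 Hd1] := cf.
  (* Shorter than the wait until the next active translate starts; injectivity of [s] makes it
     positive. *)
  pose d2 := \big[Num.min/d1]_(k | (g k != 0) && (k != k0)) (s k - a).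
  have d20 : 0 < d2.
    apply: (big_ind (fun x => 0 < x)) => // [x z x0 z0|k /andP[gk kk0]]; first by rewrite lt_min x0.
    rewrite subr_gt0 lt_neqAle smin// andbT eq_sym.
    by apply: contra kk0 => /eqP /s_inj ->.
  exists d2, (f 0 / 2); split=> // t /andP[at_ td].
  have yt : y t = K (t - a) *m g k0.
    rewrite /y (bigD1 k0)//= big1 ?addr0// => k kk0.
    have [->|gk] := eqVneq (g k) 0; first by rewrite mulmx0.
    rewrite Kfun_lt0 ?mul0mx//.
    have : d2 <= s k - a by apply: bigmin_le_cond; rewrite gk.
    by lra.
  have : `|f (t - a) - f 0| <= f 0 / 2.
    apply: Hd1; rewrite subr0 gtr0_norm ?subr_gt0//.
    have : d2 <= d1 by exact: bigmin_le_id.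
    by lra.
  rewrite yt Kfun_ge0 ?subr_ge0 ?(ltW at_)// -/(f (t - a)) ler_norml => /andP[h1 _].
  lra.
(* The integral gains at least [c * d] just after [a]; the remainder is allowed to consume half of
   it. *)
have cd0 : 0 < c * d / 2 by rewrite divr_gt0// mulr_gt0.
have [T0 HT0] : exists T0, forall T, T0 <= T -> `|E T| <= c * d / 2.
  pose C := \sum_i \sum_k n%:R * (n%:R * `|(g i)^T|) * `|g k|.
  have C0 : 0 <= C.
    by apply: sumr_ge0 => i _; apply: sumr_ge0 => k _; rewrite !mulr_ge0.
  have e0 : 0 < c * d / 2 / (C + 1) by apply: divr_gt0 => //; lra.
  have /choice[T0 HT0] : forall ik : 'I_r * 'I_r, exists T0, forall T, T0 <= T ->
      `|U (s ik.1 - s ik.2 - T) *m K T + memory A h U K (s ik.1 - s ik.2) T| <=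
      c * d / 2 / (C + 1).
    by move=> ik; exact: lyapunov_remainder.
  exists (\big[Num.max/0]_ik (T0 ik + s ik.2)) => T HT.
  apply: (@le_trans _ _ (C * (c * d / 2 / (C + 1)))); last first.
    by rewrite mulrA ler_pdivrMr; nra.
  rewrite /C mulr_suml; apply: le_trans (ler_norm_sum _ _ _) _.
  apply: ler_sum => i _; rewrite mulr_suml; apply: le_trans (ler_norm_sum _ _ _) _.
  apply: ler_sum => k _; apply: le_trans (ler_norm_mulmx _ _) _.
  rewrite [leRHS]mulrAC ler_wpM2r// -[leRHS]mulrA ler_wpM2l//.
  apply: le_trans (ler_norm_mulmx _ _) _; rewrite ler_wpM2l ?mulr_ge0//.
  apply: (HT0 (i, k)); rewrite lerBrDr; apply: le_trans HT.
  exact: (le_bigmax _ (fun ik => T0 ik + s ik.2) (i, k)).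
pose T := Num.max (Num.max T0 (a + d)) (\big[Num.max/a]_k s k).
have sT k : s k <= T by rewrite /T le_max; apply/orP; right; exact: le_bigmax.
have h1 : c * (a + d - a) <= Q (a + d) 0 0 - Q a 0 0 by apply: Q_ge => //; lra.
have h2 : 0 * (T - (a + d)) <= Q T 0 0 - Q (a + d) 0 0.
  by apply: Q_ge => //; rewrite /T !le_max lexx orbT.
have /(le_trans (ler_mx_entry _ 0 0)) : `|E T| <= c * d / 2.
  by apply: HT0; rewrite /T !le_max lexx.
rewrite ler_norml => /andP[h3 _]; rewrite (sumE T sT).
have -> : (E T + (Q T - Q a)) 0 0 = E T 0 0 + (Q T 0 0 - Q a 0 0) by rewrite !mxE.
by apply: gt0_of_increments h1 h2 h3; rewrite mulr_gt0.
Qed.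

(** The sign makes the difference of points i and j equal to (j - i) H / (r - 1), the argument in
    block (i, j). For [r = 1] the division by 0 is harmless, as there is one index. *)
Lemma grid_injective r : 0 < H ->
  injective (fun i : 'I_r => - (i%:R / (r%:R - 1) * H)).
Proof.
move=> H0 i j /oppr_inj; case: r i j => [[]//|[i j _|r i j]].
  by apply: val_inj; rewrite /= (ord1 i) (ord1 j).
have r0 : r.+2%:R - 1 != 0 :> R by rewrite -[r.+2]addn1 natrD addrK pnatr_eq0.
have Hn0 : H != 0 by rewrite gt_eqF.
move=> /(mulIf Hn0) /(mulIf (invr_neq0 r0)) /eqP.
by rewrite eqr_nat => /eqP; exact: val_inj.
Qed.

Lemma Kmx_posdef r : 0 < H -> posdefmx (Kmx h U r).
Proof.
move=> H0; split=> [|v v0]; first exact: Kmx_sym.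
have [k vk] : exists k, submxcol v k != 0.
  apply/existsP; apply: contraR v0 => /existsPn v0; rewrite -(submxcolK v).
  by rewrite (eq_mxcol (B_ := fun=> 0)) ?mxcol0// => i; move/negPn/eqP: (v0 i).
rewrite mxblock_quad; have := lyapunov_posdef (grid_injective (r := r) H0) vk.
congr (_ < fun_of_matrix _ _ _); apply: eq_bigr => i _; apply: eq_bigr => j _.
by congr (_ *m U _ *m _); ring.
Qed.

End Positivity.

(** * Discretization of the state *)

Section Grid.
Variables (R : realType) (n m : nat) (A : 'I_m.+1 -> 'M[R]_n) (h : 'I_m.+1 -> R).
Hypothesis h_ge0 : forall j, 0 <= h j.
Hypothesis h_ord0 : h ord0 = 0.
Variables (W : 'M[R]_n) (U : R -> 'M[R]_n).
Hypothesis W_sym : W^T = W.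
Hypothesis HU : is_delay_lyapunov_matrix A h W U.
Implicit Types (t u a b T tau e s : R) (p q r : nat).
Local Notation K := (Kfun A h).
Local Notation H := (max_delay h).

Let U_continuous : continuous U. Proof. by case: HU. Qed.

Lemma U_lipschitz b : exists2 L, 0 <= L & forall s t, `|s| <= b -> `|t| <= b ->
  `|U s - U t| <= L * `|s - t|.
Proof.
have [_ /(_ (b + H))[MU HMU]] := pwc_continuous U_continuous.
have [_ /(_ b)[MK HMK]] := pwc_Kfun A h_ge0.
pose L := anorm A * `|MU| + n%:R * `|MK| * `|W|.
have L0 : 0 <= L by rewrite addr_ge0 ?mulr_ge0 ?anorm_ge0.
exists L => //.
suff HL s t : s <= t -> `|s| <= b -> `|t| <= b -> `|U t - U s| <= L * (t - s).
  move=> s t sb tb; have [st|ts] := leP s t.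
    by rewrite distrC [`|s - t|]distrC (ger0_norm (_ : 0 <= t - s)) ?subr_ge0//; exact: HL.
  by rewrite (gtr0_norm (_ : 0 < s - t)) ?subr_gt0//; apply: HL => //; exact: ltW.
rewrite !ler_norml => st /andP[s1 s2] /andP[t1 t2].
apply: (mvt_norm (D := [:: 0])) => // x /andP[x1 x2] xD.
have [dU _] := is_derive_U h_ge0 W_sym HU xD; eexists; first exact: dU.
apply: le_trans (ler_normD _ _) _; apply: lerD.
  apply: norm_sumA => j; apply: le_trans (ler_norm _).
  apply: HMU; have := h_ge0 j; have := le_max_delay h_ord0 j.
  by rewrite ler_norml => *; lra.
apply: le_trans (ler_norm_mulmx _ _) _; rewrite ler_wpM2r// ler_wpM2l// norm_trmx.
by apply: le_trans (ler_norm _); apply: HMK; rewrite normrN ler_norml; lra.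
Qed.

(* The state of [K] at time [T], seen as a measure on [T, T + H], is an atom
   [K T] at [T] plus a density. [cell] lumps the mass of the density on each
   cell of a uniform grid at the right end of the cell. *)
Definition grid T N (i : nat) : R := T + H - i%:R * (H / N.+1%:R).

(** A unit at time s acts through [A j] at time s + h_j, so a point v of [T, T + H] corresponds to s
    = v - h_j, capped at [T]. Over the whole grid these points sweep exactly [T - h_j, T]. *)
Let clip T j v := Num.min (v - h j) T.

Let AK j s : 'M[R]_n := A j *m K s.

Definition cell T N (i : nat) : 'M[R]_n :=
  if (i < N.+1)%N then \sum_j (mprim (AK j) (clip T j (grid T N i)) -
                               mprim (AK j) (clip T j (grid T N i.+1)))
  else K T.

Let H_ge0 : 0 <= H. Proof. exact: max_delay_ge0. Qed.

Lemma grid0 T N : grid T N 0 = T + H.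
Proof. by rewrite /grid mul0r subr0. Qed.

Lemma grid_last T N : grid T N N.+1 = T.
Proof. by rewrite /grid mulrCA divff ?pnatr_eq0// mulr1 addrK. Qed.

Lemma grid_step T N i : grid T N i - grid T N i.+1 = H / N.+1%:R.
Proof. rewrite /grid -[i.+1]addn1 natrD; ring. Qed.

Let step_ge0 N : 0 <= H / N.+1%:R. Proof. by rewrite divr_ge0. Qed.

Lemma grid_le T N i : grid T N i.+1 <= grid T N i.
Proof. by rewrite -subr_ge0 grid_step. Qed.

Lemma grid_range T N i : (i <= N.+1)%N -> T <= grid T N i <= T + H.
Proof.
move=> iN; apply/andP; split; last by rewrite /grid gerBl mulr_ge0.
by rewrite -{1}(grid_last T N) /grid lerD2l lerN2 ler_wpM2r// ler_nat.
Qed.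

Let clip_homo T j v w : v <= w -> clip T j v <= clip T j w.
Proof.
move=> vw; rewrite le_min !ge_min lexx orbT andbT.
by apply/orP; left; lra.
Qed.

Let clip0 T N j : clip T j (grid T N 0) = T.
Proof. by rewrite /clip grid0 min_r//; have := le_max_delay h_ord0 j; lra. Qed.

Let clip_last T N j : clip T j (grid T N N.+1) = T - h j.
Proof. by rewrite /clip grid_last min_l//; have := h_ge0 j; lra. Qed.

Let clip_telescope (V : zmodType) (f : R -> V) T N j :
  \sum_(i < N.+1) (f (clip T j (grid T N i)) - f (clip T j (grid T N i.+1))) =
  f T - f (T - h j).
Proof.
transitivity (f (clip T j (grid T N 0)) - f (clip T j (grid T N N.+1))); last first.
  by rewrite clip0 clip_last.
rewrite -(big_mkord xpredT (fun i => f (clip T j (grid T N i)) - f (clip T j (grid T N i.+1)))).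
rewrite -[RHS]opprB -(telescope_sumr (fun i => f (clip T j (grid T N i))))//.
by rewrite -sumrN; apply: eq_bigr => i _; rewrite opprB.
Qed.

Let pwc_AK j : pwc (AK j).
Proof. by apply: pwc_mulmx; [exact: pwc_cst|exact: pwc_Kfun]. Qed.

(** On each cell U(u - s - h_j) is replaced by its value at the grid point. The argument moves by at
    most one step, so the error is the Lipschitz constant times the step times a bound on the mass
    of the density. *)
Lemma grid_approx T N u L MK : 0 <= T -> 0 <= u <= T + H -> 0 <= L -> 0 <= MK ->
  (forall s, `|s| <= T + H -> `|K s| <= MK) ->
  (forall s t, `|s| <= T + H -> `|t| <= T + H -> `|U s - U t| <= L * `|s - t|) ->
  `|\sum_(i < N.+2) U (u - grid T N i) *m cell T N i -
    (U (u - T) *m K T + memory A h U K u T)| <=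
  L * (H / N.+1%:R) * (n%:R * anorm A * MK * H).
Proof.
move=> T0 /andP[u0 uT] L0 MK0 HMK HL.
rewrite big_ord_recr/= {2}/cell ltnn grid_last opprD addrA addrK.
pose P j := mprim (fun s => U (u - s - h j) *m A j *m K s).
have HP j : pwc (fun s => U (u - s - h j) *m A j *m K s).
  exact: (@pwc_memory _ _ _ A h _ _ U K u j (pwc_continuous U_continuous) (pwc_Kfun A h_ge0)).
have -> : memory A h U K u T = \sum_(i < N.+1) \sum_j
    (P j (clip T j (grid T N i)) - P j (clip T j (grid T N i.+1))).
  by rewrite exchange_big; apply: eq_bigr => j _; rewrite clip_telescope.
rewrite -sumrB; apply: le_trans (ler_norm_sum _ _ _) _.
pose c j := L * (H / N.+1%:R) * (n%:R * (n%:R * `|A j|) * MK).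
apply: (@le_trans _ _ (\sum_(i < N.+1) \sum_j
    c j * (clip T j (grid T N i) - clip T j (grid T N i.+1)))); last first.
  rewrite exchange_big/= /anorm !(mulr_sumr, mulr_suml).
  apply: ler_sum => j _; rewrite -mulr_sumr (clip_telescope id) subKr /c.
  rewrite -[leLHS]mulrA; apply: ler_wpM2l; first by rewrite mulr_ge0.
  by apply: ler_wpM2l; [rewrite !mulr_ge0|exact: le_max_delay].
apply: ler_sum => i _; rewrite /cell ltn_ord mulmx_sumr -sumrB.
apply: le_trans (ler_norm_sum _ _ _) _; apply: ler_sum => j _.
pose F s := U (u - grid T N i) *m mprim (AK j) s - P j s.
have -> : U (u - grid T N i) *m (mprim (AK j) (clip T j (grid T N i)) -
     mprim (AK j) (clip T j (grid T N i.+1))) -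
    (P j (clip T j (grid T N i)) - P j (clip T j (grid T N i.+1))) =
    F (clip T j (grid T N i)) - F (clip T j (grid T N i.+1)).
  by rewrite /F mulmxBr; apply/matrixP => k l; rewrite !mxE; ring.
have [D1 HD1] := mprim_derive (pwc_AK j); have [D2 HD2] := mprim_derive (HP j).
have cF : continuous F.
  move=> x; apply: (@continuousB _ _ _ (fun s => U (u - grid T N i) *m mprim (AK j) s) (P j)).
    apply: continuous_mulmx; first exact: cst_continuous.
    by apply: mprim_continuous; exact: pwc_AK.
  by apply: mprim_continuous; exact: HP.
apply: (mvt_norm (D := D1 ++ D2)) => //.
- by apply: clip_homo; exact: grid_le.
- by rewrite !mulr_ge0.
move=> s /andP[s1 s2]; rewrite mem_cat negb_or => /andP[sD1 sD2].
have d1 := is_derive_mulmx (is_derive_cst (U (u - grid T N i)) s 1) (HD1 s sD1).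
exists (0 *m mprim (AK j) s + U (u - grid T N i) *m AK j s -
  U (u - s - h j) *m A j *m K s).
  exact: is_derive_subf d1 (HD2 s sD2).
rewrite mul0mx add0r /AK mulmxA -mulmxBl -mulmxBl.
have sT : s < T by move: s2; rewrite lt_min => /andP[].
have su : s < grid T N i - h j by move: s2; rewrite lt_min => /andP[].
have su' : grid T N i.+1 - h j < s.
  by move: s1; rewrite gt_min => /orP[//|]; lra.
have /andP[g1 g2] := grid_range T (ltnW (ltn_ord i)).
have /andP[g3 g4] := grid_range T (ltn_ord i).
have hj := h_ge0 j; have hH := le_max_delay h_ord0 j; have gs := grid_step T N i.
apply: le_trans (ler_norm_mulmx _ _) _.
apply: (@le_trans _ _ (n%:R * (n%:R * (L * (H / N.+1%:R)) * `|A j|) * MK)); last first.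
  by rewrite /c le_eqVlt; apply/orP; left; apply/eqP; ring.
apply: ler_pM; rewrite ?mulr_ge0//; last by apply: HMK; rewrite ler_norml; lra.
rewrite ler_wpM2l//; apply: le_trans (ler_norm_mulmx _ _) _.
rewrite ler_wpM2r// ler_wpM2l//.
have r1 : `|u - grid T N i| <= T + H by rewrite ler_norml; lra.
have r2 : `|u - s - h j| <= T + H by rewrite ler_norml; lra.
apply: le_trans (HL _ _ r1 r2) _.
by rewrite ler_wpM2l// ler_norml; move: (H / _) gs => d gs; lra.
Qed.

Lemma cell_sum T N MK : 0 <= T -> 0 <= MK ->
  (forall s, `|s| <= T + H -> `|K s| <= MK) ->
  \sum_(i < N.+2) `|cell T N i| <= anorm A * MK * H + MK.
Proof.
move=> T0 MK0 HMK; rewrite big_ord_recr/= {2}/cell ltnn; apply: lerD; last first.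
  by apply: HMK; rewrite ger0_norm// lerDl.
apply: (@le_trans _ _ (\sum_(i < N.+1) \sum_j
    n%:R * `|A j| * MK * (clip T j (grid T N i) - clip T j (grid T N i.+1)))); last first.
  rewrite exchange_big/= /anorm !mulr_suml.
  apply: ler_sum => j _; rewrite -mulr_sumr (clip_telescope id) subKr.
  by apply: ler_wpM2l; [rewrite !mulr_ge0|exact: le_max_delay].
apply: ler_sum => i _; rewrite /cell ltn_ord; apply: le_trans (ler_norm_sum _ _ _) _.
apply: ler_sum => j _; apply: mprim_bound; rewrite ?mulr_ge0//.
  by apply: clip_homo; exact: grid_le.
move=> s /andP[s1 s2]; apply: le_trans (ler_norm_mulmx _ _) _; rewrite ler_wpM2l ?mulr_ge0//.
apply: HMK; have sT : s < T by move: s2; rewrite lt_min => /andP[].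
have su' : grid T N i.+1 - h j < s.
  by move: s1; rewrite gt_min => /orP[//|]; lra.
have /andP[g3 g4] := grid_range T (ltn_ord i).
have hj := h_ge0 j; have hH := le_max_delay h_ord0 j.
by rewrite ler_norml; lra.
Qed.

(** The claim is that the remainder [Phi 0] has a nonnegative form. Up to an error of order 1/N,
    this form is the quadratic form of [Kmx] with N + 2 blocks at the vectors [cell T N i *m g]. *)
Lemma Kgram_le T (g : 'cV[R]_n) : 0 <= T ->
  (forall r, (0 < r)%N -> possemidefmx (Kmx h U r)) ->
  (g^T *m (Kgram A h W 0 T - Kgram A h W 0 0) *m g) 0 0 <= (g^T *m U 0 *m g) 0 0.
Proof.
move=> T0 psd; pose Phi u := U (u - T) *m K T + memory A h U K u T.
rewrite [U 0](lyapunov_gram h_ge0 W_sym HU 0 T0) -/(Phi 0).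
set X := Kgram _ _ _ _ T - _; rewrite mulmxDr mulmxDl [in leRHS]mxE lerDr.
have [L L0 HL] := U_lipschitz (T + H).
have [_ /(_ (T + H))[MK HMK]] := pwc_Kfun A h_ge0.
have MK0 : 0 <= MK by apply: le_trans (HMK 0 _); rewrite ?normr0// addr_ge0.
pose C1 := n%:R * anorm A * MK * H; pose C2 := anorm A * MK * H + MK.
have C10 : 0 <= C1 by rewrite !mulr_ge0 ?anorm_ge0.
have C20 : 0 <= C2 by rewrite addr_ge0 ?mulr_ge0 ?anorm_ge0.
pose C := n%:R * n%:R * n%:R * C2 * (L * H * C1) * `|g| * `|g| +
  n%:R * n%:R * (L * H * C1) * `|g| * `|g|.
have C0 : 0 <= C by rewrite addr_ge0 ?mulr_ge0 ?anorm_ge0.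
(* [C] does not depend on [N], so a negative value of the form would be contradicted by a large
   [N]. *)
suff HN N : 0 <= (g^T *m Phi 0 *m g) 0 0 + C / N.+1%:R.
  rewrite leNgt; apply/negP => q0.
  have := HN (Num.truncn (C / - (g^T *m Phi 0 *m g) 0 0)).
  set q := (g^T *m Phi 0 *m g) 0 0 in q0 *.
  have := truncnS_gt (C / - q); set N := Num.truncn _.
  rewrite ltr_pdivrMr ?oppr_gt0// => HN' HN''.
  have N0 : 0 < N.+1%:R :> R by rewrite ltr0n.
  have : C / N.+1%:R < - q by rewrite ltr_pdivrMr// mulrC.
  by move: HN''; move: (C / _) => x; lra.
pose dl := H / N.+1%:R.
have d0 : 0 <= L * dl * C1 by rewrite mulr_ge0// mulr_ge0// step_ge0.
pose e u := \sum_(i < N.+2) U (u - grid T N i) *m cell T N i - Phi u.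
have He u : 0 <= u <= T + H -> `|e u| <= L * dl * C1.
  by move=> uT; exact: grid_approx.
have := (psd N.+2 isT).2 (\mxcol_(i < N.+2) (cell T N i *m g)).
rewrite mxblock_quad.
under eq_bigr => i _ do under eq_bigr => k _ do rewrite !mxcolK.
(* The discretization is used twice. The inner sum approximates [Phi] at a grid point, which equals
   U there because grid points are at least [T]. After transposition the outer sum approximates
   [Phi 0]. *)
have -> : \sum_(i < N.+2) \sum_(k < N.+2) (cell T N i *m g)^T *m
      U ((k%:R - i%:R) / (N.+2%:R - 1) * H) *m (cell T N k *m g) =
    \sum_(i < N.+2) (cell T N i *m g)^T *m e (grid T N i) *m g +
    (g^T *m (e 0 + Phi 0) *m g)^T.
  have inner (i : 'I_N.+2) : \sum_(k < N.+2) (cell T N i *m g)^T *m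
        U ((k%:R - i%:R) / (N.+2%:R - 1) * H) *m (cell T N k *m g) =
      (cell T N i *m g)^T *m e (grid T N i) *m g + (cell T N i *m g)^T *m U (grid T N i) *m g.
    have /andP[g1 _] := grid_range T (ltnSE (ltn_ord i)).
    rewrite (lyapunov_propagation h_ge0 W_sym HU T0 g1) -/(Phi _).
    rewrite -mulmxDl -mulmxDr /e subrK mulmx_sumr mulmx_suml.
    apply: eq_bigr => k _; rewrite !mulmxA; congr (_ *m U _ *m _ *m _).
    rewrite /grid (_ : N.+2%:R - 1 = N.+1%:R :> R); last first.
      by rewrite -[N.+2]addn1 natrD addrK.
    by move: (N.+1%:R^-1) => x; ring.
  under eq_bigr => i _ do rewrite inner.
  rewrite big_split/=; congr (_ + _).
  rewrite /e subrK mulmx_sumr mulmx_suml linear_sum/=; apply: eq_bigr => i _.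
  have [_ _ -> _] := HU; rewrite sub0r !trmx_mul trmxK !mulmxA.
  by rewrite -!mulmxA.
rewrite mxE [X in _ + X]mxE => /le_trans; apply.
rewrite [leLHS]addrC mulmxDr mulmxDl [X in X + _]mxE addrAC addrC lerD2l.
set x := \sum_(i < N.+2) _.
have hx : `|x| <= n%:R * n%:R * n%:R * C2 * (L * dl * C1) * `|g| * `|g|.
  apply: (@le_trans _ _ (\sum_(i < N.+2)
      n%:R * (n%:R * (n%:R * `|cell T N i| * `|g|) * (L * dl * C1)) * `|g|)).
    apply: le_trans (ler_norm_sum _ _ _) _; apply: ler_sum => i _.
    apply: le_trans (ler_norm_mulmx _ _) _; rewrite ler_wpM2r// ler_wpM2l//.
    apply: le_trans (ler_norm_mulmx _ _) _; rewrite ler_pM ?mulr_ge0//.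
      by rewrite ler_wpM2l// norm_trmx; exact: ler_norm_mulmx.
    apply: He; have /andP[? ->] := grid_range T (ltnSE (ltn_ord i)).
    by rewrite andbT (le_trans T0).
  have -> : \sum_(i < N.+2)
      n%:R * (n%:R * (n%:R * `|cell T N i| * `|g|) * (L * dl * C1)) * `|g| =
      n%:R * n%:R * n%:R * (\sum_(i < N.+2) `|cell T N i|) * (L * dl * C1) * `|g| * `|g|.
    by rewrite mulr_sumr !mulr_suml; apply: eq_bigr => i _; ring.
  rewrite ler_wpM2r// ler_wpM2r// ler_wpM2r//.
  by rewrite ler_wpM2l ?mulr_ge0//; exact: cell_sum.
have hy : `|g^T *m e 0 *m g| <= n%:R * n%:R * (L * dl * C1) * `|g| * `|g|.
  apply: le_trans (ler_norm_mulmx _ _) _; rewrite ler_wpM2r//.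
  apply: (@le_trans _ _ (n%:R * (n%:R * `|g| * (L * dl * C1)))); last first.
    by rewrite le_eqVlt; apply/orP; left; apply/eqP; ring.
  rewrite ler_wpM2l//; apply: le_trans (ler_norm_mulmx _ _) _.
  rewrite norm_trmx ler_wpM2l ?mulr_ge0//; apply: He.
  by rewrite lexx addr_ge0.
have := le_trans (ler_norm _) (le_trans (ler_mx_entry x 0 0) hx).
have := le_trans (ler_norm _) (le_trans (ler_mx_entry (g^T *m e 0 *m g) 0 0) hy).
have -> : C / N.+1%:R = n%:R * n%:R * n%:R * C2 * (L * dl * C1) * `|g| * `|g| +
    n%:R * n%:R * (L * dl * C1) * `|g| * `|g|.
  by rewrite /C /dl; ring.
by move=> h1 h2; rewrite addrC; apply: lerD.
Qed.

End Grid.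

(** * Square integrability of the fundamental matrix *)

Section PositiveDefinite.
Variables (R : realType) (n : nat) (W : 'M[R]_n).
Hypothesis W_pos : posdefmx W.

Lemma posdefmx_unit : W \in unitmx.
Proof.
rewrite -row_free_unit -kermx_eq0; apply/negPn/negP => /rowV0Pn[v].
move=> /sub_kermxP vW v0; have vT0 : v^T != 0.
  by apply: contra v0 => /eqP vT; rewrite -(trmxK v) vT trmx0.
by have := W_pos.2 _ vT0; rewrite trmxK vW mul0mx mxE ltxx.
Qed.

(* Cauchy-Schwarz for the inner product given by [W], applied to [v] and to the
   [i]-th column of the inverse of [W]. *)
Lemma posdefmx_entry : exists2 c, 0 <= c &
  forall v : 'cV[R]_n, (v^T *m v) 0 0 <= c * (v^T *m W *m v) 0 0.
Proof.
pose w i : 'cV[R]_n := invmx W *m delta_mx i 0.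
pose q (v : 'cV[R]_n) := (v^T *m W *m v) 0 0.
have q_ge0 v : 0 <= q v.
  by have [->|/(W_pos.2)/ltW//] := eqVneq v 0; rewrite /q mulmx0 mxE.
have Ww i : W *m w i = delta_mx i 0 by rewrite /w mulKVmx// posdefmx_unit.
have qw_gt0 i : 0 < q (w i).
  apply: W_pos.2; apply/eqP => w0; have := Ww i; rewrite w0 mulmx0.
  move=> /matrixP/(_ i 0); rewrite !mxE !eqxx => /eqP.
  by rewrite eq_sym oner_eq0.
have wv i (v : 'cV[R]_n) : v i 0 ^+ 2 <= q (w i) * q v.
  have wWv : (w i)^T *m W = (delta_mx i 0)^T by rewrite -Ww [RHS]trmx_mul W_pos.1.
  have vi : (w i)^T *m W *m v = (v i 0)%:M.
    rewrite wWv trmx_delta -rowE [LHS]mx11_scalar; congr _%:M; by rewrite mxE.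
  have iv : v^T *m W *m w i = (v i 0)%:M.
    rewrite -[RHS]tr_scalar_mx -vi [RHS]trmx_mul [((w i)^T *m W)^T]trmx_mul.
    by rewrite trmxK W_pos.1 mulmxA.
  (* The residual of [v] after its W-orthogonal projection on [w i]. *)
  have := q_ge0 (v - (v i 0 / q (w i)) *: w i).
  rewrite /q [(v - _)^T]linearB/= [(_ *: w i)^T]linearZ/= !mulmxBl !mulmxBr -!scalemxAl -!scalemxAr.
  rewrite iv vi.
  have [Qv QvE] : {X | X = v^T *m W *m v} by exists (v^T *m W *m v).
  have [Qw QwE] : {X | X = (w i)^T *m W *m w i} by exists ((w i)^T *m W *m w i).
  rewrite -QvE -QwE !mxE eqxx !mulr1n QvE QwE -/(q v) -/(q (w i)) => hq.
  set x := v i 0 in hq *; have E : x / q (w i) * q (w i) = x by rewrite divfK// gt_eqF.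
  have {}hq : 0 <= q v - x / q (w i) * x by rewrite E in hq; lra.
  have : 0 <= q (w i) * (q v - x / q (w i) * x) by rewrite mulr_ge0// ltW.
  rewrite mulrBr mulrA [q (w i) * (_ / _)]mulrC E expr2; lra.
(* This constant is the trace of the inverse of [W]. *)
exists (\sum_i q (w i)) => [|v]; first by apply: sumr_ge0.
rewrite mxE mulr_suml; apply: ler_sum => i _; rewrite mxE -expr2; exact: wv.
Qed.

End PositiveDefinite.

(** * Vanishing of integrable functions of controlled growth *)

Section Growth.
Variable R : realType.

Implicit Types (s t a b c d e x y z : R).

Lemma nondecreasing_cauchy (P : R -> R) B d : (forall s t, s <= t -> P s <= P t) ->
  (forall t, P t <= B) ->
  forall e, 0 < e -> exists T, forall t, T <= t -> P t - P (t - d) <= e.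
Proof.
move=> P_homo PB e e0.
have hS : has_sup (range P) by split; [exists (P 0); exists 0|exists B => _ [t _ <-]].
have [_ [T _ <-] HT] := sup_adherent e0 hS.
exists (T + d) => t Tt.
have h1 : P t <= sup (range P) by apply: ub_le_sup; [exact: hS.2|exists t].
have h2 : P T <= P (t - d) by apply: P_homo; lra.
lra.
Qed.

Lemma primitive_homo (N P : R -> R) (D : seq R) : continuous P ->
  (forall t, t \notin D -> is_derive t 1 P (N t)) -> (forall t, 0 <= N t) ->
  forall s t, s <= t -> P s <= P t.
Proof.
move=> cP dP N0 s t st; suff : - P t - (- P s) <= 0 * (t - s).
  by rewrite mul0r opprK addrC subr_le0.
apply: (@mvt_le _ (fun t => - P t) D) => // [x|x _ xD].
  exact: (@continuousN _ _ _ P x (cP x)).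
by exists (- N x); [apply: is_deriveN; exact: dP|rewrite oppr_le0].
Qed.

(* Averages the growth bound over an interval of length [H]. *)
Lemma vanish_of_growth (H : R) (N P : R -> R) (D : seq R) c B :
  0 < H -> continuous P -> (forall t, t \notin D -> is_derive t 1 P (N t)) ->
  (forall t, 0 <= N t) -> (forall t, P t <= B) -> 0 <= c ->
  (forall s t, 0 < s -> s <= t -> N t - N s <= c * (P t - P (s - H))) ->
  forall e, 0 < e -> exists T, forall t, T <= t -> N t <= e.
Proof.
move=> H0 cP dP N0 PB c0 grow e e0.
have P_homo := primitive_homo cP dP N0.
have d0 : 0 < 1 + H * c by have := mulr_ge0 (ltW H0) c0; lra.
(* Chosen so that the average over the window, at most [e'], and the growth inside it, at most
   [H * c * e'], add up to [H * e]. The growth at a point of the window looks back by another H,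
   hence the length [2 * H] below. *)
pose e' := H * e / (1 + H * c).
have e'0 : 0 < e' by apply: divr_gt0 => //; exact: mulr_gt0.
have e'E : e' * (1 + H * c) = H * e by rewrite /e' divfK// gt_eqF.
have [T HT] := nondecreasing_cauchy (2 * H) P_homo PB e'0.
exists (Num.max T (2 * H)) => t; rewrite ge_max => /andP[tT tH].
have hP := HT t tT.
have h1 : (N t * t - P t) - (N t * (t - H) - P (t - H)) <= c * e' * (t - (t - H)).
  apply: (@mvt_le _ (fun s => N t * s - P s) D) => [||x /andP[x1 x2] xD]; first lra.
    move=> x; apply: continuousB; last exact: cP.
    exact: (@mulrl_continuous _ (N t)).
  exists (N t * 1 - N x).
    have dl := @is_derive_scalef R R (N t) id x 1 (is_derive_id x 1).
    exact: is_derive_subf dl (dP x xD).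
  rewrite mulr1; have x0 : 0 < x by lra.
  apply: le_trans (grow x t x0 (ltW x2)) _.
  rewrite ler_wpM2l//; apply: le_trans hP.
  by rewrite lerD2l lerN2; apply: P_homo; lra.
have p1 : P (t - 2 * H) <= P (t - H) by apply: P_homo; lra.
have h2 : H * N t <= H * e by lra.
by move: h2; rewrite ler_pM2l.
Qed.

Lemma increments_le x x' y y' : x - x' - (y - y') <= 0 -> x - y <= x' - y'.
Proof. lra. Qed.

Lemma delayed_increments c x x' y y' z : 0 <= c -> x' <= x -> z <= y' -> z <= y ->
  c * (x + x' - (y + y')) <= 2 * c * (x - z).
Proof. by move=> c0 h1 h2 h3; rewrite [2 * c]mulrC -mulrA ler_wpM2l//; lra. Qed.

Lemma amgm_scaled c x y z z' w : 0 <= c -> w <= c * (x * y) -> x ^+ 2 <= z ->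
  y ^+ 2 <= z' -> 2 * w <= c * (z + z').
Proof.
move=> c0 h1 h2 h3; have : 0 <= c * (x - y) ^+ 2 by rewrite mulr_ge0 ?sqr_ge0.
have : 0 <= c * (z - x ^+ 2) by rewrite mulr_ge0// subr_ge0.
have : 0 <= c * (z' - y ^+ 2) by rewrite mulr_ge0// subr_ge0.
rewrite !expr2; lra.
Qed.

End Growth.

Section Vanishing.
Variables (R : realType) (n m : nat) (A : 'I_m.+1 -> 'M[R]_n) (h : 'I_m.+1 -> R).
Hypothesis h_ge0 : forall j, 0 <= h j.
Hypothesis h_ord0 : h ord0 = 0.
Implicit Types (t u a b T tau e s : R) (p q r : nat).
Local Notation K := (Kfun A h).
Local Notation H := (max_delay h).
Hypothesis H_gt0 : 0 < H.

(* The derivative of [|K g|^2] is controlled by [|K g|^2] on the last delay interval. *)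
Lemma Kfun_l2_vanish (g : 'cV[R]_n) B :
  (forall T, 0 <= T -> (mprim (fun s => (K s *m g)^T *m (K s *m g)) T -
     mprim (fun s => (K s *m g)^T *m (K s *m g)) 0) 0 0 <= B) ->
  forall e, 0 < e -> exists T, forall t, T <= t -> `|K t *m g| <= e.
Proof.
move=> HB e e0.
pose N s := ((K s *m g)^T *m (K s *m g)) 0 0.
have HN : pwc (fun s => (K s *m g)^T *m (K s *m g)).
  have HK : pwc (fun s => K s *m g) by apply: pwc_mulmx; [exact: pwc_Kfun|exact: pwc_cst].
  by apply: pwc_mulmx => //; exact: pwc_trmx.
pose P s := mprim (fun s => (K s *m g)^T *m (K s *m g)) s 0 0.
have NE s : N s = \sum_i (K s *m g) i 0 ^+ 2.
  by rewrite /N mxE; apply: eq_bigr => i _; rewrite mxE -expr2.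
have N_ge0 s : 0 <= N s by rewrite NE; apply: sumr_ge0 => i _; exact: sqr_ge0.
have norm_le s : `|K s *m g| ^+ 2 <= N s.
  rewrite -[leRHS]sqr_sqrtr// lerXn2r ?nnegrE ?sqrtr_ge0//.
  apply/mx_norm_leP; first exact: sqrtr_ge0.
  move=> i j; rewrite (ord1 j) -sqrtr_sqr ler_wsqrtr// NE (bigD1 i)//= lerDl.
  by apply: sumr_ge0 => k _; exact: sqr_ge0.
have cP : continuous P.
  by move=> t; have /continuous_mxP := mprim_continuous HN (x := t); exact.
have [D HD] := mprim_derive HN.
have dP s : s \notin D -> is_derive s 1 P (N s).
  by move=> /HD /is_derive_mxP; exact.
have P_homo := primitive_homo cP dP N_ge0.
have PB t : P t <= P 0 + B.
  apply: le_trans (P_homo t (Num.max t 0) _) _; first by rewrite le_max lexx.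
  have := HB (Num.max t 0); rewrite le_max lexx orbT => /(_ isT).
  by rewrite mxE [X in _ + X]mxE -/(P _) -/(P _) lerBlDl.
pose a2 := n%:R * anorm A; have a20 : 0 <= a2 by rewrite mulr_ge0 ?anorm_ge0.
have grow s t : 0 < s -> s <= t -> N t - N s <= 2 * a2 * (P t - P (s - H)).
  move=> s0 st.
  pose c j := n%:R * (n%:R * `|A j|).
  pose yb t := (1%:M + Klim A h t) *m g.
  (* By the arithmetic-geometric inequality, term j of the derivative of N is at most [c j] times N
     at the current plus N at the delayed time. [S] is a primitive of that bound, so N - S does not
     increase. *)
  pose S t := \sum_j c j *: (P t + P (t - h j)).
  have cS : continuous S.
    move=> x; apply: continuous_sumr => j _; apply: continuousZr.
    apply: (@continuous_addf _ _ P (fun t => P (t - h j))); first exact: cP.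
    by apply: continuous_affine; exact: cP.
  have cyb : continuous yb.
    move=> x; apply: continuous_mulmx; [exact: Kb_continuous|exact: cst_continuous].
  pose F t := ((yb t)^T *m yb t) 0 0 - S t.
  have ybE x : 0 <= x -> yb x = K x *m g by move=> x0; rewrite Kfun_ge0.
  have FE x : 0 <= x -> F x = N x - S x by move=> x0; rewrite /F ybE.
  have cF : continuous F.
    move=> x; apply: continuousB; last exact: cS.
    have /continuous_mxP : {for x, continuous (fun t => (yb t)^T *m yb t)}.
      by apply: continuous_mulmx; [apply: continuous_trmx; exact: cyb|exact: cyb].
    by move=> /(_ 0 0).
  pose D' := [seq h j | j <- enum 'I_m.+1] ++ D ++
    flatten [seq [seq d + h j | d <- D] | j <- enum 'I_m.+1].
  have : F t - F s <= 0 * (t - s).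
    apply: (@mvt_le _ F D') => // x /andP[sx xt].
    rewrite !mem_cat !negb_or => /and3P[xh xD xD'].
    have x0 : 0 < x by lra.
    have dPj j : is_derive x 1 (fun t => P (t - h j)) (N (x - h j)).
      apply: is_derive_affine; apply: dP; apply: contra xD' => xD'; apply/flattenP.
      exists [seq d + h j | d <- D]; first by apply/mapP; exists j; rewrite ?mem_enum.
      by apply/mapP; exists (x - h j); rewrite ?subrK.
    have dS : is_derive x 1 S (\sum_j c j *: (N x + N (x - h j))).
      have dPP j := is_derive_scalef (c j) (is_derive_addf (dP x xD) (dPj j)).
      exact: (@is_derive_sumr _ _ _ (index_enum _) xpredT
        (fun j t => c j *: (P t + P (t - h j))) _ x (fun j _ => dPP j)).
    have dy : is_derive x 1 yb (\sum_j A j *m (K (x - h j) *m g)).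
      have [dK _] := is_derive_Kb A h_ge0 x0 xh.
      apply: (is_derive_eq (is_derive_mulmx dK (is_derive_cst g x 1))).
      by rewrite mulmx0 addr0 mulmx_suml; apply: eq_bigr => j _; rewrite mulmxA.
    have /is_derive_mxP/(_ 0 0) dyy := is_derive_mulmx (is_derive_trmx dy) dy.
    eexists; first exact: is_derive_subf dyy dS.
    rewrite subr_le0 (_ : (_ + _) = 2 *: \sum_j (yb x)^T *m (A j *m (K (x - h j) *m g))).
      rewrite mxE summxE mulr_sumr; apply: ler_sum => j _.
      rewrite ybE ?(ltW x0)//.
      set y1 := K x *m g; set y2 := K (x - h j) *m g.
      have h1 : ((y1^T *m (A j *m y2)) 0 0) <= c j * (`|y1| * `|y2|).
        apply: le_trans (ler_norm _) _; apply: le_trans (ler_mx_entry _ _ _) _.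
        apply: le_trans (ler_norm_mulmx _ _) _; rewrite norm_trmx /c.
        apply: (@le_trans _ _ (n%:R * `|y1| * (n%:R * `|A j| * `|y2|))).
          by rewrite ler_wpM2l ?mulr_ge0// ler_norm_mulmx.
        by rewrite le_eqVlt; apply/orP; left; apply/eqP; ring.
      have cj0 : 0 <= c j by rewrite !mulr_ge0.
      by apply: (amgm_scaled cj0 h1); rewrite norm_le.
    rewrite -mulmx_sumr scaler_nat mulr2n; congr (_ + _).
    have tr11 (X : 'M[R]_1) : X^T = X by apply/matrixP => i j; rewrite mxE !ord1.
    by rewrite -[LHS]tr11 trmx_mul trmxK.
  have t0 : 0 <= t by apply: le_trans st; exact: ltW.
  rewrite mul0r (FE _ t0) (FE _ (ltW s0)) => /increments_le/le_trans; apply.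
  have -> : S t - S s = \sum_j c j * (P t + P (t - h j) - (P s + P (s - h j))).
    by rewrite /S -sumrB; apply: eq_bigr => j _; rewrite mulrBr.
  rewrite /a2 /anorm !mulr_sumr mulr_suml; apply: ler_sum => j _.
  have hj := h_ge0 j; have hH := le_max_delay h_ord0 j.
  by apply: delayed_increments; rewrite ?mulr_ge0//; apply: P_homo; lra.
have e20 : 0 < e ^+ 2 by exact: exprn_gt0.
have [T HT] := vanish_of_growth H_gt0 cP dP N_ge0 PB (mulr_ge0 (ler0n _ 2) a20) grow e20.
exists T => t /HT; move/(le_trans (norm_le t)).
by rewrite ler_pXn2r// ?nnegrE// ltW.
Qed.

Variables (W : 'M[R]_n) (U : R -> 'M[R]_n).
Hypothesis W_pos : posdefmx W.
Hypothesis HU : is_delay_lyapunov_matrix A h W U.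

(** Positive definiteness of [W] turns the bound on the integral of K^T W K into square
    integrability of [K t *m g] for each [g]; the basis vectors then give the columns of K. *)
Lemma psd_Kfun_vanish : (forall r, (0 < r)%N -> possemidefmx (Kmx h U r)) ->
  forall e, 0 < e -> exists T, forall t, T <= t -> `|K t| <= e.
Proof.
move=> psd e e0; have [c c0 Hc] := posdefmx_entry W_pos.
have Hg (g : 'cV[R]_n) : exists T, forall t, T <= t -> `|K t *m g| <= e.
  apply: (@Kfun_l2_vanish g (c * (g^T *m U 0 *m g) 0 0)) => // T T0.
  have hK := Kgram_le h_ge0 h_ord0 W_pos.1 HU g T0 psd.
  apply: le_trans (ler_wpM2l c0 hK).
  have HK : pwc (fun s => K s *m g) by apply: pwc_mulmx; [exact: pwc_Kfun|exact: pwc_cst].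
  have HN : pwc (fun s => (K s *m g)^T *m (K s *m g)).
    by apply: pwc_mulmx => //; exact: pwc_trmx.
  have [D HD] := mprim_derive HN.
  have [D' HD'] := mprim_derive (pwc_gram A h_ge0 W 0).
  pose P t := mprim (fun s => (K s *m g)^T *m (K s *m g)) t 0 0.
  have cP : continuous P.
    by move=> t; have /continuous_mxP := mprim_continuous HN (x := t); exact.
  pose F t := P t - c * (g^T *m Kgram A h W 0 t *m g) 0 0.
  have cg : continuous (fun t => (g^T *m Kgram A h W 0 t *m g) 0 0).
    move=> t; have /continuous_mxP : {for t, continuous (fun t =>
        g^T *m Kgram A h W 0 t *m g)}.
      apply: continuous_mulmx; last exact: cst_continuous.
      apply: continuous_mulmx; first exact: cst_continuous.
      by apply: mprim_continuous; exact: pwc_gram.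
    by move=> /(_ 0 0).
  have cF : continuous F.
    move=> t; apply: (continuous_subf (f := P)); first exact: cP.
    exact: (continuous_comp (cg t) (@mulrl_continuous _ c _)).
  have : F T - F 0 <= 0 * (T - 0).
    apply: (@mvt_le _ F (D ++ D')) => // t _.
    rewrite mem_cat negb_or => /andP[tD tD'].
    have d1 := is_derive_mulmx (is_derive_mulmx (is_derive_cst g^T t 1) (HD' t tD'))
      (is_derive_cst g t 1).
    have /is_derive_mxP/(_ 0 0) d2 := d1; have /is_derive_mxP/(_ 0 0) d3 := HD t tD.
    eexists; first exact: is_derive_subf d3 (is_derive_scalef c d2).
    rewrite mul0mx add0r mulmx0 addr0 subr_le0; apply: le_trans (Hc _) _.
    by rewrite subr0 trmx_mul !mulmxA.
  rewrite /F mul0r => /increments_le; rewrite -mulrBr /P.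
  have subE (X Y : 'M[R]_1) : (X - Y) 0 0 = X 0 0 - Y 0 0 by rewrite !mxE.
  by rewrite mulmxBr mulmxBl !subE.
have /choice[T HT] : forall j : 'I_n, exists T, forall t, T <= t ->
    `|K t *m delta_mx j (0 : 'I_1)| <= e by move=> j; exact: Hg.
exists (\big[Num.max/0]_j T j) => t tT; apply/mx_norm_leP => [|i j]; first exact: ltW.
have -> : K t i j = (K t *m delta_mx j (0 : 'I_1)) i 0 by rewrite -colE [RHS]mxE.
apply: le_trans (ler_mx_entry _ _ _) _; apply: HT; apply: le_trans tT.
exact: le_bigmax.
Qed.

End Vanishing.

(** * Exponential stability *)

Section RegularFunctions.
Variables (R : realType) (V : normedModType R).
Implicit Types (f : R -> V) (a b c u v t : R).

(** One-sided limits bound [f] on both sides of each point, the value at the point is added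
    separately, and [interval_ind] glues the local bounds. *)
Lemma piecewise_continuous_bounded f a b : a <= b -> piecewise_continuous a b f ->
  exists M, forall t, a <= t <= b -> `|f t| <= M.
Proof.
move=> ab [_ fr fl].
apply: (@interval_ind _ (fun u v => exists M, forall t, u <= t <= v -> `|f t| <= M) _ _ ab).
  move=> u w v _ uw wv _ [M1 HM1] [M2 HM2]; exists (Num.max M1 M2) => t /andP[ut tv].
  have [tw|wt] := leP t w; rewrite le_max; apply/orP; [left; apply: HM1|right; apply: HM2].
    by rewrite ut.
  by rewrite ltW.
move=> t /andP[at_ tb].
have [d1 d10 [M1 HM1]] : exists2 d, 0 < d &
    exists M, forall s, t < s -> s < t + d -> s <= b -> `|f s| <= M.
  move: tb; rewrite le_eqVlt => /predU1P[->|tb].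
    by exists 1 => //; exists 0 => s ts _ sb; move: (lt_le_trans ts sb); rewrite ltxx.
  have /fr/cvg_ex[/= l /cvgrPdist_le/(_ 1 ltr01)[d /= d0 Hd]] : a <= t < b by rewrite at_.
  exists d => //; exists (`|l| + 1) => s ts sd _.
  have h1 : `|l - f s| <= 1.
    by apply: Hd => //=; rewrite distrC gtr0_norm ?subr_gt0//; lra.
  rewrite -[f s](subKr l); apply: le_trans (ler_normB _ _) _; lra.
have [d2 d20 [M2 HM2]] : exists2 d, 0 < d &
    exists M, forall s, s < t -> t - d < s -> a <= s -> `|f s| <= M.
  move: at_; rewrite le_eqVlt => /predU1P[<-|at_].
    by exists 1 => //; exists 0 => s ts _ sb; move: (le_lt_trans sb ts); rewrite ltxx.
  have /fl/cvg_ex[/= l /cvgrPdist_le/(_ 1 ltr01)[d /= d0 Hd]] : a < t <= b by rewrite at_.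
  exists d => //; exists (`|l| + 1) => s ts sd _.
  have h1 : `|l - f s| <= 1.
    by apply: Hd => //=; rewrite gtr0_norm ?subr_gt0//; lra.
  rewrite -[f s](subKr l); apply: le_trans (ler_normB _ _) _; lra.
exists (Num.min d1 d2) => [|u v au vb]; first by rewrite lt_min d10.
move=> tu ut tv vt; exists (Num.max `|f t| (Num.max M1 M2)) => s /andP[us sv].
have m1 : Num.min d1 d2 <= d1 by rewrite ge_min lexx.
have m2 : Num.min d1 d2 <= d2 by rewrite ge_min lexx orbT.
rewrite !le_max; have [st|ts|->] := ltgtP s t; last by rewrite lexx.
  by apply/orP; right; apply/orP; right; apply: HM2 => //; lra.
by apply/orP; right; apply/orP; left; apply: HM1 => //; lra.
Qed.

Lemma absolutely_continuousW f a b u v : a <= u -> v <= b ->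
  absolutely_continuous a b f -> absolutely_continuous u v f.
Proof.
move=> au vb H e /H[d d0 Hd]; exists d => // N p q Hpq; apply: Hd => i.
by have [? [? ?]] := Hpq i; split; [lra|split; lra].
Qed.

Lemma absolutely_continuous_subl f (c : V) a b : absolutely_continuous a b f ->
  absolutely_continuous a b (fun t => f t - t *: c).
Proof.
move=> H e e0; have e20 : 0 < e / 2 by lra.
have [d d0 Hd] := H _ e20; have c0 : 0 < `|c| + 1 by have := normr_ge0 c; lra.
exists (Num.min d (e / 2 / (`|c| + 1))) => [|N u v Huv disj].
  by rewrite lt_min d0 divr_gt0.
rewrite lt_min => /andP[s1]; rewrite ltr_pdivlMr// => s2.
have S0 : 0 <= \sum_i (v i - u i).
  by apply: sumr_ge0 => i _; have [_ [? _]] := Huv i; rewrite subr_ge0.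
apply: (@le_lt_trans _ _ (\sum_i `|f (v i) - f (u i)| + (\sum_i (v i - u i)) * `|c|)).
  rewrite mulr_suml -big_split/=; apply: ler_sum => i _; have [_ [uv _]] := Huv i.
  rewrite (_ : _ - _ = (f (v i) - f (u i)) - (v i - u i) *: c); last first.
    by rewrite scalerBl !opprD !opprK addrACA.
  apply: le_trans (ler_normB _ _) _.
  by rewrite normrZ ger0_norm ?subr_ge0.
by have := Hd N u v Huv disj s1; lra.
Qed.

End RegularFunctions.

Section Stability.
Variables (R : realType) (n m : nat) (A : 'I_m.+1 -> 'M[R]_n) (h : 'I_m.+1 -> R).
Hypothesis h_ge0 : forall j, 0 <= h j.
Hypothesis h_ord0 : h ord0 = 0.
Implicit Types (t u a b T tau e s : R) (p q r : nat).
Local Notation K := (Kfun A h).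
Local Notation H := (max_delay h).
Local Notation mu := (@lebesgue_measure R).

Section Solution.
Variables phi x : R -> 'cV[R]_n.
Hypothesis phi_pc : piecewise_continuous (- H) 0 phi.
Hypothesis x_sol : is_solution A h phi x.

Let H0 : 0 <= H. Proof. exact: max_delay_ge0. Qed.

Let rhs t : 'cV[R]_n := \sum_j A j *m x (t - h j).

Lemma init_norm_le t : - H <= t <= 0 -> enorm (phi t) <= init_norm h phi.
Proof.
move=> tH; apply: ub_le_sup; last by exists t => //=; rewrite in_itv.
have [|M HM] := piecewise_continuous_bounded _ phi_pc; first by rewrite oppr_le0.
exists (Num.sqrt n%:R * M) => _ [s /= sH <-]; move: sH; rewrite in_itv/= => sH.
by apply: le_trans (enorm_le _) _; rewrite ler_wpM2l ?sqrtr_ge0// HM.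
Qed.

Lemma init_norm_ge0 : 0 <= init_norm h phi.
Proof.
by apply: le_trans (enorm_ge0 (phi 0)) (init_norm_le _); rewrite lexx oppr_le0 H0.
Qed.

Lemma solution_init t : - H <= t <= 0 -> `|x t| <= init_norm h phi.
Proof.
move=> tH; have [_ _ _ ->//] := x_sol.
exact: le_trans (ler_norm_enorm _) (init_norm_le _).
Qed.

Let delay_range s t j : 0 <= t -> t <= s -> - H <= t - h j <= s.
Proof.
by move=> t0 ts; have := le_max_delay h_ord0 j; have := h_ge0 j; lra.
Qed.

(** The step is so short that the increment over it is at most half of the maximum reached; this
    absorbs the maximum into the bound and replaces a Gronwall inequality. *)
Lemma solution_growth_step b s : 0 <= s -> 0 <= b ->
  (forall t, - H <= t <= s -> `|x t| <= b) ->
  forall t, - H <= t <= s + (2 * (anorm A + 1))^-1 -> `|x t| <= 2 * b.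
Proof.
move=> s0 b0 Hb; set d := _^-1; have a0 := anorm_ge0 A.
have d0 : 0 < d by rewrite invr_gt0; lra.
have dE : d * (2 * (anorm A + 1)) = 1 by rewrite /d mulVf//; lra.
have [xc xac xae _] := x_sol.
have cw : {within `[s, s + d], continuous (fun t => `|x t|)}.
  have : {within `[s, s + d], continuous x}.
    apply: continuous_subspaceW xc => r /=; rewrite !in_itv/= andbT => /andP[sr _].
    exact: le_trans sr.
  by move=> cw r; apply: cvg_norm; exact: cw.
have [|c] := EVT_max _ cw; first lra.
rewrite in_itv/= => /andP[sc cd] Hc.
(* The maximum over the step exists by continuity, and both the past bound and the new values lie
   below [M], which then satisfies M <= b + M / 2. *)
pose M := Num.max b `|x c|; have M0 : 0 <= M by rewrite le_max b0.
have HM t : - H <= t <= s + d -> `|x t| <= M.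
  move=> /andP[t1 t2]; rewrite le_max; have [ts|st] := leP t s.
    by rewrite Hb// t1.
  by apply/orP; right; apply: Hc; rewrite in_itv/= ltW.
have sd0 : 0 < s + d by lra.
have : `|x c - x s| <= anorm A * M * (c - s).
  apply: ac_mvt => //; last by rewrite mulr_ge0.
    exact: absolutely_continuousW (xac _ sd0).
  apply: (@filterS _ _ (ae_filter_ringOfSetsType mu) _ _ _ xae) => t Ht /andP[st tc].
  have t0 : 0 <= t by lra.
  exists (rhs t); first exact: Ht.
  by apply: norm_Asum => j; apply: HM; apply: delay_range (le_trans tc cd).
have hs : `|x s| <= b by apply: Hb; rewrite lexx andbT (le_trans _ s0)// oppr_le0.
have hcs : anorm A * M * (c - s) <= anorm A * M * d by rewrite ler_wpM2l ?mulr_ge0//; lra.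
have hM : anorm A * M * d <= M / 2.
  have -> : anorm A * M * d = M * (anorm A * d) by ring.
  by rewrite ler_wpM2l//; lra.
move=> hc; have hx : `|x c| <= b + M / 2.
  by rewrite -[x c](subrK (x s)); apply: le_trans (ler_normD _ _) _; lra.
have M2b : M <= 2 * b.
  by move: hx hM; rewrite /M; case: (leP b `|x c|) => ? *; lra.
by move=> t /HM/le_trans; apply.
Qed.

Lemma solution_growth k t :
  - H <= t <= k%:R * (2 * (anorm A + 1))^-1 -> `|x t| <= 2 ^+ k * init_norm h phi.
Proof.
elim: k t => [|k IH] t; first by rewrite mul0r mul1r; exact: solution_init.
rewrite -natr1 mulrDl mul1r exprS -mulrA => tk.
apply: solution_growth_step tk; last exact: IH.
  by rewrite mulr_ge0// invr_ge0; have := anorm_ge0 A; lra.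
by rewrite mulr_ge0 ?exprn_ge0// init_norm_ge0.
Qed.

Lemma solution_continuous t : 0 < t -> {for t, continuous x}.
Proof.
move=> t0; have [xc _ _ _] := x_sol.
have : {within `]0, +oo[, continuous x}.
  by apply: continuous_subspaceW xc => r /=; rewrite !in_itv/= !andbT; exact: ltW.
rewrite continuous_open_subspace; last exact: interval_open.
by apply; rewrite inE/= in_itv/= andbT.
Qed.

(** After time H all delayed arguments are positive, where [x] is continuous. The right-hand side is
    then continuous, and the mean value inequality for [x] minus its linear part upgrades the
    equation from almost every time to every time. *)
Lemma solution_derive t : H < t -> is_derive t 1 x (rhs t).
Proof.
move=> Ht; have [_ xac xae _] := x_sol; have t0 : 0 < t by exact: le_lt_trans H0 Ht.
have crhs : {for t, continuous rhs}.
  apply: continuous_sumr => j _; apply: (continuous_mulmx (F := cst (A j))).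
    exact: cst_continuous.
  apply: continuous_affine; apply: solution_continuous.
  by have := le_max_delay h_ord0 j; lra.
apply/is_deriveP => e e0; have /continuous_distP/(_ e e0)[d d0 Hd] := crhs.
have main u v : 0 <= u -> u <= v -> t - d < u -> v < t + d ->
    `|(x v - v *: rhs t) - (x u - u *: rhs t)| <= e * (v - u).
  move=> u0 uv tu vt; pose f (w : R) := x w - w *: rhs t; rewrite -/(f v) -/(f u).
  apply: ac_mvt => //; last exact: ltW.
    apply: absolutely_continuous_subl.
    have v10 : 0 < v + 1 by lra.
    by apply: absolutely_continuousW (xac _ v10); lra.
  apply: (@filterS _ _ (ae_filter_ringOfSetsType mu) _ _ _ xae) => r Hr /andP[ur rv].
  have r0 : 0 <= r by lra.
  exists (rhs r - 1 *: rhs t); last by rewrite scale1r; apply: Hd; rewrite ltr_norml; lra.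
  apply: is_derive_subf; first exact: Hr.
  apply/is_deriveP => e' e'0; exists 1 => // y _.
  rewrite scale1r -scalerBl -scalerBl subrr scale0r normr0.
  by rewrite mulr_ge0// ltW.
exists (Num.min d t) => [|s]; first by rewrite lt_min d0; lra.
rewrite lt_min => /andP[sd st].
have s0 : 0 <= s by move: st; rewrite ltr_norml; lra.
move: sd; rewrite ltr_norml => /andP[sd1 sd2].
have eqd : x s - x t - (s - t) *: rhs t = (x s - s *: rhs t) - (x t - t *: rhs t).
  by rewrite scalerBl; apply/matrixP => i j; rewrite !mxE; ring.
rewrite eqd; have [ts|st'] := leP t s.
  by rewrite ger0_norm ?subr_ge0//; apply: main => //; lra.
by rewrite distrC ltr0_norm ?subr_lt0// (opprB s t); apply: main => //; lra.
Qed.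

(* Variation of constants from time [b] on. *)
Lemma solution_propagation b T c k : 0 < b -> H <= b -> 0 <= T -> 0 <= c -> 0 <= k ->
  (forall t, b - H <= t <= b -> `|x t| <= c) ->
  (forall t, T - H <= t <= T -> `|K t| <= k) ->
  `|x (b + T)| <= (n%:R + H * (n%:R * anorm A)) * k * c.
Proof.
move=> b0 Hb T0 c0 k0 Hc Hk.
(* Before time -H the function [x] is arbitrary, so the shifted solution is cut there; the memory
   never looks further back. [yb] is instead frozen at its initial value before 0. *)
pose y t : 'cV[R]_n := if t < - H then 0 else x (t - - b).
pose yb t := x (Num.max (t + b) b).
have yE t : - H <= t -> y t = x (t - - b) by move=> tH; rewrite /y ltNge tH.
have cyb : continuous yb.
  move=> t; have cx : {for Num.max (t + b) b, continuous x}.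
    by apply: solution_continuous; rewrite lt_max b0 orbT.
  apply/continuous_distP => e e0; have /continuous_distP/(_ e e0)[d d0 Hd] := cx.
  exists d => // s sd; apply: Hd; apply: le_lt_trans sd.
  rewrite ler_norml.
  have := ler_norm (s - t); have := ler_norm (t - s); rewrite (distrC t s).
  by case: (leP (s + b) b); case: (leP (t + b) b) => *; lra.
have Hy : pwc y.
  split.
    exists [:: - H] => t; rewrite inE => tH.
    have [tlt|tgt] : t < - H \/ - H < t by move: tH; case: ltgtP; auto.
      apply: (is_derive_continuous (l := 0)).
      apply: (@is_derive_near _ _ (cst 0) _ _ _ (- H - t)); first lra.
      by move=> s; rewrite ltr_norml => /andP[_ st]; rewrite /y ifT//; lra.
    have cx : {for t, continuous (fun t => x (t - - b))}.
      by apply: continuous_affine; apply: solution_continuous; lra.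
    apply/continuous_distP => e e0; have /continuous_distP/(_ e e0)[d d0 Hd] := cx.
    exists (Num.min d (t + H)) => [|s]; first by rewrite lt_min d0; lra.
    rewrite lt_min => /andP[sd st]; have sH : - H <= s.
      by move: st; rewrite ltr_norml => /andP[st _]; lra.
    by rewrite !yE ?(ltW tgt)//; exact: Hd.
  move=> B; pose d := (2 * (anorm A + 1))^-1.
  have d0 : 0 < d by rewrite invr_gt0; have := anorm_ge0 A; lra.
  pose N := (Num.truncn ((B + b) / d)).+1.
  have HN : B + b < N%:R * d.
    by have := truncnS_gt ((B + b) / d); rewrite ltr_pdivrMr.
  exists (2 ^+ N * init_norm h phi) => t; rewrite ler_norml => /andP[t1 t2].
  have [tH|tH] := leP (- H) t; last first.
    by rewrite /y tH normr0 mulr_ge0 ?exprn_ge0// init_norm_ge0.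
  rewrite yE//; apply: solution_growth; rewrite opprK -/d.
  have hH := max_delay_ge0 h.
  by apply/andP; split; [lra|apply: ltW; apply: le_lt_trans HN; rewrite lerD2r].
have dy t : 0 < t < T -> t \notin [::] ->
    is_derive t 1 yb (\sum_j A j *m y (t - h j)) /\ yb t = y t.
  move=> /andP[t0 tT] _; have hH := max_delay_ge0 h; split; last first.
    rewrite yE; last lra.
    by rewrite /yb max_l ?opprK//; lra.
  apply: (@is_derive_near _ _ (fun s => x (s - - b)) _ _ _ t) => //.
    move=> s; rewrite ltr_norml => /andP[st _]; rewrite /yb max_l ?opprK//; lra.
  have -> : \sum_j A j *m y (t - h j) = rhs (t - - b).
    apply: eq_bigr => j _; rewrite yE; last first.
      by have := le_max_delay h_ord0 j; lra.
    by congr (_ *m x _); ring.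
  by apply: is_derive_affine; apply: solution_derive; lra.
have := variation_of_constants h_ge0 T0 Hy cyb dy.
rewrite /yb add0r maxxx max_l; last lra.
rewrite [T + b]addrC => ->; apply: le_trans (ler_normD _ _) _.
rewrite !mulrDl; apply: lerD.
  apply: le_trans (ler_norm_mulmx _ _) _; rewrite ler_pM ?mulr_ge0//.
    by rewrite ler_wpM2l// Hk// lexx andbT; have := max_delay_ge0 h; lra.
  by apply: Hc; rewrite lexx andbT; have := max_delay_ge0 h; lra.
apply: memory_bound => //; first exact: pwc_Kfun.
- by move=> j; exact: le_max_delay.
- by move=> t; rewrite subr0; exact: Hk.
- by move=> t /andP[t1 t2]; rewrite yE; [apply: Hc|]; lra.
Qed.

End Solution.

(** Rounding the number of elapsed periods down costs at most one factor [expR 1]. *)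
Lemma expR_truncn (t d : R) : 0 <= t -> 0 < d ->
  expR (-1) ^+ Num.truncn (t / d) <= expR 1 * expR (- (d^-1 * t)).
Proof.
move=> t0 d0; rewrite -expRM_natl -expRD ler_expR mulrN1.
have : t / d < (Num.truncn (t / d)).+1%:R by exact: truncnS_gt.
by rewrite -natr1 [d^-1 * t]mulrC; lra.
Qed.

(** Every period [th'] multiplies the bound on the tail of a solution by exp(-1), which yields the
    rate [th'^-1]. *)
Lemma Kfun_vanish_stable : 0 < H ->
  (forall e, 0 < e -> exists T, forall t, T <= t -> `|K t| <= e) ->
  exponentially_stable A h.
Proof.
move=> H0 K_vanish; have a0 := anorm_ge0 A.
pose C := n%:R + H * (n%:R * anorm A).
have C0 : 0 <= C by rewrite addr_ge0 ?mulr_ge0// ltW.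
have [T0 /(Kfun_bounded h_ge0)[MK MK0 HMK]] := K_vanish 1 ltr01.
have q0 := expR_gt0 (-1 : R); set q := expR (-1) in q0.
have e0 : 0 < q / (C + 1) by apply: divr_gt0 => //; lra.
have [T1 HT1] := K_vanish _ e0; set e := q / _ in e0 HT1.
have eC : C * e <= q by rewrite /e mulrA ler_pdivrMr; nra.
(* After [th] the whole window of K in the propagation bound lies beyond [T1]; the further H in
   [th'] lets the solution build a complete history on which the bound of the preceding period
   holds. *)
pose th := Num.max 0 T1 + H; pose th' := th + H.
have th0 : 0 <= th by rewrite addr_ge0 ?le_max ?lexx// ltW.
have thT : T1 <= th - H by rewrite addrK le_max lexx orbT.
have th'0 : 0 < th' by rewrite /th'; lra.
pose d := (2 * (anorm A + 1))^-1.
have d0 : 0 < d by rewrite invr_gt0; lra.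
pose N := (Num.truncn (H / d)).+1.
have HN : H < N%:R * d by have := truncnS_gt (H / d); rewrite ltr_pdivrMr.
pose B0 : R := 2 ^+ N; have B00 : 0 <= B0 by rewrite exprn_ge0.
(* [B0] bounds the growth up to time H, and the second term bounds all later times by propagation
   from H with K bounded by [MK]. *)
pose B := B0 + C * MK * B0; have B_ge0 : 0 <= B by rewrite addr_ge0 ?mulr_ge0.
have g0 : 0 <= Num.sqrt n%:R * B * expR 1 :> R.
  by rewrite !mulr_ge0 ?sqrtr_ge0 ?expR_ge0.
exists (1 + Num.sqrt n%:R * B * expR 1), th'^-1; split; [lra|by rewrite invr_gt0|].
move=> phi x pc sol t t0; have b0 := init_norm_ge0 pc; set beta := init_norm h phi in b0 *.
have main k s : k%:R * th' <= s -> `|x s| <= B * beta * q ^+ k.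
  elim: k s => [|k IH] s.
    rewrite mul0r expr0 mulr1 => s0; rewrite /B mulrDl.
    have HB w : - H <= w <= H -> `|x w| <= B0 * beta.
      move=> /andP[r1 r2]; rewrite /B0 /beta; apply: (solution_growth pc sol).
      by rewrite r1/=; apply: le_trans r2 _; exact: ltW.
    have [sH|sH] := leP s H.
      apply: le_trans (HB s _) _; first by rewrite sH andbT; lra.
      by rewrite lerDl !mulr_ge0.
    have -> : s = H + (s - H) by ring.
    apply: le_trans (solution_propagation pc sol H0 (lexx _) _
      (mulr_ge0 B00 b0) MK0 _ _) _.
    - lra.
    - by move=> w wH; apply: HB; lra.
    - by move=> *; exact: HMK.
    - by rewrite -!mulrA lerDr mulr_ge0.
  rewrite -natr1 mulrDl mul1r => ks.
  have kth : 0 <= k%:R * th' by rewrite mulr_ge0// ltW.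
  pose b := k%:R * th' + H.
  have -> : s = b + (s - b) by rewrite /b; ring.
  have c0 : 0 <= B * beta * q ^+ k by rewrite !mulr_ge0// exprn_ge0// ltW.
  apply: le_trans (solution_propagation pc sol _ _ _ c0 (ltW e0) _ _) _.
  - by rewrite /b; lra.
  - by rewrite /b; lra.
  - by rewrite /b; move: ks; rewrite /th'; lra.
  - by move=> w /andP[r1 _]; apply: IH; move: r1; rewrite /b; lra.
  - move=> w /andP[r1 _]; apply: HT1; apply: le_trans thT _.
    by apply: le_trans r1; rewrite /b; move: ks; rewrite /th'; lra.
  - by rewrite -/C exprS [leRHS]mulrCA; apply: ler_wpM2r.
have k1 : (Num.truncn (t / th'))%:R * th' <= t.
  by rewrite -ler_pdivlMr//; rewrite truncn_le divr_ge0// ltW.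
apply: le_trans (enorm_le _) _.
apply: (@le_trans _ _ (Num.sqrt n%:R * (B * beta * (expR 1 * expR (- (th'^-1 * t)))))).
  rewrite ler_wpM2l ?sqrtr_ge0//; apply: le_trans (main _ _ k1) _.
  by rewrite ler_wpM2l ?mulr_ge0//; exact: expR_truncn.
rewrite (_ : Num.sqrt _ * _ = Num.sqrt n%:R * B * expR 1 * expR (- (th'^-1 * t)) * beta);
  last by ring.
by rewrite ler_wpM2r// ler_wpM2r ?expR_ge0// lerDr.
Qed.

End Stability.

(** * Eigenvalues *)

Lemma is_derive_dilate (R : realType) (f : R -> R) (c t l : R) :
  is_derive (c * t) 1 f l -> is_derive t 1 (fun s => f (c * s)) (c * l).
Proof.
move=> /is_deriveP H; apply/is_deriveP => e e0.
have c0 : 0 < `|c| + 1 by have := normr_ge0 c; lra.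
have e'0 : 0 < e / (`|c| + 1) by exact: divr_gt0.
have [d d0 Hd] := H _ e'0; exists (d / (`|c| + 1)) => [|s]; first exact: divr_gt0.
rewrite ltr_pdivlMr// => sd.
have E : c * s - c * t = c * (s - t) by rewrite mulrBr.
have := Hd (c * s); rewrite E normrM.
have -> : (c * (s - t)) *: l = (s - t) *: (c * l).
  by rewrite -[LHS]/(c * (s - t) * l) -[RHS]/((s - t) * (c * l)); ring.
have st0 := normr_ge0 (s - t).
move=> /(_ ltac:(nra)) /le_trans; apply.
have ee : e / (`|c| + 1) * (`|c| + 1) = e by rewrite divfK// gt_eqF.
by set e' := e / _ in ee e'0 *; rewrite mulrA ler_wpM2r//; nra.
Qed.

Section Eigenvalues.
Variables (R : realType) (n m : nat) (A : 'I_m.+1 -> 'M[R]_n) (h : 'I_m.+1 -> R).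
Hypothesis h_ge0 : forall j, 0 <= h j.
Hypothesis h_ord0 : h ord0 = 0.
Implicit Types (t u T e x y : R).
Local Notation H := (max_delay h).
Local Open Scope complex_scope.

Section Mode.
Variables (al om : R).

(* The real part of [exp ((al + i om) t) (x + i y)]. *)
Definition mode x y t := expR (al * t) * (cos (om * t) * x - sin (om * t) * y).

Lemma is_derive_mode x y t :
  is_derive t 1 (mode x y) (al * mode x y t - om * mode y (- x) t).
Proof.
have dE := is_derive_dilate (c := al) (is_derive_expR (al * t)).
have dC := is_derive_dilate (c := om) (is_derive_cos (om * t)).
have dS := is_derive_dilate (c := om) (is_derive_sin (om * t)).
have dC' := @is_derive_scalef R R x _ t _ dC.
have dS' := @is_derive_scalef R R y _ t _ dS.
have dM := @is_deriveM _ _ (fun s => expR (al * s))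
  (fun s => x *: cos (om * s) - y *: sin (om * s)) t 1 _ _ dE (is_derive_subf dC' dS').
apply: (@is_derive_near _ _ ((fun s => expR (al * s)) *
  (fun s => x *: cos (om * s) - y *: sin (om * s))) _ _ _ 1) => //.
  move=> s _; rewrite /mode -[LHS]/(expR (al * s) * (x * cos (om * s) - y * sin (om * s))).
  by ring.
apply: (is_derive_eq dM); rewrite /mode /GRing.scale/=; ring.
Qed.

Lemma mode_shift x y s t : mode x y (t - s) =
  expR (al * t) * (cos (om * t) * mode x y (- s) - sin (om * t) * mode y (- x) (- s)).
Proof.
rewrite /mode mulrBr -mulrBr [al * (t - s)]mulrBr -[_ - al * s]/(_ + - (al * s)) expRD.
rewrite [om * (t - s)]mulrBr cosB sinB !mulrN cosN sinN; ring.
Qed.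

Lemma mode_sqr x y t :
  mode x y t ^+ 2 + mode y (- x) t ^+ 2 = expR (al * t) ^+ 2 * (x ^+ 2 + y ^+ 2).
Proof.
rewrite /mode !exprMn -mulrDr; congr (_ * _).
have := cos2Dsin2 (om * t); set c := cos _; set s := sin _ => E.
have -> : (c * x - s * y) ^+ 2 + (c * y - s * - x) ^+ 2 =
  (c ^+ 2 + s ^+ 2) * (x ^+ 2 + y ^+ 2) by ring.
by rewrite E mul1r.
Qed.

(** Replacing (x, y) by (y, -x) turns the real part into the imaginary part; a single real family
    [mode] thus serves both. *)
Lemma ReM_cexp t x y :
  (cexp (- ((al +i* om) * t%:C)) * (x +i* y)) = mode x y (- t) +i* mode y (- x) (- t).
Proof.
rewrite /cexp; simpc; rewrite /= /mode !mulrN.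
by congr (_ +i* _); ring.
Qed.

End Mode.

Lemma Re_sum I (r : seq I) (P : pred I) (F : I -> R[i]) :
  complex.Re (\sum_(i <- r | P i) F i) = \sum_(i <- r | P i) complex.Re (F i).
Proof. by apply: big_morph => // -[? ?] [? ?]. Qed.

Lemma Im_sum I (r : seq I) (P : pred I) (F : I -> R[i]) :
  complex.Im (\sum_(i <- r | P i) F i) = \sum_(i <- r | P i) complex.Im (F i).
Proof. by apply: big_morph => // -[? ?] [? ?]. Qed.

Lemma eigenvector_real (al om : R) : is_eigenvalue A h (al +i* om) ->
  exists a b : 'cV[R]_n, (exists i, a i 0 ^+ 2 + b i 0 ^+ 2 != 0) /\
   forall i, al * a i 0 - om * b i 0 =
     \sum_j \sum_k A j i k * mode al om (a k 0) (b k 0) (- h j) /\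
    al * b i 0 + om * a i 0 =
     \sum_j \sum_k A j i k * mode al om (b k 0) (- a k 0) (- h j).
Proof.
rewrite /is_eigenvalue; set M := (_ - _) => /eqP.
rewrite -det_tr => /det0P[v v0 vM].
have [w [i0 wi0] Mw] : exists2 w : 'cV_n, exists k, w k 0 != 0 & M *m w = 0.
  exists v^T; last by rewrite -[M]trmxK -trmx_mul vM trmx0.
  by have /rV0Pn[k vk] := v0; exists k; rewrite mxE.
exists (map_mx (@complex.Re R) w), (map_mx (@complex.Im R) w).
have wE l : w l 0 = complex.Re (w l 0) +i* complex.Im (w l 0) by case: (w l 0).
split.
  exists i0; rewrite !mxE.
  apply: contra wi0; rewrite paddr_eq0 ?sqr_ge0// !sqrf_eq0 => /andP[/eqP vr /eqP vi].
  by rewrite wE vr vi.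
move=> i.
have E : (al +i* om) * w i 0 = \sum_j \sum_k (A j i k)%:C *
    (mode al om (complex.Re (w k 0)) (complex.Im (w k 0)) (- h j) +i*
     mode al om (complex.Im (w k 0)) (- complex.Re (w k 0)) (- h j)).
  move/matrixP/(_ i 0): Mw; rewrite /M mulmxBl [LHS]mxE mul_scalar_mx [X in X + _]mxE.
  rewrite [X in _ + X]mxE mulmx_suml summxE [RHS]mxE => /eqP; rewrite subr_eq0 => /eqP ->.
  apply: eq_bigr => j _; rewrite -scalemxAl mxE mxE mulr_sumr; apply: eq_bigr => k _.
  by rewrite mxE mulrCA {1}(wE k) ReM_cexp.
rewrite !mxE; split.
  move/(congr1 (@complex.Re R)): E; rewrite {1}(wE i) /= => ->.
  rewrite Re_sum; apply: eq_bigr => j _; rewrite Re_sum; apply: eq_bigr => k _.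
  by rewrite !mxE /= mul0r subr0.
move/(congr1 (@complex.Im R)): E; rewrite {1}(wE i) /= => ->.
rewrite Im_sum; apply: eq_bigr => j _; rewrite Im_sum; apply: eq_bigr => k _.
by rewrite !mxE /= mul0r addr0.
Qed.

Lemma mode_solution (al om : R) (a b : 'cV[R]_n) :
  (forall i, al * a i 0 - om * b i 0 =
     \sum_j \sum_k A j i k * mode al om (a k 0) (b k 0) (- h j)) ->
  (forall i, al * b i 0 + om * a i 0 =
     \sum_j \sum_k A j i k * mode al om (b k 0) (- a k 0) (- h j)) ->
  let x t := \col_i mode al om (a i 0) (b i 0) t in
  is_solution A h x x /\ piecewise_continuous (- H) 0 x.
Proof.
move=> Ha Hb x.
have dx t : is_derive t 1 x (\sum_j A j *m x (t - h j)).
  apply/is_derive_mxP => i j; rewrite (ord1 j).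
  rewrite (_ : (fun s => _) = mode al om (a i 0) (b i 0)); last first.
    by apply/funext => s; rewrite mxE.
  apply: (is_derive_eq (is_derive_mode al om (a i 0) (b i 0) t)).
  transitivity (expR (al * t) * (cos (om * t) * (al * a i 0 - om * b i 0) -
      sin (om * t) * (al * b i 0 + om * a i 0))).
    by rewrite /mode; ring.
  rewrite Ha Hb summxE !mulr_sumr -sumrB mulr_sumr; apply: eq_bigr => l _.
  rewrite !mulr_sumr -sumrB mulr_sumr mxE; apply: eq_bigr => k _.
  by rewrite [x _ _ _]mxE mode_shift; ring.
have cx : continuous x by move=> t; exact: is_derive_continuous (dx t).
split; first by apply: (@is_solutionI _ _ _ A h h_ge0 h_ord0 x x [::]) => //; exact: pwc_continuous.
split.
- by exists [::] => t _ _; exact: cx.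
- by move=> t _; apply/cvg_ex; exists (x t); apply: cvg_at_right_filter; exact: cx.
- by move=> t _; apply/cvg_ex; exists (x t); apply: cvg_at_left_filter; exact: cx.
Qed.

Lemma stable_eigenvalue (s : R[i]) : exponentially_stable A h -> is_eigenvalue A h s ->
  complex.Re s < 0.
Proof.
case: s => al om [g [sg [g1 sg0 Hst]]] /eigenvector_real[a [b [[i abi] Hab]]] /=.
rewrite ltNge; apply/negP => al0.
have [sol1 pc1] := mode_solution (fun i => (Hab i).1) (fun i => (Hab i).2).
(* The imaginary part is a solution too. Both are needed, since one of them may vanish at the chosen
   time, while the sum of their squares cannot. *)
have [sol2 pc2] : let x t := \col_i mode al om (b i 0) ((- a) i 0) t in
    is_solution A h x x /\ piecewise_continuous (- H) 0 x.
  apply: mode_solution => k.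
    rewrite mxE mulrN opprK (Hab k).2; apply: eq_bigr => j _; apply: eq_bigr => l _.
    by rewrite mxE.
  have -> : al * (- a) k 0 + om * b k 0 = - (al * a k 0 - om * b k 0) by rewrite mxE; ring.
  rewrite (Hab k).1 -sumrN; apply: eq_bigr => j _; rewrite -sumrN; apply: eq_bigr => l _.
  by rewrite mxE /mode; ring.
set x1 := fun t => _ in sol1 pc1; set x2 := fun t => _ in sol2 pc2.
pose C1 := g * init_norm h x1; pose C2 := g * init_norm h x2.
have H1 t : 0 <= t -> `|mode al om (a i 0) (b i 0) t| <= C1 * expR (- (sg * t)).
  move=> t0; have := ler_enorm_entry (x1 t) i; rewrite mxE => /le_trans; apply.
  by apply: le_trans (Hst _ _ pc1 sol1 t t0) _; rewrite /C1 mulrAC.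
have H2 t : 0 <= t -> `|mode al om (b i 0) (- a i 0) t| <= C2 * expR (- (sg * t)).
  move=> t0; have := ler_enorm_entry (x2 t) i; rewrite mxE [(- a) i 0]mxE => /le_trans; apply.
  by apply: le_trans (Hst _ _ pc2 sol2 t t0) _; rewrite /C2 mulrAC.
pose r := a i 0 ^+ 2 + b i 0 ^+ 2.
have r0 : 0 < r by rewrite lt_neqAle eq_sym abi addr_ge0 ?sqr_ge0.
pose D := C1 ^+ 2 + C2 ^+ 2; have D0 : 0 <= D by rewrite addr_ge0 ?sqr_ge0.
(* At this time sg t = 1 + D / r. With e (1 + sg t) <= 1 this gives D e < r, whereas a nonnegative
   real part would force r <= D e^2 <= D e. *)
pose t := (D + r) / (r * sg).
have t0 : 0 <= t by rewrite divr_ge0 ?mulr_ge0 ?ltW// ltr_wpDl.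
have e0 := expR_ge0 (- (sg * t)); set e := expR _ in e0.
have e1 : e <= 1 by rewrite -expR0 ler_expR oppr_le0 mulr_ge0// ltW.
have hr : r <= expR (al * t) ^+ 2 * r.
  rewrite ler_peMl ?(ltW r0)//; apply: exprn_ege1.
  by rewrite -expR0 ler_expR mulr_ge0.
have hD : expR (al * t) ^+ 2 * r <= D * e ^+ 2.
  rewrite /r -(mode_sqr al om) mulrDl -!exprMn; apply: lerD.
    by rewrite -[leLHS]real_normK ?num_real// lerXn2r ?nnegrE// ?H1// (le_trans _ (H1 _ t0)).
  by rewrite -[leLHS]real_normK ?num_real// lerXn2r ?nnegrE// ?H2// (le_trans _ (H2 _ t0)).
have he : e * (1 + sg * t) <= 1.
  have := expR_ge1Dx (sg * t); have := expR_gt0 (sg * t).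
  by rewrite /e expRN => h1 h2; rewrite mulrC ler_pdivrMr// mul1r.
have sgt : sg * t = (D + r) / r.
  by rewrite /t; field; rewrite !gt_eqF.
have : r * (sg * t) = D + r by rewrite sgt mulrCA divff ?mulr1// gt_eqF.
move: hr hD he; set q := expR (al * t) ^+ 2 * r; set u := sg * t => hr hD he hu.
have : D * e ^+ 2 <= D * e by rewrite ler_wpM2l// expr2 ler_piMl.
nra.
Qed.

Lemma stable_lyapunov_condition : exponentially_stable A h -> lyapunov_condition A h.
Proof.
move=> st [s1 [s2 [/(stable_eigenvalue st) h1 /(stable_eigenvalue st) h2 /eqP]]].
case: s1 s2 h1 h2 => [a1 b1] [a2 b2] /= h1 h2; rewrite eq_complex /= => /andP[/eqP h3 _].
by lra.
Qed.

End Eigenvalues.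

Theorem theorem4 (R : realType) (n m : nat)
    (A : 'I_m.+1 -> 'M[R]_n) (h : 'I_m.+1 -> R)
    (h_ord0 : h ord0 = 0)
    (h_gt0 : forall k, k != ord0 -> 0 < h k)
    (A_neq0 : exists2 k, k != ord0 & A k != 0)
    (W : 'M[R]_n) (W_posdef : posdefmx W)
    (U : R -> 'M[R]_n)
    (U_lyapunov : lyapunov_condition A h -> is_delay_lyapunov_matrix A h W U) :
  (exponentially_stable A h <->
     lyapunov_condition A h /\
     forall r : nat, (0 < r)%N -> posdefmx (Kmx h U r)) /\
  (lyapunov_condition A h -> ~ exponentially_stable A h ->
     exists2 r : nat, (0 < r)%N & ~ possemidefmx (Kmx h U r)).
Proof.
have h_ge0 j : 0 <= h j.
  by have [->|/h_gt0/ltW//] := eqVneq j ord0; rewrite h_ord0.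
have H_gt0 : 0 < max_delay h.
  by have [k k0 _] := A_neq0; exact: lt_le_trans (h_gt0 k k0) (le_max_delay h_ord0 k).
(* Asking only for semidefiniteness lets this implication serve twice: for the converse, and by
   contraposition for the last claim. *)
have psd_stable : lyapunov_condition A h ->
    (forall r, (0 < r)%N -> possemidefmx (Kmx h U r)) -> exponentially_stable A h.
  move=> /U_lyapunov HU psd; apply: Kfun_vanish_stable => //.
  exact: (psd_Kfun_vanish h_ge0 h_ord0 H_gt0 W_posdef HU).
split; first split.
- move=> st; have lyap := stable_lyapunov_condition h_ge0 h_ord0 st; split=> // r _.
  apply: (Kmx_posdef h_ge0 h_ord0 W_posdef (U_lyapunov lyap)) => //.
  exact: Kfun_vanish.
- move=> [lyap pos]; apply: psd_stable => // r r0; have [sym pos_r] := pos r r0.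
  by split=> // v; have [->|/pos_r/ltW//] := eqVneq v 0; rewrite mulmx0 mxE.
- move=> lyap nst; apply: contrapT => nex; apply: nst; apply: psd_stable => // r r0.
  by apply: contrapT => npsd; apply: nex; exists r.
Qed.
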